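(* Let $\beta>2$, $d>0$ and $0<\alpha<1$ be constants, let $G$ be the random power law DAG with these parameters (source $v$), and write $g_j=g_j(G,v)$. Let $\omega=\omega(n)$ be a function tending to infinity as $n\to\infty$. Let $$\gamma=d^{\beta-1}\left(\frac{\beta-2}{\beta-1}\right)^{\beta-2}\left(\left(1+\left(d\frac{\beta-2}{\beta-1}\right)^{1-\beta}\right)^{\frac{\beta-2}{\beta-1}}-1\right)$$ if $\frac1\alpha-\beta+3\in\mathbb{N}^+\setminus\{1,2\}$, and $\gamma=1$ otherwise. Let $j_1$ be the largest integer satisfying $j_1\le\max\{\frac1\alpha-\beta+3,2\}$. Let $j_2=O(\log\log n)$ be the largest integer such that $$d^{\beta-1}\left(\frac{\gamma}{d^{\beta-1}}n^{\alpha(j_1-1)-1}\right)^{\left(\frac{\beta-2}{\beta-1}\right)^{j_2-j_1}}\le(\omega\log\log n)^{-\max\{2,(\beta-1)^2\}}.$$ Let $$\xi=\left(\frac{\beta-2}{\beta-1}\right)d\left(\left(\frac{d(\beta-2)}{\beta-1}\right)^{\beta-1}+1\right)^{-\frac1{\beta-1}}.$$ Define $\bar w_0=\bar w_1=M=n^\alpha$; for $2\le j<\frac1\alpha-\beta+3$, $$\bar w_j=\begin{cases} n^\alpha & \text{if } 2\le j<\frac1\alpha-\beta+2,\\ \xi n^\alpha & \text{if } 2\le j=\frac1\alpha-\beta+2,\\ \left(\frac{\beta-2}{\beta-1}\right)d\, n^{\frac{1-\alpha(j-1)}{\beta-1}} & \text{if } \frac1\alpha-\beta+2<j<\frac1\alpha-\beta+3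 \text{ and } j\ge2;\end{cases}$$ and for $j_1\le j\le j_2-1$, $$\bar w_j=\left(\frac{\beta-2}{\beta-1}\right)\left(\frac{\gamma}{d^{\beta-1}}n^{\alpha(j_1-1)-1}\right)^{-\left(\frac{\beta-2}{\beta-1}\right)^{j-j_1}/(\beta-1)}.$$ Then for $1\le j\le j_2-1$, a.a.s. $$(1+o(1))\bar w_j\le g_j\le(1+o(1))\bar w_{j-1}.$$
   Context: Seepage game: let $G$ be a finite directed acyclic graph (DAG) and $v$ a node (the source). For $i\in\mathbb{N}$ let $L_i=\{u\in V(G):\mathrm{dist}(u,v)=i\}$ (directed distance from $v$). For $j\in\mathbb{N}^+$ with $L_j\neq\emptyset$ and real $r>0$, the game $\mathcal{G}(G,v,j,r)$ is played by the sludge and the greens in discrete time-steps; at time-step $t$ the greens protect exactly $r_t=\lfloor rt\rfloor-\lfloor r(t-1)\rfloor$ new nodes. The sludge starts at $v_1=v$, then the greens protect $r_1$ nodes of $G\setminus\{v\}$. At each time $t\ge2$, the sludge moves along a directed edge from $v_{t-1}$ to a non-protected out-neighbour $v_t$, and then the greens protect $r_t$ nodes that are neither protected nor contaminated (visited by the sludge). Protected nodes stay protected. The game ends when the sludge cannot move; the sludge wins if it reaches a node of $L_j$, otherwise the greens win. The green number is $g_j(G,v)=\inf\{r\in\mathbb{R}^+:\text{the greens win }\mathcal{G}(G,v,j,r)\}$. Random DAG model with parameters $n$ and a sequence $(w_1,w_2,\dots)$ of non-negative weights: $L_0=\{v\}$. Inductively, once $L_0,\dots,L_k$ exist, their nodes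 are labelled $v_1=v,v_2,\dots$ layer by layer, so $L_k=\{v_{d_{k-1}+1},\dots,v_{d_k}\}$ with $d_k=\sum_{i=0}^k|L_i|$. Take a new set $S$ of $n$ nodes; each $v_i\in L_k$ independently generates $\max\{w_i-\deg^-(v_i),0\}$ directed edges from $v_i$ to $S$, each endpoint uniform in $S$, independently. Nodes of $S$ chosen at least once form $L_{k+1}$. The random power law DAG with parameters $\beta>2$, $d>0$, $0<\alpha<1$ uses $M=n^\alpha$, $i_0=n\left(\frac dM\frac{\beta-2}{\beta-1}\right)^{\beta-1}$, $c=\left(\frac{\beta-2}{\beta-1}\right)dn^{\frac1{\beta-1}}$ and $w_i=c(i_0+i-1)^{-\frac1{\beta-1}}$ for $i\ge1$. Asymptotics are as $n\to\infty$; a.a.s. means with probability tending to $1$. *)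

(* Defs.v *)
From HB Require Import structures.
From mathcomp Require Import all_boot all_order all_algebra.
From mathcomp Require Import all_classical all_reals all_analysis.
From mathcomp Require Import lra.
Set Implicit Arguments.
Unset Strict Implicit.
Unset Printing Implicit Defensive.
Import Order.TTheory GRing.Theory Num.Theory.
Import numFieldNormedType.Exports.
Local Open Scope ring_scope.

Record dag (T : finType) := Dag {
  dvert : {set T};
  darc : rel T;
  darc_vert : forall x y, darc x y -> (x \in dvert) && (y \in dvert);
  darc_acyclic : forall x p, path darc x p -> p != [::] -> last x p != x }.

Definition walk_of_length (T : finType) (e : rel T) (i : nat) (v u : T) : bool :=
  [exists p : i.-tuple T, path e v p && (last v p == u)].

Definition dist_layer (T : finType) (G : dag T) (v : T) (i : nat) : {set T} :=
  [set u in dvert G | walk_of_length (darc G) i v u &&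
                      [forall m : 'I_i, ~~ walk_of_length (darc G) m v u]].

Definition greens_rate (R : realType) (r : R) (t : nat) : nat :=
  (Num.truncn (r * t%:R) - Num.truncn (r * t.-1%:R))%N.

(* [greens_win_from G v j r t u P C]: the sludge has just arrived at u at     *)
(* time t, P is the protected set, C the contaminated set (u included), the   *)
(* greens are to play and can force a win. If fewer than r_t nodes are        *)
(* available the greens take all of them. The sludge must move as long as it  *)
(* can; the greens have won when the quantification over w is empty. Plays on *)
(* a DAG are finite, so the least fixpoint is the right one.                  *)
Inductive greens_win_from (R : realType) (T : finType) (G : dag T) (v : T)
    (j : nat) (r : R) : nat -> T -> {set T} -> {set T} -> Prop :=
| GreensMove (t : nat) (u : T) (P C Q : {set T}) :
    u \notin dist_layer G v j ->
    Q \subset dvert G :\: (P :|: C) ->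
    #|Q| = minn (greens_rate r t) #|dvert G :\: (P :|: C)| ->
    (forall w, darc G u w -> w \notin P :|: Q ->
       greens_win_from G v j r t.+1 w (P :|: Q) (w |: C)) ->
    greens_win_from G v j r t u P C.

Definition greens_win (R : realType) (T : finType) (G : dag T) (v : T)
    (j : nat) (r : R) : Prop :=
  greens_win_from G v j r 1 v finset.set0 [set v].

Definition green_number (R : realType) (T : finType) (G : dag T) (v : T)
    (j : nat) : R :=
  inf [set r : R | 0 < r /\ greens_win G v j r]%classic.

(* Random DAG, generated up to layer K. [None] is the source and [Some (k, s)]*)
(* is the element s of the fresh n-set S out of which layer k.+1 is made.     *)
Definition node (K n : nat) : finType := option ('I_K * 'I_n).

Definition depth (K n : nat) (x : node K n) : nat :=
  if x is Some (k, _) then k.+1 else 0%N.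

(* An outcome lists, for each potential node x and each m < D, the endpoint   *)
(* in S of the m-th edge that x generates; only the first [out_degree] ones   *)
(* are used. Uniform outcomes are exactly independent uniform endpoints.      *)
(* D has to be at least every out-degree.                                     *)
Definition outcome (K n D : nat) : finType := {ffun node K n * 'I_D -> 'I_n}.

(* Nodes generated so far, in the order of their labels, and the list of      *)
(* edges generated so far, with multiplicities.                               *)
Record partial_dag (K n : nat) := PartialDag {
  pnodes : seq (node K n);
  pedges : seq (node K n * node K n) }.

Definition node_label (K n : nat) (st : partial_dag K n) (x : node K n) : nat :=
  (index x (pnodes st)).+1.

Definition in_degree (K n : nat) (st : partial_dag K n) (x : node K n) : nat :=
  count (fun e => e.2 == x) (pedges st).

(* Number of edges generated by x; the real weight is rounded down.           *)
Definition out_degree (R : realType) (w : nat -> R) (K n : nat)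
    (st : partial_dag K n) (x : node K n) : nat :=
  Num.truncn (Num.max (w (node_label st x) - (in_degree st x)%:R) 0).

Definition new_edges (R : realType) (w : nat -> R) (K n D : nat)
    (X : outcome K n D) (st : partial_dag K n) (k : 'I_K) :
    seq (node K n * node K n) :=
  [seq (x, Some (k, X (x, m))) |
     x <- [seq x <- pnodes st | depth x == k],
     m <- [seq m : 'I_D <- enum 'I_D | (m < out_degree w st x)%N]].

(* Layer k.+1 is labelled in the order of S = 'I_n.                           *)
Definition new_nodes (K n : nat) (k : 'I_K) (es : seq (node K n * node K n)) :
    seq (node K n) :=
  [seq Some (k, s) | s <- [seq s <- enum 'I_n |
                             Some (k, s) \in [seq e.2 | e <- es]]].

Definition grow (R : realType) (w : nat -> R) (K n D : nat)
    (X : outcome K n D) (st : partial_dag K n) (k : 'I_K) : partial_dag K n :=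
  let es := new_edges w X st k in
  PartialDag (pnodes st ++ new_nodes k es) (pedges st ++ es).

Definition grown (R : realType) (w : nat -> R) (K n D : nat)
    (X : outcome K n D) : partial_dag K n :=
  foldl (grow w X) (PartialDag [:: None] [::]) (enum 'I_K).

Lemma grown_edge (R : realType) (w : nat -> R) (K n D : nat)
    (X : outcome K n D) x y : (x, y) \in pedges (grown w X) ->
  [/\ x \in pnodes (grown w X), y \in pnodes (grown w X)
    & depth y = (depth x).+1].
Proof.
rewrite /grown.
pose ok (st : partial_dag K n) := forall x y, (x, y) \in pedges st ->
  [/\ x \in pnodes st, y \in pnodes st & depth y = (depth x).+1].
suff H s st : ok st -> ok (foldl (grow w X) st s) by apply: H.
elim: s st => //= k s IHs st okst; apply: IHs => {}x {}y /=.
rewrite !mem_cat => /orP[/okst[-> -> ->] //|xy_new].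
have y_tgt : y \in [seq e.2 | e <- new_edges w X st k].
  by apply/mapP; exists (x, y).
move: xy_new y_tgt => /allpairsPdep[x' [m [+ _ [-> ->]]]] /=.
rewrite mem_filter => /andP[/eqP dx x'in] y_tgt.
split; rewrite ?x'in ?dx //; apply/orP; right.
by apply/mapP; exists (X (x', m)); rewrite // mem_filter y_tgt mem_enum.
Qed.

Lemma grown_acyclic (R : realType) (w : nat -> R) (K n D : nat)
    (X : outcome K n D) x p :
  path (fun y z => (y, z) \in pedges (grown w X)) x p -> p != [::] ->
  last x p != x.
Proof.
move=> xp p0; suff H : (depth x + size p = depth (last x p))%N.
  by apply/eqP => E; move: H; rewrite E => /eqP; rewrite -[eqbRHS]addn0
    eqn_add2l size_eq0 (negPf p0).
elim: p x xp {p0} => [|y p IHp] x /=; first by rewrite addn0.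
by move=> /andP[/grown_edge[_ _ dy] /IHp <-]; rewrite dy addSnnS.
Qed.

Definition random_dag (R : realType) (w : nat -> R) (K n D : nat)
    (X : outcome K n D) : dag (node K n).
Proof.
refine (@Dag _ [set x in pnodes (grown w X)]
  (fun x y => (x, y) \in pedges (grown w X)) _ (@grown_acyclic R w K n D X)).
by move=> x y /grown_edge[]; rewrite !inE => -> ->.
Defined.

Definition prob (R : realType) (Omega : finType) (E : Omega -> Prop) : R :=
  #|[set X | `[< E X >]]|%:R / #|Omega|%:R.

(* Parameters of the random power law DAG. Subscripts i are at least 1.       *)
Section PowerLaw.
Context {R : realType} (beta d alpha : R).

Definition pl_M (n : nat) : R := n%:R `^ alpha.

Definition pl_i0 (n : nat) : R :=
  n%:R * (d / pl_M n * ((beta - 2) / (beta - 1))) `^ (beta - 1).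

Definition pl_c (n : nat) : R :=
  (beta - 2) / (beta - 1) * d * n%:R `^ (1 / (beta - 1)).

Definition pl_w (n i : nat) : R :=
  pl_c n * (pl_i0 n + i%:R - 1) `^ (- (1 / (beta - 1))).

(* Truncation parameters under which [random_dag] is the whole process, by    *)
(* [pl_w_le_w1] and [pl_w_lt1]: out-degrees are at most w_i <= w_1, and nodes *)
(* of layer pl_depth have labels > pl_depth, hence no out-edge.               *)
Definition pl_width (n : nat) : nat := Num.truncn (pl_w n 1).

Definition pl_depth (n : nat) : nat := (Num.truncn (pl_c n `^ (beta - 1))).+1.

Lemma pl_i0_gt0 (n : nat) : 2 < beta -> 0 < d -> (0 < n)%N ->
  0 < pl_i0 n.
Proof.
move=> b2 d0 n0; have nR : 0 < n%:R :> R by rewrite ltr0n.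
rewrite mulr_gt0 // powR_gt0 // mulr_gt0 ?divr_gt0 ?powR_gt0 //; lra.
Qed.

Lemma pl_c_gt0 (n : nat) : 2 < beta -> 0 < d -> (0 < n)%N ->
  0 < pl_c n.
Proof.
move=> b2 d0 n0; have nR : 0 < n%:R :> R by rewrite ltr0n.
rewrite mulr_gt0 ?powR_gt0 // mulr_gt0 // divr_gt0; lra.
Qed.

Lemma pl_w_le_w1 (n i : nat) : 2 < beta -> 0 < d -> (0 < n)%N -> (0 < i)%N ->
  pl_w n i <= pl_w n 1.
Proof.
move=> b2 d0 n0 i0; have i0_gt0 := pl_i0_gt0 b2 d0 n0.
have i1 : 1 <= i%:R :> R by rewrite ler1n.
rewrite /pl_w ler_pM2l ?pl_c_gt0 // !powRN lef_pV2 ?posrE ?powR_gt0; try lra.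
by apply: ge0_ler_powR; rewrite ?nnegrE ?divr_ge0 //; lra.
Qed.

Lemma pl_w_lt1 (n i : nat) : 2 < beta -> 0 < d -> (0 < n)%N ->
  (pl_depth n < i)%N -> pl_w n i < 1.
Proof.
move=> b2 d0 n0 Ki; have i0_gt0 := pl_i0_gt0 b2 d0 n0.
have c0 := pl_c_gt0 b2 d0 n0.
have cK : pl_c n `^ (beta - 1) < (pl_depth n)%:R.
  exact: truncnS_gt.
have K0 : 0 <= (pl_depth n)%:R :> R by [].
have K1i : (pl_depth n)%:R + 1 <= i%:R :> R by rewrite natr1 ler_nat.
rewrite /pl_w powRN ltr_pdivrMr ?powR_gt0 ?mul1r; try lra.
have -> : pl_c n = (pl_c n `^ (beta - 1)) `^ (1 / (beta - 1)).
  by rewrite -powRrM mulrC mulfVK ?powRr1 ?ltW //; apply/eqP; lra.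
rewrite -[X in _ < _ `^ X]mul1r.
apply: gt0_ltr_powR; rewrite ?nnegrE ?powR_ge0 ?divr_gt0 //; lra.
Qed.

Definition pl_outcome (n : nat) : finType :=
  outcome (pl_depth n) n (pl_width n).

Definition pl_dag (n : nat) (X : pl_outcome n) : dag (node (pl_depth n) n) :=
  random_dag (pl_w n) X.

Definition pl_source (n : nat) : node (pl_depth n) n := None.

(* The critical value 1/alpha - beta + 3.                                     *)
Definition pl_x : R := alpha^-1 - beta + 3.

Definition pl_gamma : R :=
  if [&& pl_x \is a Num.nat, pl_x != 0, pl_x != 1 & pl_x != 2] then
    d `^ (beta - 1) * ((beta - 2) / (beta - 1)) `^ (beta - 2) *
    ((1 + (d * ((beta - 2) / (beta - 1))) `^ (1 - beta))
       `^ ((beta - 2) / (beta - 1)) - 1)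
  else 1.

Definition pl_j1 : int := Num.floor (Num.max pl_x 2).

Definition pl_base (n : nat) : R :=
  pl_gamma / d `^ (beta - 1) * n%:R `^ (alpha * (pl_j1%:~R - 1) - 1).

Definition pl_j2_cond (omega : nat -> R) (n : nat) (j : int) : Prop :=
  d `^ (beta - 1) * pl_base n `^ (((beta - 2) / (beta - 1)) ^ (j - pl_j1))
  <= (omega n * ln (ln n%:R)) `^ (- Num.max 2 ((beta - 1) ^+ 2)).

Definition is_pl_j2 (omega : nat -> R) (n : nat) (j2 : int) : Prop :=
  pl_j2_cond omega n j2 /\ forall j, pl_j2_cond omega n j -> j <= j2.

Definition pl_xi : R :=
  (beta - 2) / (beta - 1) * d *
  ((d * (beta - 2) / (beta - 1)) `^ (beta - 1) + 1) `^ (- (1 / (beta - 1))).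

(* The ranges j < 1/alpha - beta + 3 and j1 <= j of the last two families     *)
(* cover j >= 2 and overlap only in j = j1 when 1/alpha - beta + 3 > 2 is not *)
(* an integer; then gamma = 1 and the two expressions agree.                  *)
Definition pl_wbar (n j : nat) : R :=
  if (j < 2)%N then pl_M n
  else if j%:R < alpha^-1 - beta + 3 then
    if j%:R < alpha^-1 - beta + 2 then n%:R `^ alpha
    else if j%:R == alpha^-1 - beta + 2 then pl_xi * n%:R `^ alpha
    else (beta - 2) / (beta - 1) * d *
         n%:R `^ ((1 - alpha * (j%:R - 1)) / (beta - 1))
  else (beta - 2) / (beta - 1) *
       pl_base n `^ (- ((beta - 2) / (beta - 1)) ^ (j%:Z - pl_j1) / (beta - 1)).

End PowerLaw.

(* Main.v *)
(* The sludge wins at rate r if G contains a tree of depth j, rooted at v, all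
   of whose internal nodes have more than r + 1 children: the greens protect
   at most r + 1 nodes at a time, so the sludge can always move to a child whose
   subtree is untouched. The greens win at rate r if r - 1 bounds all the
   out-degrees in layer j - 1, by waiting until the sludge gets there.

   The number d_k of nodes up to layer k satisfies d_(k+1) <= 1 + F(d_k), where
   F(D) = w_1 + ... + w_D, and the only losses are in-degrees, roundings and
   collisions of edges, which a first moment bound controls. Comparing F with an
   integral, d_k stays close to an explicit sequence p_k: relative errors add up
   only during a bounded number of steps, after which F(D) is of order
   D^((beta-2)/(beta-1)) and contracts them. Hence in layer j - 1 the least weight
   is close to wbar_j and the largest one is at most about wbar_(j-1), which
   gives the upper bound.

   For the lower bound, let every node use its first m edges, with m slightly
   below wbar_j, and keep only the targets of in-degree 1, which form a tree. At
   most m^k nodes are reached in layer k. Such a node loses 2a children with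
   probability at most 2^m (e/n)^a, where e is the number of edges between the
   two layers. As j = O(log log n) while m is at least (log log n)^3 up to a
   constant, a union bound over the reached nodes suffices, with a a small
   fraction of m. *)
Require Import Defs.
From mathcomp Require Import all_boot all_order all_algebra.
From mathcomp Require Import all_classical all_reals all_analysis.
From mathcomp Require Import zify ring lra.
Set Implicit Arguments.
Unset Strict Implicit.
Unset Printing Implicit Defensive.
Import Order.TTheory GRing.Theory Num.Theory.
Import numFieldNormedType.Exports.
Local Open Scope ring_scope.

(** * The game *)

Section Game.
Context {R : realType}.

(** The exponent in the definition of j_2 has two tasks. Write L = log log n. Its part 2 keeps the
    reference size of every layer before j_2 below n / L^2: collision probabilities are then
    O(1/L^2), small enough to be summed over O(L) layers, and they tend to 0, so that their a-th
    power beats 2^m although a is only a small fraction of m. Its part (beta - 1)^2 makes wbar_j at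
    least of order L^4, because (beta - 1)^2 / (beta - 2) >= 4; this exceeds j^2 by far, which is
    what m^j <= 2^m asks for. Since j_2 grows with n, all estimates have to be uniform in j. The
    upper bound on layer sizes holds for every outcome, so the edge counts in the collision bounds
    can be replaced by constants. Conditional probabilities become counting: resampling a coordinate
    at a node of depth k changes neither the first k layers nor the set of edges about to leave
    layer k. The relative error stays fixed until the end, where a diagonal choice turns it into
    o(1). *)

Lemma greens_rate_ub (r : R) (t : nat) : 0 <= r -> (0 < t)%N ->
  (greens_rate r t)%:R < r + 1.
Proof.
case: t => // t r0 _; rewrite /greens_rate /=.
have a0 : 0 <= r * t%:R by rewrite mulr_ge0.
have b0 : 0 <= r * t.+1%:R by rewrite mulr_ge0.
have ab : (Num.truncn (r * t%:R) <= Num.truncn (r * t.+1%:R))%N.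
  by apply: le_truncn; rewrite ler_wpM2l // ler_nat.
rewrite natrB //.
have : (Num.truncn (r * t.+1%:R))%:R <= r * t.+1%:R by rewrite truncn_le.
have := truncnS_gt (r * t%:R).
by rewrite -!natr1 mulrDr mulr1; lra.
Qed.

Lemma greens_rate_lb (r : R) (t : nat) : 0 <= r -> (0 < t)%N ->
  r - 1 < (greens_rate r t)%:R.
Proof.
case: t => // t r0 _; rewrite /greens_rate /=.
have a0 : 0 <= r * t%:R by rewrite mulr_ge0.
have b0 : 0 <= r * t.+1%:R by rewrite mulr_ge0.
have ab : (Num.truncn (r * t%:R) <= Num.truncn (r * t.+1%:R))%N.
  by apply: le_truncn; rewrite ler_wpM2l // ler_nat.
rewrite natrB //.
have : (Num.truncn (r * t%:R))%:R <= r * t%:R by rewrite truncn_le.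
have := truncnS_gt (r * t.+1%:R).
by rewrite -!natr1 mulrDr mulr1; lra.
Qed.

Variables (T : finType) (G : dag T) (v : T) (j : nat) (r : R) (dep : T -> nat).

Section Sludge.
Variables (par : T -> T) (A : {set T}) (m : nat).

Definition tree_children (u : T) : {set T} :=
  [set w in A | (par w == u) && (dep w == (dep u).+1)].

(** Membership is decided by iterating [par] upwards, so the subtrees of distinct nodes of equal
    depth are disjoint by construction. *)
Definition subtree (u : T) : {set T} :=
  [set x | (dep u <= dep x)%N && (iter (dep x - dep u) par x == u)].

Lemma subtree_child u w : w \in tree_children u -> subtree w \subset subtree u.
Proof.
rewrite !inE => /and3P[_ /eqP pw /eqP dw]; apply/fintype.subsetP => x.
rewrite !inE dw => /andP[lx /eqP ix]; rewrite (ltnW lx) /=.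
by rewrite -(subnSK lx) iterS ix pw.
Qed.

(** Induction over the greens' strategy, with the invariant that no protected node lies strictly
    below the current node. *)
Lemma sludge_beats_greens :
  v \in A -> dep v = 0%N ->
  (forall u, u \in A -> (dep u < j)%N -> (m <= #|tree_children u|)%N) ->
  (forall u w, u \in A -> w \in tree_children u -> darc G u w) ->
  (forall u, u \in A -> dep u = j -> u \in dist_layer G v j) ->
  (forall t, (0 < t)%N -> (greens_rate r t < m)%N) ->
  ~ greens_win G v j r.
Proof.
move=> vA dv degA arcA layA rate.
suff H t u P C : greens_win_from G v j r t u P C -> (0 < t)%N -> u \in A ->
    (dep u <= j)%N -> P :&: (subtree u :\ u) = finset.set0 -> False.
  by move=> /H; apply => //; rewrite ?dv // finset.set0I.
elim=> {t u P C} t u P C Q uj _ cQ _ IH t0 uA dj PD.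
have {}dj : (dep u < j)%N.
  rewrite ltn_neqAle dj andbT; apply: contra uj => /eqP.
  exact: layA.
(* [h] sends a node to its ancestor one level below [u], so each protected node spoils the subtree
   of at most one child; fewer than [m] nodes cannot spoil them all. *)
pose h x := iter (dep x - (dep u).+1) par x.
have [w wu wh] : exists2 w, w \in tree_children u & w \notin h @: Q.
  apply/exists_inP; rewrite -[X in is_true X]negbK negb_exists_in; apply/negP => /forall_inP sub.
  have : tree_children u \subset h @: Q.
    by apply/fintype.subsetP => w /sub; rewrite negbK.
  move/subset_leq_card => H.
  have := leq_trans (degA _ uA dj) (leq_trans H (leq_imset_card h _)).
  by rewrite cQ leqNgt (leq_ltn_trans (geq_minl _ _) (rate _ t0)).
have := wu; rewrite inE => /and3P[wA pw /eqP dw].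
have subw : subtree w \subset subtree u :\ u.
  apply/fintype.subsetP => x xw; rewrite !inE; have := fintype.subsetP (subtree_child wu) _ xw.
  rewrite inE => ->; rewrite andbT.
  by apply: contraTneq xw => ->; rewrite inE dw ltnn.
have ww : w \in subtree w by rewrite inE leqnn subnn eqxx.
have wQ x : x \in subtree w -> x \notin P :|: Q.
  move=> xw; rewrite inE negb_or; apply/andP; split.
    apply/negP => xP; have : x \in P :&: (subtree u :\ u).
      by rewrite inE xP (fintype.subsetP subw).
    by rewrite PD inE.
  apply: contra wh => xQ; apply/imsetP; exists x => //.
  by move: xw; rewrite inE dw => /andP[_ /eqP].
apply: (IH w (arcA _ _ uA wu) (wQ _ ww)) => //; first by rewrite dw.
apply/finset.setP => x; rewrite finset.in_set0; apply/negbTE/negP.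
by rewrite finset.in_setI => /andP[xPQ]; rewrite finset.in_setD1 => /andP[_ /wQ]; rewrite xPQ.
Qed.

End Sludge.

(** The rules prescribe how many nodes are protected, so a wanted set [B] has to be padded to a
    legal move. *)
Lemma set_between (B A : {set T}) (k : nat) : B \subset A -> (#|B| <= k)%N ->
  exists Q : {set T}, [/\ B \subset Q, Q \subset A & #|Q| = minn k #|A|].
Proof.
move=> BA Bk.
have : (minn k #|A| - #|B| <= #|A :\: B|)%N.
  by rewrite cardsDS // leq_sub2r // geq_minr.
move=> /card_geqP[s [us ss sA]].
have Bm : (#|B| <= minn k #|A|)%N by rewrite leq_min Bk subset_leq_card.
exists (B :|: [set x in s]); split; first exact: finset.subsetUl.
  rewrite finset.subUset BA /=; apply/fintype.subsetP => x; rewrite inE => /sA.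
  by rewrite inE => /andP[].
rewrite cardsU (_ : B :&: _ = finset.set0) ?cards0 ?subn0; last first.
  apply/finset.setP => x; rewrite !inE; apply/negbTE/negP => /andP[xB /sA].
  by rewrite inE xB.
by rewrite cardsE (card_uniqP us) ss subnKC.
Qed.

(** Every arc raises the depth by one, so at time t the sludge sits at depth t - 1 and no
    contaminated node is deeper. Hence at time [j] none of its out-neighbours is contaminated, and
    all of them can be protected at once. *)
Lemma greens_beat_sludge :
  dep v = 0%N -> (0 < j)%N ->
  (forall u w, darc G u w -> dep w = (dep u).+1) ->
  (forall u, u \in dist_layer G v j -> dep u = j) ->
  (forall u, dep u = j.-1 -> (#|[set w | darc G u w]| <= greens_rate r j)%N) ->
  greens_win G v j r.
Proof.
move=> dv j0 arcD layD outD.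
suff H i : forall t u (P C : {set T}), (t + i = j)%N -> (0 < t)%N -> dep u = t.-1 ->
    (forall c, c \in C -> (dep c <= dep u)%N) -> greens_win_from G v j r t u P C.
  apply: (H j.-1) => //; first by rewrite add1n prednK.
  by move=> c; rewrite inE => /eqP ->.
elim: i => [|i IH] t u P C; last first.
  move=> tj t0 du dC.
  (* Before time [j] any legal move will do: the empty set is padded. *)
  have [Q [_ QA cQ]] := @set_between finset.set0 (dvert G :\: (P :|: C))
    (greens_rate r t) (finset.sub0set _) (leq_trans (eq_leq (cards0 _)) (leq0n _)).
  apply: GreensMove QA cQ _.
    by apply/negP => /layD; lia.
  move=> w uw _; apply: IH => //; [lia|by rewrite (arcD _ _ uw); lia|].
  move=> c; rewrite finset.in_setU1 => /predU1P[->//|/dC].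
  by rewrite (arcD _ _ uw); lia.
rewrite addn0 => -> _ du dC.
have uL : u \notin dist_layer G v j by apply/negP => /layD; lia.
pose A := dvert G :\: (P :|: C).
have [|Q [BQ QA cQ]] := @set_between ([set w | darc G u w] :&: A) A
    (greens_rate r j) (finset.subsetIr _ _).
  exact: leq_trans (subset_leq_card (finset.subsetIl _ _)) (outD _ du).
apply: GreensMove uL QA cQ _ => w uw /negP[].
rewrite finset.in_setU; apply/orP; have [|wP] := boolP (w \in P); first by left.
right; apply: (fintype.subsetP BQ); rewrite !inE uw negb_or wP /=.
have /andP[_ ->] := darc_vert uw; rewrite andbT.
by apply/negP => /dC; rewrite (arcD _ _ uw) ltnn.
Qed.

End Game.

(** * The random DAG, layer by layer *)

Section Process.
Context {R : realType}.
Variables (w : nat -> R) (K n D : nat).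
Implicit Types (X : outcome K n D) (x y : node K n) (k : nat).

Definition stage X k : partial_dag K n :=
  foldl (grow w X) (PartialDag [:: None] [::]) (take k (enum 'I_K)).

(** An edge is represented by the coordinate of the outcome that decides its endpoint; parallel
    edges thus stay distinct, and the set is known before the endpoints are drawn. *)
Definition edge_slots X k : {set node K n * 'I_D} :=
  [set p : node K n * 'I_D | [&& p.1 \in pnodes (stage X k), depth p.1 == k
             & (p.2 < out_degree w (stage X k) p.1)%N]].

Definition node_count X k := size (pnodes (stage X k)).
Definition edge_count X k := size (pedges (stage X k)).

Lemma stageS X k (hk : (k < K)%N) :
  stage X k.+1 = grow w X (stage X k) (Ordinal hk).
Proof.
rewrite /stage (take_nth (Ordinal hk)) ?size_enum_ord // foldl_rcons.
by rewrite (nth_ord_enum _ (Ordinal hk)).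
Qed.

Lemma grown_stage X : grown w X = stage X K.
Proof. by rewrite /stage -[X in take X](size_enum_ord K) take_size. Qed.

Let slot_seq X k : seq (node K n * 'I_D) :=
  [seq (x, m) | x <- [seq x <- pnodes (stage X k) | depth x == k],
     m <- [seq m : 'I_D <- enum 'I_D | (m < out_degree w (stage X k) x)%N]].

Let mem_slot_seq X k : slot_seq X k =i edge_slots X k.
Proof.
move=> [x m]; rewrite inE /=; apply/allpairsPdep/and3P => /=.
  move=> [x' [m' []]]; rewrite mem_filter => /andP[dx xs].
  by rewrite mem_filter => /andP[om _] [-> ->].
move=> [xs dx om]; exists x, m; split=> //; rewrite mem_filter ?dx //.
by rewrite om mem_enum.
Qed.

Let new_edges_slots X k (hk : (k < K)%N) :
  new_edges w X (stage X k) (Ordinal hk) =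
  [seq (p.1, Some (Ordinal hk, X p)) | p <- slot_seq X k].
Proof.
by rewrite /new_edges /slot_seq map_allpairs.
Qed.

Let mem_new_nodes X k (hk : (k < K)%N) y :
  (y \in new_nodes (Ordinal hk) (new_edges w X (stage X k) (Ordinal hk))) =
  [exists p in edge_slots X k, y == Some (Ordinal hk, X p)].
Proof.
apply/mapP/exists_inP => [[s]|[p pE /eqP ->]].
  rewrite mem_filter new_edges_slots -map_comp => /andP[/mapP[p ps [sp] _] ->].
  by exists p; rewrite -?mem_slot_seq // sp.
exists (X p) => //; rewrite mem_filter mem_enum andbT new_edges_slots -map_comp.
by apply/mapP; exists p; rewrite ?mem_slot_seq.
Qed.

Let depth_new_nodes X k (hk : (k < K)%N) y :
  y \in new_nodes (Ordinal hk) (new_edges w X (stage X k) (Ordinal hk)) ->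
  depth y = k.+1.
Proof. by rewrite mem_new_nodes => /exists_inP[p _ /eqP ->]. Qed.

Lemma pnodes_stageS X k (hk : (k < K)%N) : pnodes (stage X k.+1) =
  pnodes (stage X k) ++
  new_nodes (Ordinal hk) (new_edges w X (stage X k) (Ordinal hk)).
Proof. by rewrite stageS. Qed.

Lemma stage_depth X k x : (k <= K)%N -> x \in pnodes (stage X k) ->
  (depth x <= k)%N.
Proof.
elim: k => [|k IH] hk; first by rewrite /stage take0 /= inE => /eqP ->.
rewrite (pnodes_stageS X hk) mem_cat => /orP[/(IH (ltnW hk))/leqW //|].
by move/depth_new_nodes ->.
Qed.

Lemma stage_uniq X k : (k <= K)%N -> uniq (pnodes (stage X k)).
Proof.
elim: k => [|k IH] hk; first by rewrite /stage take0.
rewrite (pnodes_stageS X hk) cat_uniq IH 1?ltnW //=; apply/andP; split.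
  apply/hasPn => y /depth_new_nodes dy; apply/negP => /(stage_depth (ltnW hk)).
  by rewrite dy ltnn.
by rewrite map_inj_uniq 1?filter_uniq ?enum_uniq // => s t [].
Qed.

Let slot_seq_uniq X k : (k <= K)%N -> uniq (slot_seq X k).
Proof.
move=> hk; apply: allpairs_uniq_dep.
- by rewrite filter_uniq // stage_uniq.
- by move=> x _; rewrite filter_uniq ?enum_uniq.
- by move=> [x m] [x' m'] _ _ /= [-> ->].
Qed.

Let size_slot_seq X k : (k <= K)%N -> size (slot_seq X k) = #|edge_slots X k|.
Proof.
by move=> hk; rewrite -(card_uniqP (slot_seq_uniq X hk)); apply: eq_card => p;
  rewrite mem_slot_seq.
Qed.

Lemma stage_nodeP X k l x : (k <= l <= K)%N -> (depth x <= k)%N ->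
  (x \in pnodes (stage X l)) = (x \in pnodes (stage X k)).
Proof.
move=> /andP[]; elim: l => [|l IH]; first by rewrite leqn0 => /eqP ->.
rewrite leq_eqVlt ltnS => /predU1P[-> //|kl] hl dx.
rewrite (pnodes_stageS X hl) mem_cat IH ?(ltnW hl) // orbC.
by case: (boolP (x \in new_nodes _ _)) => // /depth_new_nodes; lia.
Qed.

Lemma stage_new_nodeP X k (hk : (k < K)%N) s :
  (Some (Ordinal hk, s) \in pnodes (stage X k.+1)) =
  [exists p in edge_slots X k, X p == s].
Proof.
rewrite (pnodes_stageS X hk) mem_cat mem_new_nodes.
case: (boolP (_ \in pnodes _)) => [/(stage_depth (ltnW hk))|_ /=].
  by rewrite /= ltnn.
by apply: eq_existsb => p; rewrite /eq_op /= xpair_eqE eqxx /= eq_sym.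
Qed.

Lemma edgeP X k x y : (k <= K)%N -> reflect
  (exists2 hx : (depth x < K)%N, (depth x < k)%N &
     exists2 m, (x, m) \in edge_slots X (depth x) &
       y = Some (Ordinal hx, X (x, m)))
  ((x, y) \in pedges (stage X k)).
Proof.
move=> hk; apply: (iffP idP); elim: k hk => [|k IH] hk.
- by rewrite /stage take0.
- rewrite (stageS X hk) /= mem_cat => /orP[/(IH (ltnW hk))[hx /leqW xk m] |].
    by exists hx.
  rewrite new_edges_slots => /mapP[[x' m]].
  rewrite mem_slot_seq => pE [-> ->]; have := pE; rewrite inE => /and3P[_ /eqP /= dx _].
  have hx : (depth x' < K)%N by rewrite dx.
  exists hx; rewrite ?dx //; exists m; first by rewrite dx.
  by rewrite /= (_ : Ordinal hk = Ordinal hx) //; apply: val_inj; rewrite /= dx.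
- by move=> [].
- move=> [hx]; rewrite ltnS leq_eqVlt (stageS X hk) /= mem_cat => /predU1P[dx|dx] hm.
    case: hm => m mE ->; apply/orP; right.
    rewrite new_edges_slots; apply/mapP; exists (x, m) => /=.
      by rewrite mem_slot_seq -dx.
    by rewrite /= (_ : Ordinal hx = Ordinal hk) //; apply: val_inj; rewrite /= dx.
  by rewrite IH // 1?ltnW //; exists hx.
Qed.

Lemma node_count0 X : node_count X 0 = 1%N.
Proof. by rewrite /node_count /stage take0. Qed.

Lemma edge_count0 X : edge_count X 0 = 0%N.
Proof. by rewrite /edge_count /stage take0. Qed.

Lemma node_countS X k : (k < K)%N ->
  node_count X k.+1 = (node_count X k + #|X @: edge_slots X k|)%N.
Proof.
move=> hk; rewrite /node_count (pnodes_stageS X hk) size_cat size_map.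
congr addn; rewrite -(card_uniqP _) 1?filter_uniq ?enum_uniq //.
apply: eq_card => s; rewrite mem_filter mem_enum andbT new_edges_slots -map_comp.
apply/mapP/imsetP => [[p ps /= [->]]|[p ps ->]]; exists p => //.
  by rewrite -mem_slot_seq.
by rewrite mem_slot_seq.
Qed.

Lemma edge_countS X k : (k < K)%N ->
  edge_count X k.+1 = (edge_count X k + #|edge_slots X k|)%N.
Proof.
move=> hk; rewrite /edge_count stageS size_cat new_edges_slots size_map.
by rewrite size_slot_seq // ltnW.
Qed.

Lemma in_degreeS X k (hk : (k < K)%N) s :
  in_degree (stage X k.+1) (Some (Ordinal hk, s)) =
  #|[set p in edge_slots X k | X p == s]|.
Proof.
rewrite /in_degree stageS /= count_cat.
rewrite (_ : count _ (pedges _) = 0%N) ?add0n; last first.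
  apply/eqP; rewrite -leqn0 leqNgt -has_count; apply/hasPn => -[x y] /=.
  move=> /(edgeP _ _ _ (ltnW hk))[hx xk [m _ ->]]; apply/eqP => -[].
  by lia.
rewrite new_edges_slots count_map -size_filter -(card_uniqP _); last first.
  by rewrite filter_uniq // slot_seq_uniq // ltnW.
apply: eq_card => p; rewrite mem_filter mem_slot_seq !inE andbC /=.
by congr (_ && _); apply/eqP/eqP => [[]|->].
Qed.

(** New edges end in fresh nodes, and fresh nodes are appended, so labels and in-degrees of old
    nodes are final. *)
Lemma out_degreeS X k x : (k < K)%N -> x \in pnodes (stage X k) ->
  out_degree w (stage X k.+1) x = out_degree w (stage X k) x.
Proof.
move=> hk xk; rewrite /out_degree /node_label (pnodes_stageS X hk) index_cat xk.
congr (Num.truncn (Num.max (_ - _%:R) _)); rewrite /in_degree stageS /= count_cat.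
rewrite [X in (_ + X)%N](_ : _ = 0%N) ?addn0 //.
apply/eqP; rewrite -leqn0 leqNgt -has_count; apply/hasPn => -[x' y] /=.
rewrite new_edges_slots => /mapP[p _ [_ ->]]; apply/eqP => xE.
by have := stage_depth (ltnW hk) xk; rewrite -xE ltnn.
Qed.

(** This is the source of all independence: what has been built up to layer [k] depends only on
    coordinates at nodes of depth less than [k]. *)
Lemma eq_stage X (Y : outcome K n D) k : (k <= K)%N ->
  (forall p, (depth p.1 < k)%N -> X p = Y p) -> stage X k = stage Y k.
Proof.
elim: k => [|k IH] hk H; first by rewrite /stage !take0.
rewrite !(stageS _ hk) IH; [|exact: ltnW|by move=> p pk; apply: H; exact: ltnW].
rewrite /grow.
rewrite (_ : new_edges w X _ _ = new_edges w Y (stage Y k) (Ordinal hk)) //.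
apply/(eq_in_allpairs_dep (T := fun _ => 'I_D)) => x; rewrite mem_filter => /andP[/eqP dx _] m _.
by rewrite H //= dx.
Qed.

Lemma eq_edge_slots X (Y : outcome K n D) k : (k <= K)%N ->
  (forall p, (depth p.1 < k)%N -> X p = Y p) -> edge_slots X k = edge_slots Y k.
Proof. by move=> hk /(eq_stage hk) E; apply/finset.setP => p; rewrite !inE E. Qed.

(** * Edge counts against sums of weights *)

Hypothesis w_ge0 : forall i, 0 <= w i.
Hypothesis w_le : forall i, (0 < i)%N -> (Num.truncn (w i) <= D)%N.

Lemma out_degree_le X k x :
  (out_degree w (stage X k) x)%:R <= w (node_label (stage X k) x).
Proof.
rewrite /out_degree; set a := Num.max _ _; apply: (@le_trans _ _ a).
  by rewrite truncn_le /a le_max lexx orbT.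
by rewrite /a ge_max w_ge0 gerBl ler0n.
Qed.

Lemma out_degree_width X k x : (out_degree w (stage X k) x <= D)%N.
Proof.
apply: leq_trans (w_le (i := node_label (stage X k) x) _) => //.
by rewrite truncn_ge_nat ?w_ge0 // out_degree_le.
Qed.

Lemma out_degree_ge X k x : w (node_label (stage X k) x) <=
  (out_degree w (stage X k) x)%:R + (in_degree (stage X k) x)%:R + 1.
Proof.
rewrite /out_degree; set a := Num.max _ _.
have : a < (Num.truncn a)%:R + 1 by rewrite natr1 truncnS_gt.
have : w (node_label (stage X k) x) - (in_degree (stage X k) x)%:R <= a.
  by rewrite /a le_max lexx.
lra.
Qed.

Lemma card_edge_slots X k : (k <= K)%N -> #|edge_slots X k| =
  (\sum_(x <- pnodes (stage X k) | depth x == k) out_degree w (stage X k) x)%N.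
Proof.
move=> hk; rewrite -size_slot_seq // size_allpairs_dep sumnE big_map big_filter.
apply: eq_bigr => x _; rewrite -[RHS]card_ord -(card_uniqP _) 1?filter_uniq ?enum_uniq //.
have := out_degree_width X k x; set o := out_degree _ _ _ => oD.
have inj : injective (widen_ord oD) by move=> i i' /(congr1 val) /= /val_inj.
rewrite -(card_imset _ inj); apply: eq_card => m.
rewrite mem_filter mem_enum andbT; apply/idP/imsetP => [mo|[i _ ->]] /=.
  by exists (Ordinal mo) => //; apply: val_inj.
exact: ltn_ord.
Qed.

Lemma edge_count_sum X k : (k < K)%N -> edge_count X k.+1 =
  (\sum_(x <- pnodes (stage X k)) out_degree w (stage X k) x)%N.
Proof.
move=> hk; rewrite edge_countS // card_edge_slots 1?ltnW //.
rewrite [RHS](bigID (fun x => depth x == k)) /= addnC; congr addn.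
elim: k hk => [|k IH] hk.
  by rewrite edge_count0 /stage take0 /= big_cons big_nil.
rewrite edge_countS 1?ltnW // card_edge_slots 1?ltnW 1?ltnW // IH 1?ltnW //.
rewrite addnC.
transitivity (\sum_(x <- pnodes (stage X k)) out_degree w (stage X k) x)%N.
  by rewrite [RHS](bigID (fun x => depth x == k)).
rewrite (pnodes_stageS X (ltnW hk)).
rewrite [RHS]big_cat /= [X in _ = (_ + X)%N]big_seq_cond.
rewrite [X in _ = (_ + X)%N]big_pred0 ?addn0; last first.
  by move=> x; apply/negbTE/negP => /andP[/depth_new_nodes ->]; rewrite eqxx.
rewrite big_seq [RHS]big_seq_cond; apply: eq_big => x; last first.
  by move=> xk; rewrite out_degreeS // ltnW.
case: (boolP (x \in _)) => //= /(stage_depth (ltnW (ltnW hk))).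
by case: eqP => // ->; rewrite ltnn.
Qed.

Definition weight_sum (m : nat) : R := \sum_(i < m) w i.+1.

(** Labels are positions in the list of nodes, so they run through 1, ..., [node_count]. The total
    weight therefore depends on the outcome only through the number of nodes. *)
Lemma sum_weight_label X k : (k <= K)%N ->
  \sum_(x <- pnodes (stage X k)) w (node_label (stage X k) x) =
  weight_sum (node_count X k).
Proof.
move=> hk; rewrite (big_nth None) big_mkord; apply: eq_bigr => i _.
by rewrite /node_label index_uniq // stage_uniq.
Qed.

Lemma edge_count_ub X k : (k < K)%N ->
  (edge_count X k.+1)%:R <= weight_sum (node_count X k).
Proof.
move=> hk; rewrite edge_count_sum // natr_sum -sum_weight_label 1?ltnW //.
by apply: ler_sum => x _; exact: out_degree_le.
Qed.

Lemma sum_in_degree X k : (k <= K)%N ->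
  (\sum_(x <- pnodes (stage X k)) in_degree (stage X k) x <= edge_count X k)%N.
Proof.
move=> hk; rewrite /in_degree /edge_count.
elim: (pedges _) => [|e es IH]; first by rewrite big1_seq.
rewrite /= big_split /= -add1n leq_add //.
have := stage_uniq X hk; elim: (pnodes _) => [|x s IHs] /=; first by rewrite big_nil.
rewrite big_cons => /andP[xs us].
case: eqP => [ex|_] /=; last by rewrite add0n IHs.
rewrite big1_seq // => y /andP[_ ys]; apply/eqP; rewrite eqb0 ex.
by apply: contraNneq xs => ->.
Qed.

(** The second term pays for the in-degrees subtracted from the weights, the third for rounding
    down, less than one per node. *)
Lemma edge_count_lb X k : (k < K)%N -> weight_sum (node_count X k) <=
  (edge_count X k.+1)%:R + (edge_count X k)%:R + (node_count X k)%:R.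
Proof.
move=> hk; rewrite edge_count_sum // -sum_weight_label 1?ltnW //.
have /(_ (ltnW hk)) := @sum_in_degree X k; rewrite -(ler_nat R) => H.
apply: (@le_trans _ _ (\sum_(x <- pnodes (stage X k))
  ((out_degree w (stage X k) x)%:R + (in_degree (stage X k) x)%:R + 1))).
  by apply: ler_sum => x _; exact: out_degree_ge.
rewrite !big_split /= -!natr_sum /node_count -(sum1_size (pnodes _)) natr_sum.
by rewrite [X in _ <= _ + X]natr_sum lerD2r lerD2l.
Qed.

End Process.
(** * Resampling coordinates of a uniform outcome *)

Section Counting.
Variables (P S : finType).
Implicit Types (X : {ffun P -> S}) (p : P) (s : S).

Definition upd X p s : {ffun P -> S} := [ffun q => if q == p then s else X q].

Lemma card_pairs (I J : finType) (B : {set I * J}) :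
  #|B| = (\sum_i #|[set j | (i, j) \in B]|)%N.
Proof.
rewrite -sum1_card (eq_bigl (fun z => (z.1, z.2) \in B)); last by case.
rewrite -(pair_big_dep xpredT (fun i j => (i, j) \in B) (fun _ _ => 1%N)) /=.
by apply: eq_bigr => i _; rewrite -sum1_card; apply: eq_bigl => j; rewrite inE.
Qed.

Lemma card_pairsC (I J : finType) (E : I -> J -> bool) :
  (\sum_i #|[set j | E i j]| = \sum_j #|[set i | E i j]|)%N.
Proof.
under eq_bigr do rewrite -sum1_card.
under [RHS]eq_bigr do rewrite -sum1_card.
rewrite (exchange_big_dep xpredT) //=.
by apply: eq_bigr => j _; apply: eq_bigl => i; rewrite !inE.
Qed.

(* Resampling the coordinate p, i.e. the involution (X, s) |-> (upd X p s, X p), *)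
(* shows that X p is uniform and independent of the rest of X.                 *)
Lemma card_coord_in p (Q : pred {ffun P -> S}) (F : {ffun P -> S} -> {set S}) f :
  (forall X s, Q (upd X p s) = Q X) -> (forall X s, F (upd X p s) = F X) ->
  (forall X, Q X -> #|F X| <= f)%N ->
  (#|S| * #|[set X | Q X && (X p \in F X)]| <= f * #|[set X | Q X]|)%N.
Proof.
move=> Qp Fp Ff.
pose sw (z : {ffun P -> S} * S) := (upd z.1 p z.2, z.1 p).
have sw_inj : injective sw.
  move=> [X s] [Y t] [/ffunP E XY]; congr (_, _); last first.
    by have := E p; rewrite !ffunE eqxx.
  by apply/ffunP => q; have := E q; rewrite !ffunE; case: eqP => [->|].
pose B := [set z : {ffun P -> S} * S | Q z.1 && (z.2 \in F z.1)].
apply: (@leq_trans #|B|).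
  rewrite mulnC -finset.cardsT -cardsX -(card_imset _ sw_inj); apply: subset_leq_card.
  apply/fintype.subsetP => _ /finset.imsetP[[X s] + ->]; rewrite !inE /= => /andP[/andP[QX XF] _].
  by rewrite Qp Fp QX.
rewrite card_pairs mulnC -sum_nat_const (bigID (fun X => Q X)) /=.
rewrite [X in (_ + X)%N]big1 ?addn0; last first.
  move=> X /negbTE QX; apply/eqP; rewrite cards_eq0; apply/eqP/finset.setP => s.
  by rewrite !inE /= QX.
rewrite [leqRHS](eq_bigl (fun X => Q X)); last by move=> X; rewrite inE.
apply: leq_sum => X QX; apply: leq_trans (Ff X QX); apply: subset_leq_card.
by apply/fintype.subsetP => s; rewrite !inE /= QX.
Qed.

(** One coordinate is peeled off at a time: as [A] has no repetitions, the requirements on the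
    others do not look at it and can be absorbed into [Q]. *)
Lemma card_coords_in (A : seq P) (Q : pred {ffun P -> S})
    (F : {ffun P -> S} -> {set S}) f : uniq A ->
  {in A, forall p X s, Q (upd X p s) = Q X} ->
  {in A, forall p X s, F (upd X p s) = F X} ->
  (forall X, Q X -> #|F X| <= f)%N ->
  (#|S| ^ size A * #|[set X | Q X && all (fun p => X p \in F X) A]| <=
   f ^ size A * #|[set X | Q X]|)%N.
Proof.
elim: A => [|p A IH] /=.
  move=> _ _ _ _; rewrite !mul1n; apply: subset_leq_card.
  by apply/fintype.subsetP => X; rewrite !inE andbT.
move=> /andP[pA uA] QA FA Ff.
have sub q : q \in A -> q \in p :: A by rewrite inE orbC => ->.
have {}IH := IH uA (fun q qA => QA q (sub q qA)) (fun q qA => FA q (sub q qA)) Ff.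
pose Q' X := Q X && all (fun q => X q \in F X) A.
have pp : p \in p :: A by rewrite inE eqxx.
have Q'p X s : Q' (upd X p s) = Q' X.
  rewrite /Q' QA // FA //; congr andb; apply: eq_in_all => q qA.
  by rewrite ffunE; case: eqP => // qp; rewrite -qp qA in pA.
have := card_coord_in Q'p (FA p pp) (fun X QX => Ff X (proj1 (andP QX))).
rewrite (_ : [set X | Q' X && _] =
    [set X | Q X && ((X p \in F X) && all (fun q => X q \in F X) A)]); last first.
  by apply/finset.setP => X; rewrite !inE /Q' -andbA [in RHS](andbC (X p \in F X)).
move=> H; rewrite !expnSr -mulnA.
apply: leq_trans (leq_mul (leqnn _) H) _.
by rewrite mulnCA -[leqRHS]mulnA [leqRHS]mulnCA leq_mul2l IH orbT.
Qed.

(* A maximal A with the stated property meets every value taken on C, and X is *)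
(* injective on the rest of C.                                                 *)
Lemma half_collided (E C : {set P}) (h : P -> S) (a : nat) : C \subset E ->
  {in C, forall p, exists2 q, q \in E & (q != p) && (h q == h p)} ->
  (a.*2 <= #|C|)%N ->
  exists A : {set P}, [/\ A \subset C, #|A| = a &
    {in A, forall p, h p \in h @: (E :\: A)}].
Proof.
move=> CE Ccol Ca.
pose ok (A : {set P}) := (A \subset C) && [forall p in A, h p \in h @: (E :\: A)].
have ok0 : ok finset.set0 by rewrite /ok finset.sub0set; apply/forall_inP => p; rewrite inE.
have [B /maxsetP[/andP[BC /forall_inP Bh] Bmax] _] := maxset_exists ok0.
have aB : (a <= #|B|)%N.
  (* Two slots of C outside [B] with a common value would allow [B] to be enlarged by one of
     them. *)
  have inj p1 p2 : p1 \in C -> p1 \notin B -> p2 \in C -> p2 \notin B ->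
      h p1 = h p2 -> p1 = p2.
    move=> p1C p1B p2C p2B h12; apply/eqP; apply: contraNT p1B => p12.
    rewrite -(Bmax (p1 |: B)) ?finset.setU11 ?finset.subsetUr //; apply/andP; split.
      by rewrite finset.subUset finset.sub1set p1C.
    have p2m : h p2 \in h @: (E :\: (p1 |: B)).
      by apply: imset_f; rewrite !inE (fintype.subsetP CE) // andbT negb_or eq_sym p12.
    apply/forall_inP => p; rewrite finset.in_setU1 => /predU1P[->|pB]; first by rewrite h12.
    have /finset.imsetP[q] := Bh p pB; rewrite finset.in_setD => /andP[qB qE] hpq.
    have [qp1|qp1] := eqVneq q p1; first by rewrite hpq qp1 h12.
    by rewrite hpq imset_f // !inE negb_or qp1 qB.
  (* If the partner [q] of [p] were outside [B] as well, [B] could be enlarged by [p]. *)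
  have sub : h @: (C :\: B) \subset h @: B.
    apply/fintype.subsetP => _ /finset.imsetP[p + ->]; rewrite finset.in_setD => /andP[pB pC].
    have [q qE /andP[qp /eqP hqp]] := Ccol p pC.
    have [qB|qB] := boolP (q \in B); first by rewrite -hqp imset_f.
    case/negP: pB; rewrite -(Bmax (p |: B)) ?finset.setU11 ?finset.subsetUr //; apply/andP; split.
      by rewrite finset.subUset finset.sub1set pC.
    have qm : h q \in h @: (E :\: (p |: B)).
      by apply: imset_f; rewrite !inE qE andbT negb_or qp.
    apply/forall_inP => p'; rewrite finset.in_setU1 => /predU1P[->|pB']; first by rewrite -hqp.
    have /finset.imsetP[q'] := Bh p' pB'; rewrite finset.in_setD => /andP[qB' qE'] hpq'.
    have [q'p|q'p] := eqVneq q' p; first by rewrite hpq' q'p -hqp.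
    by rewrite hpq' imset_f // !inE negb_or q'p qB'.
  have : (#|C :\: B| <= #|B|)%N.
    rewrite -(card_in_imset (f := h)).
      exact: leq_trans (subset_leq_card sub) (leq_imset_card _ _).
    move=> p1 p2; rewrite !finset.in_setD => /andP[? ?] /andP[? ?]; exact: inj.
  by rewrite cardsD (finset.setIidPr BC); lia.
(* Passing from [B] to a subset of size [a] is harmless, since the complement in [E] only grows. *)
have /card_geqP[s [us ss sB]] := aB.
exists [set p in s]; split.
- by apply/fintype.subsetP => p; rewrite inE => /sB; exact: (fintype.subsetP BC).
- by rewrite cardsE (card_uniqP us).
- move=> p; rewrite inE => /sB /Bh; apply: fintype.subsetP.
  apply: finset.imsetS; apply: finset.setDS; apply/fintype.subsetP => q; rewrite inE; exact: sB.
Qed.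

End Counting.

(** * Collisions *)

Lemma card_ord_lt (D m : nat) : (#|[set i : 'I_D | (i < m)%N]| <= m)%N.
Proof.
rewrite -[X in (_ <= X)%N]card_ord.
case: m => [|m].
  by rewrite card_ord leqn0 cards_eq0; apply/eqP/finset.setP => i; rewrite !inE.
rewrite -(@card_in_imset _ _ (fun i : 'I_D => inord i : 'I_m.+1)) ?max_card //.
by move=> i j; rewrite !inE => im jm /(congr1 val) /=; rewrite !inordK // => /val_inj.
Qed.

(** The union bound in counting form. *)
Lemma card_exists_le (I J : finType) (Z : {set I}) (P : pred J) (B : J -> {set I}) :
  (forall x, x \in Z -> exists2 i, P i & x \in B i) ->
  (#|Z| <= \sum_(i | P i) #|B i|)%N.
Proof.
move=> H; pose E x i := P i && (x \in B i).
apply: (@leq_trans (\sum_x #|[set i | E x i]|)).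
  rewrite -sum1_card [leqRHS](bigID (fun x => x \in Z)) /=.
  apply: leq_trans (leq_addr _ _); apply: leq_sum => x /H[i Pi xi].
  by rewrite card_gt0; apply/set0Pn; exists i; rewrite inE /E Pi.
rewrite card_pairsC (bigID P) /= [X in (_ + X)%N]big1 ?addn0; last first.
  by move=> i /negbTE nP; apply/eqP; rewrite cards_eq0; apply/eqP/finset.setP => x;
    rewrite !inE /E nP.
apply: leq_sum => i Pi; apply: subset_leq_card; apply/fintype.subsetP => x.
by rewrite inE /E => /andP[].
Qed.

Section Collisions.
Context {R : realType}.
Variables (w : nat -> R) (K n D : nat).
Implicit Types (X : outcome K n D) (x y : node K n) (k : nat).
Local Notation slot := (node K n * 'I_D)%type.
Local Notation edge_slots := (@edge_slots R w K n D).

Definition collided X k : {set slot} :=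
  [set p in edge_slots X k |
     [exists q in edge_slots X k, (q != p) && (X q == X p)]].

Definition slots_of (m : nat) y : {set slot} :=
  [set p : slot | (p.1 == y) && (p.2 < m)%N].

(** The first [m] potential edges of a node are followed whether or not they are generated. This
    gives a superset of the tree used by the sludge whose size is at most m^k and which ignores all
    coordinates of depth [k] or more. *)
Fixpoint reach (m : nat) X k : {set node K n} :=
  if k is k'.+1 then
    if insub k' is Some hk then
      [set Some (hk, X p) | p in [set p : slot | (p.1 \in reach m X k') && (p.2 < m)%N]]
    else finset.set0
  else [set None].

Lemma upd_depth X k p s : depth p.1 = k ->
  forall q : slot, (depth q.1 < k)%N -> upd X p s q = X q.
Proof. by move=> <- q qp; rewrite ffunE; case: eqP qp => // ->; rewrite ltnn. Qed.

Lemma reach_depth m X k y : y \in reach m X k -> depth y = k.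
Proof.
case: k => [|k] /=; first by rewrite inE => /eqP ->.
by case: insubP => [i _ <-|]; rewrite ?inE // => /finset.imsetP[p _ ->].
Qed.

Lemma eq_reach m X (Y : outcome K n D) k :
  (forall p, (depth p.1 < k)%N -> X p = Y p) -> reach m X k = reach m Y k.
Proof.
elim: k => //= k IH H; case: insubP => // hk _ hkE.
have E : reach m X k = reach m Y k by apply: IH => p pk; apply: H; exact: ltnW.
rewrite E; apply: eq_in_imset => p; rewrite inE => /andP[/reach_depth pk _].
by rewrite H // pk.
Qed.

Lemma card_slots_of m y : (#|slots_of m y| <= m)%N.
Proof.
have inj : injective (fun i : 'I_D => (y, i)) by move=> i j [].
have -> : slots_of m y = (fun i : 'I_D => (y, i)) @: [set i : 'I_D | (i < m)%N].
  apply/finset.setP => -[x i]; rewrite !inE /=; apply/andP/finset.imsetP => [[/eqP -> im]|[l]].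
    by exists i; rewrite ?inE.
  by rewrite inE => lm [-> ->].
rewrite card_imset //; exact: card_ord_lt.
Qed.

Lemma card_reach m X k : (#|reach m X k| <= m ^ k)%N.
Proof.
elim: k => [|k IH] /=; first by rewrite cards1.
case: insubP => [hk _ _|_]; last by rewrite cards0.
apply: leq_trans (leq_imset_card _ _) _.
rewrite expnSr; apply: leq_trans (leq_mul IH (leqnn m)).
rewrite card_pairs (bigID (fun x => x \in reach m X k)) /=.
rewrite [X in (_ + X)%N]big1 ?addn0; last first.
  move=> x /negbTE xr; apply/eqP; rewrite cards_eq0; apply/eqP/finset.setP => i.
  by rewrite !inE /= xr.
rewrite -sum_nat_const; apply: leq_sum => x xr.
rewrite (_ : [set j | _] = [set i : 'I_D | (i < m)%N]); last first.
  by apply/finset.setP => i; rewrite !inE /= xr.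
exact: card_ord_lt.
Qed.

Definition bad m a X k : bool :=
  [exists y in reach m X k, (a.*2 <= #|collided X k :&: slots_of m y|)%N].

Lemma collided_sub X k : collided X k \subset edge_slots X k.
Proof. by apply/fintype.subsetP => p; rewrite inE => /andP[]. Qed.

Lemma collidedP X k p : p \in collided X k ->
  exists2 q, q \in edge_slots X k & (q != p) && (X q == X p).
Proof. by rewrite inE => /andP[_ /exists_inP]. Qed.

Lemma edge_slots_upd X k p s : (k <= K)%N -> depth p.1 = k ->
  edge_slots (upd X p s) k = edge_slots X k.
Proof. by move=> hk pk; apply: eq_edge_slots => // q; exact: upd_depth. Qed.

Lemma image_slots_upd X k p s (A : {set slot}) : (k <= K)%N -> depth p.1 = k ->
  p \in A -> upd X p s @: (edge_slots (upd X p s) k :\: A) =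
              X @: (edge_slots X k :\: A).
Proof.
move=> hk pk pA; rewrite edge_slots_upd //; apply: eq_in_imset => q.
by rewrite inE ffunE => /andP[qA _]; case: eqP qA => // ->; rewrite pA.
Qed.

Lemma card_image_slots X k (A : {set slot}) W : (#|edge_slots X k| <= W)%N ->
  (#|X @: (edge_slots X k :\: A)| <= W)%N.
Proof.
move=> H; apply: leq_trans (leq_imset_card _ _) _.
exact: leq_trans (subset_leq_card (finset.subsetDl _ _)) H.
Qed.

(** If 2a of the first [m] slots of [y] collide, [half_collided] yields [a] of them whose endpoints
    are all hit from outside these [a]. For a fixed choice, the [a] coordinates are independent and
    each falls into a set of at most [W] endpoints. *)
Lemma card_bad m a k W : (k <= K)%N -> (forall X, #|edge_slots X k| <= W)%N ->
  (n ^ a * #|[set X | bad m a X k]| <= m ^ k * 2 ^ m * W ^ a * #|outcome K n D|)%N.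
Proof.
move=> hk EW.
(* [Q y] looks only at coordinates of smaller depth and [F A] only at endpoints of slots outside
   [A], so resampling the coordinates in [A] alters neither. *)
pose Q y X := y \in reach m X k.
pose F (A : {set slot}) X := X @: (edge_slots X k :\: A).
pose B (yA : node K n * {set slot}) :=
  [set X | Q yA.1 X && all (fun p => X p \in F yA.2 X) (enum yA.2)].
pose P (yA : node K n * {set slot}) :=
  [&& depth yA.1 == k, yA.2 \in powerset (slots_of m yA.1) & #|yA.2| == a].
have /(leq_mul (leqnn (n ^ a))) : (#|[set X | bad m a X k]| <= \sum_(yA | P yA) #|B yA|)%N.
  apply: card_exists_le => X; rewrite inE => /exists_inP[y yr].
  have CE : collided X k :&: slots_of m y \subset edge_slots X k.
    exact: fintype.subset_trans (finset.subsetIl _ _) (collided_sub X k).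
  move=> /(half_collided CE (h := X))[p|A [AC cA AF]].
    by rewrite finset.in_setI => /andP[/collidedP].
  exists (y, A).
    rewrite /P /= (reach_depth yr) eqxx cA eqxx powersetE andbT.
    exact: fintype.subset_trans AC (finset.subsetIr _ _).
  rewrite inE /Q yr /=; apply/allP => p; rewrite mem_enum; exact: AF.
move=> H; apply: leq_trans H _; rewrite big_distrr /=.
apply: (@leq_trans (\sum_(yA | P yA) W ^ a * #|[set X | Q yA.1 X]|)).
  apply: leq_sum => -[y A] /= /and3P[/= /eqP dy]; rewrite powersetE => Ay /eqP cA.
  have dA p : p \in enum A -> depth p.1 = k.
    by rewrite mem_enum => /(fintype.subsetP Ay); rewrite inE => /andP[/eqP ->].
  rewrite -[X in (X ^ a * _)%N]card_ord -cA (cardE A).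
  apply: card_coords_in => [|p /dA pk X s|p pA X s|X _]; first exact: enum_uniq.
  - by rewrite /Q (eq_reach m (Y := X)) // => q; exact: upd_depth.
  - by rewrite /F image_slots_upd // ?dA // -mem_enum.
  - exact: card_image_slots.
rewrite -big_distrr /= mulnC [leqRHS]mulnAC leq_mul2r; apply/orP; right.
(* The sum over [A] is enlarged to all subsets of the first [m] slots, at most 2^m of them. *)
apply: (@leq_trans (\sum_y \sum_(A in powerset (slots_of m y)) #|[set X | Q y X]|)).
  rewrite pair_big_dep /= [leqRHS](bigID P) /=; apply: leq_trans (leq_addr _ _).
  rewrite [leqRHS](eq_bigl P) // => -[y A] /=; rewrite /P /=.
  by case: (A \in _); rewrite ?andbF.
apply: (@leq_trans (\sum_y 2 ^ m * #|[set X | Q y X]|)).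
  apply: leq_sum => y _; rewrite sum_nat_const card_powerset leq_mul2r.
  by rewrite leq_exp2l // card_slots_of orbT.
rewrite -big_distrr /= -mulnA [leqRHS]mulnCA leq_mul2l; apply/orP; right.
(* Exchanging the sums turns the outcomes reaching [y], summed over [y], into the reached nodes of
   each outcome. *)
have := card_pairsC (fun y X => y \in reach m X k); rewrite /Q => ->.
rewrite mulnC -sum_nat_const; apply: leq_sum => X _.
by apply: leq_trans (card_reach m X k); apply: subset_leq_card; apply/fintype.subsetP => y; rewrite inE.
Qed.

(** A slot collides only if its endpoint is among those of the other slots of its layer, a set of at
    most [W] elements that does not move when this slot is resampled. *)
Lemma sum_collided k W : (k <= K)%N -> (forall X, #|edge_slots X k| <= W)%N ->
  (n * \sum_X #|collided X k| <= W * \sum_X #|edge_slots X k|)%N.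
Proof.
move=> hk EW.
have E (H : outcome K n D -> {set slot}) :
    (\sum_X #|H X| = \sum_p #|[set X | p \in H X]|)%N.
  rewrite -card_pairsC; apply: eq_bigr => X _; apply: eq_card => p.
  by rewrite inE.
rewrite !E !big_distrr /=; apply: leq_sum => p _.
have [pk|pk] := eqVneq (depth p.1) k; last first.
  rewrite (_ : [set X | p \in collided X k] = finset.set0) ?cards0 ?muln0 //.
  apply/finset.setP => X; rewrite finset.in_set0; apply/negbTE/negP; rewrite !inE => /andP[/and3P[_ /eqP pk' _] _].
  by rewrite pk' eqxx in pk.
rewrite -[X in (X * _)%N]card_ord.
pose F X := X @: (edge_slots X k :\: [set p]).
apply: (@leq_trans (#|'I_n| * #|[set X | (p \in edge_slots X k) && (X p \in F X)]|)).
  rewrite leq_mul2l; apply/orP; right; apply: subset_leq_card.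
  apply/fintype.subsetP => X; rewrite [in X in X -> _]finset.in_set => pC.
  have [q qE /andP[qp /eqP qq]] := collidedP pC.
  rewrite inE (fintype.subsetP (collided_sub X k) _ pC) /=.
  by rewrite -qq imset_f // !finset.in_setD1 qp.
apply: card_coord_in => [X s|X s|X _].
- by rewrite edge_slots_upd.
- by rewrite /F image_slots_upd // inE.
- exact: card_image_slots.
Qed.

Lemma edge_countE X k : (k <= K)%N ->
  edge_count w X k = (\sum_(l < k) #|edge_slots X l|)%N.
Proof.
elim: k => [|k IH] hk; first by rewrite edge_count0 big_ord0.
by rewrite edge_countS // IH 1?ltnW // big_ord_recr.
Qed.

Lemma card_slots_le_image X k :
  (#|edge_slots X k| <= #|X @: edge_slots X k| + #|collided X k|)%N.
Proof.
rewrite -(cardsID (collided X k) (edge_slots X k)) addnC.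
rewrite (finset.setIidPr (collided_sub X k)) leq_add2r.
rewrite -(card_in_imset (f := X)).
  by apply: subset_leq_card; apply: finset.imsetS; exact: finset.subsetDl.
move=> p q; rewrite !finset.in_setD => /andP[pC pE] /andP[_ qE] pq.
apply/eqP; apply: contraNT pC => npq; rewrite inE pE; apply/exists_inP; exists q => //.
by rewrite eq_sym npq pq eqxx.
Qed.

(** Slots that do not collide have distinct endpoints. The inequality is strict because the source
    is a node with no incoming edge. *)
Lemma edge_count_lt_node X k : (k <= K)%N ->
  (edge_count w X k < node_count w X k + \sum_(l < k) #|collided X l|)%N.
Proof.
elim: k => [|k IH] hk; first by rewrite edge_count0 node_count0.
rewrite edge_countS // node_countS // big_ord_recr /=.
by rewrite addnACA -addSn leq_add ?IH ?card_slots_le_image // ltnW.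
Qed.

Lemma node_count_le_edge X k : (k <= K)%N ->
  (node_count w X k <= (edge_count w X k).+1)%N.
Proof.
elim: k => [|k IH] hk; first by rewrite edge_count0 node_count0.
rewrite edge_countS // node_countS //.
by rewrite -addSn leq_add ?IH ?leq_imset_card // ltnW.
Qed.

Lemma edge_count_mono X k l : (k <= l <= K)%N ->
  (edge_count w X k <= edge_count w X l)%N.
Proof.
move=> /andP[]; elim: l => [|l IH]; first by rewrite leqn0 => /eqP ->.
rewrite leq_eqVlt ltnS => /predU1P[-> //|kl] hl.
by rewrite edge_countS // (leq_trans (IH kl (ltnW hl))) ?leq_addr.
Qed.

Lemma card_slots_le_count X k l : (k < l <= K)%N ->
  (#|edge_slots X k| <= edge_count w X l)%N.
Proof.
move=> /andP[kl lK]; apply: leq_trans (edge_count_mono X (_ : k.+1 <= l <= K)%N).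
  by rewrite edge_countS ?leq_addl // (leq_trans kl).
by rewrite kl.
Qed.

(** One factor [W] bounds the slots of a single layer, the other the edges of all layers
    together. *)
Lemma sum_all_collided k W : (k <= K)%N -> (forall X, edge_count w X k <= W)%N ->
  (n * \sum_X \sum_(l < k) #|collided X l| <= W * W * #|outcome K n D|)%N.
Proof.
move=> hk EW; rewrite exchange_big big_distrr /=.
apply: (@leq_trans (\sum_(l < k) W * \sum_X #|edge_slots X l|)).
  apply: leq_sum => l _; apply: sum_collided => [|X].
    exact: ltnW (leq_trans (ltn_ord l) hk).
  by apply: leq_trans (EW X); apply: card_slots_le_count; rewrite ltn_ord.
rewrite -big_distrr /= -mulnA leq_mul2l; apply/orP; right.
rewrite exchange_big mulnC -sum_nat_const /=; apply: leq_sum => X _.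
by rewrite -edge_countE.
Qed.

End Collisions.

(** * The tree of nodes of in-degree one *)

Section Tree.
Context {R : realType}.
Variables (w : nat -> R) (K n D : nat) (X : outcome K n D).
Implicit Types (x y u : node K n) (k l : nat).
Local Notation slot := (node K n * 'I_D)%type.
Local Notation G := (random_dag w X).
Hypothesis w_ge0 : forall i, 0 <= w i.
Hypothesis w_le : forall i, (0 < i)%N -> (Num.truncn (w i) <= D)%N.

Lemma darc_depth x y : darc G x y -> depth y = (depth x).+1.
Proof. by case/grown_edge. Qed.

Lemma path_depth x p : path (darc G) x p -> depth (last x p) = (depth x + size p)%N.
Proof.
elim: p x => [|y p IH] x /=; first by rewrite addn0.
by move=> /andP[/darc_depth xy /IH ->]; rewrite xy addSnnS.
Qed.

Lemma walk_depth i u : walk_of_length (darc G) i None u -> depth u = i.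
Proof.
by move=> /existsP[p /andP[/path_depth + /eqP <-]]; rewrite size_tuple.
Qed.

Lemma dist_layer_depth i u : u \in dist_layer G None i -> depth u = i.
Proof. by rewrite inE => /and3P[_ /walk_depth]. Qed.

(** All walks from the source to [u] have length [depth u], so a single walk settles the
    distance. *)
Lemma mem_dist_layer u p : path (darc G) None p -> last None p = u ->
  u \in dvert G -> u \in dist_layer G None (depth u).
Proof.
move=> pth lst uG; have sz := path_depth pth; rewrite lst /= add0n in sz.
rewrite inE uG /=; apply/andP; split.
  apply/existsP; exists (tcast (esym sz) (in_tuple p)).
  by rewrite val_tcast pth lst eqxx.
by apply/forallP => i; apply/negP => /walk_depth E; have := ltn_ord i; rewrite -E ltnn.
Qed.

Lemma label_le k x : x \in pnodes (stage w X k) ->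
  (0 < node_label (stage w X k) x <= node_count w X k)%N.
Proof. by rewrite /node_label /= index_mem. Qed.

Lemma label_gt k x : (k < K)%N -> x \in pnodes (stage w X k.+1) ->
  depth x = k.+1 -> (node_count w X k < node_label (stage w X k.+1) x)%N.
Proof.
move=> hk xk dx; rewrite /node_label ltnS (pnodes_stageS w X hk) index_cat.
case: ifP => [/(stage_depth (ltnW hk))|_]; last exact: leq_addr.
by rewrite dx ltnn.
Qed.

Lemma greens_win_of_weight (r B : R) k : (k < K)%N -> 0 <= r -> B <= r - 1 ->
  (forall u, u \in pnodes (stage w X k) -> depth u = k ->
     w (node_label (stage w X k) u) <= B) ->
  greens_win G None k.+1 r.
Proof.
move=> hk r0 Br HB; apply: (@greens_beat_sludge _ _ _ _ _ _ (@depth K n)) => //.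
- exact: darc_depth.
- exact: dist_layer_depth.
move=> u /= du; set N := [set y | _].
have NE y : y \in N -> exists2 p, p \in edge_slots w X k &
    (p.1 == u) && (y == Some (Ordinal hk, X p)).
  rewrite inE /= grown_stage => /(edgeP _ _ _ _ (leqnn K))[hx _ [m mE ->]].
  exists (u, m); first by rewrite -du.
  rewrite eqxx /= (_ : Ordinal hx = Ordinal hk) //; exact: val_inj.
(* The node [u] may be a potential one that was never generated; then it has no out-neighbours.
   Otherwise an edge certifies that it belongs to the stage, where the weight bound applies. *)
have [N0|[y /NE[p]]] := set_0Vmem N; first by rewrite N0 cards0.
rewrite inE => /and3P[pk _ _] /andP[/eqP pu _]; rewrite pu in pk.
apply: (@leq_trans (out_degree w (stage w X k) u)).
  have sub : N \subset (fun m : 'I_D => Some (Ordinal hk, X (u, m))) @: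
      [set m : 'I_D | (m < out_degree w (stage w X k) u)%N].
    apply/fintype.subsetP => z /NE[[q m]]; rewrite inE => /and3P[/= _ _ mo].
    move=> /andP[/eqP/= qu /eqP ->]; rewrite qu in mo *.
    by apply/finset.imsetP; exists m; rewrite ?inE.
  apply: leq_trans (subset_leq_card sub) _.
  exact: leq_trans (leq_imset_card _ _) (card_ord_lt _ _).
rewrite -(ler_nat R); apply: le_trans (out_degree_le w_ge0 X k u) _.
apply: le_trans (HB _ pk du) (le_trans Br (ltW _)).
exact: greens_rate_lb.
Qed.

Variable m : nat.

Fixpoint tree k : {set node K n} :=
  if k is k'.+1 then
    if insub k' is Some hk then
      [set Some (hk, X p) | p in [set p : slot |
         [&& p.1 \in tree k', (p.2 < m)%N & p \in edge_slots w X k' :\: collided w X k']]]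
    else finset.set0
  else [set None].

(** For an uncollided target the slot found is unique, and this is the tree parent. Elsewhere any
    value will do, since [subtree] needs only a function. *)
Definition parent x : node K n :=
  if x is Some (k, s) then
    if [pick p in edge_slots w X k | X p == s] is Some p then p.1 else None
  else None.

Lemma tree_depth k x : x \in tree k -> depth x = k.
Proof.
case: k => [|k] /=; first by rewrite inE => /eqP ->.
by case: insubP => [i _ <-|]; rewrite ?inE // => /finset.imsetP[p _ ->].
Qed.

Lemma treeSP k (hk : (k < K)%N) x : reflect
  (exists2 p : slot, [&& p.1 \in tree k, (p.2 < m)%N &
      p \in edge_slots w X k :\: collided w X k] & x = Some (Ordinal hk, X p))
  (x \in tree k.+1).
Proof.
rewrite /= insubT; apply: (iffP finset.imsetP) => -[p]; rewrite ?inE => pP ->; exists p.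
- by rewrite !inE.
- by [].
- by move: pP; rewrite !inE.
- by [].
Qed.

Lemma tree_reach k x : x \in tree k -> x \in reach m X k.
Proof.
elim: k x => //= k IH x; case: insubP => [hk _ _|]; last by rewrite inE.
move=> /finset.imsetP[p]; rewrite inE => /and3P[pT pm _] ->.
by apply: imset_f; rewrite inE IH.
Qed.

Lemma noncollided_eq k p q : p \in edge_slots w X k :\: collided w X k ->
  q \in edge_slots w X k -> X q = X p -> q = p.
Proof.
rewrite finset.in_setD => /andP[pC pE] qE qp; apply/eqP; apply: contraNT pC => npq.
by rewrite inE pE; apply/exists_inP; exists q => //; rewrite npq qp eqxx.
Qed.

Lemma tree_node k x : (k <= K)%N -> x \in tree k ->
  (x \in pnodes (stage w X k)) && (in_degree (stage w X k) x <= 1)%N.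
Proof.
case: k => [|k] hk; first by rewrite /= inE => /eqP ->; rewrite /stage take0.
move=> /(treeSP hk)[p /and3P[_ _ pE] ->]; rewrite stage_new_nodeP in_degreeS.
apply/andP; split.
  by apply/exists_inP; exists p => //; move: pE; rewrite finset.in_setD => /andP[].
rewrite -(cards1 p); apply: subset_leq_card; apply/fintype.subsetP => q.
by rewrite !inE => /andP[qE /eqP qp]; apply/eqP; apply: noncollided_eq pE _ qp; rewrite inE.
Qed.

Lemma parent_slot k (hk : (k < K)%N) p : p \in edge_slots w X k :\: collided w X k ->
  parent (Some (Ordinal hk, X p)) = p.1.
Proof.
move=> pE; rewrite /parent; case: pickP => [q /andP[qE /eqP qp]|/(_ p)].
  by rewrite (noncollided_eq pE qE qp).
by move: pE; rewrite finset.in_setD => /andP[_ -> /=]; rewrite eqxx.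
Qed.

Lemma slot_darc k (hk : (k < K)%N) p : p \in edge_slots w X k ->
  darc G p.1 (Some (Ordinal hk, X p)).
Proof.
case: p => x i pE; rewrite /= grown_stage; apply/(edgeP _ _ _ _ (leqnn K)).
have dx : depth x = k by move: pE; rewrite inE => /and3P[_ /eqP].
have hx : (depth x < K)%N by rewrite dx.
exists hx => //; exists i; first by rewrite dx.
by rewrite (_ : Ordinal hx = Ordinal hk) //; exact: val_inj.
Qed.

Lemma tree_path k x : (k <= K)%N -> x \in tree k ->
  exists2 p, path (darc G) None p & last None p = x.
Proof.
elim: k x => [|k IH] x hk; first by rewrite /= inE => /eqP ->; exists [::].
move=> /(treeSP hk)[p /and3P[/(IH _ (ltnW hk))[s sp sl] _]].
rewrite finset.in_setD => /andP[_ pE] ->.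
exists (rcons s (Some (Ordinal hk, X p))); last by rewrite last_rcons.
by rewrite rcons_path sp sl slot_darc.
Qed.

Lemma tree_dist_layer k x : (k <= K)%N -> x \in tree k ->
  x \in dist_layer G None k.
Proof.
move=> hk xT; rewrite -[k](tree_depth xT).
have [p pp pl] := tree_path hk xT; apply: mem_dist_layer pp pl _.
have /andP[xk _] := tree_node hk xT.
rewrite /= inE grown_stage (@stage_nodeP _ _ _ _ _ _ k) ?(tree_depth xT) //.
by rewrite hk leqnn.
Qed.

Variables (j a : nat).
Hypothesis jK : (j <= K)%N.
Hypothesis m_le : forall k u, (k < j)%N -> u \in pnodes (stage w X k) ->
  m%:R + 1 <= w (node_label (stage w X k) u).
Hypothesis good : forall k, (k < j)%N -> ~~ bad w m a X k.

(** The 1 added to [m] in [m_le] pays for the in-degree, which is at most 1 on the tree. *)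
Lemma tree_out_degree k u : (k < j)%N -> u \in tree k ->
  (m <= out_degree w (stage w X k) u)%N.
Proof.
move=> kj uT; have /andP[uk du] := tree_node (ltnW (leq_trans kj jK)) uT.
rewrite /out_degree truncn_ge_nat ?le_max ?lexx ?orbT //.
apply/orP; left; have := m_le kj uk.
by move: du; rewrite -(ler_nat R); lra.
Qed.

Lemma card_tree_children k u : (k < j)%N -> u \in tree k ->
  (m - a.*2 <= #|tree_children (@depth K n) parent
     [set x | (depth x <= j)%N && (x \in tree (depth x))] u|)%N.
Proof.
move=> kj uT; have hk : (k < K)%N := leq_trans kj jK.
have mo := tree_out_degree kj uT.
(* Outcomes hold only [D] coordinates per node; this makes the first [m] slots exist. *)
have mD : (m <= D)%N := leq_trans mo (out_degree_width w_ge0 w_le X k u).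
have du := tree_depth uT.
have /andP[uk _] := tree_node (ltnW hk) uT.
pose h (p : slot) : node K n := Some (Ordinal hk, X p).
have sE : slots_of D m u \subset edge_slots w X k.
  apply/fintype.subsetP => -[x i]; rewrite !inE /= => /andP[/eqP -> im].
  by rewrite uk du eqxx (leq_trans im).
have cs : (m <= #|slots_of D m u|)%N.
  have inj : injective (fun i : 'I_m => (u, widen_ord mD i)).
    by move=> i i' [] /val_inj.
  rewrite -[X in (X <= _)%N]card_ord -(card_imset _ inj); apply: subset_leq_card.
  by apply/fintype.subsetP => _ /finset.imsetP[i _ ->]; rewrite inE /= eqxx ltn_ord.
have cc : (m - a.*2 <= #|slots_of D m u :\: collided w X k|)%N.
  have := good kj; rewrite /bad negb_exists_in => /forall_inP/(_ u (tree_reach uT)).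
  by rewrite -ltnNge cardsD finset.setIC; lia.
apply: leq_trans cc _.
have sub p : p \in slots_of D m u :\: collided w X k ->
    p \in edge_slots w X k :\: collided w X k.
  by rewrite !finset.in_setD => /andP[-> /(fintype.subsetP sE) ->].
have h_inj : {in slots_of D m u :\: collided w X k &, injective h}.
  move=> p q /sub pE /sub; rewrite finset.in_setD => /andP[_ qE] [pq].
  by apply/esym; exact: noncollided_eq pE qE (esym pq).
rewrite -(card_in_imset h_inj); apply: subset_leq_card.
apply/fintype.subsetP => _ /finset.imsetP[p pS ->]; have pE := sub p pS.
move: pS; rewrite finset.in_setD => /andP[pC]; rewrite inE => /andP[/eqP pu pm].
rewrite inE (parent_slot hk pE) pu eqxx du eqxx /= andbT.
rewrite inE kj; apply/(treeSP hk); exists p => //.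
by rewrite pu uT pm.
Qed.

Lemma tree_not_greens_win (r : R) :
  (forall t, (0 < t)%N -> (greens_rate r t < m - a.*2)%N) ->
  ~ greens_win G None j r.
Proof.
move=> rate; set A := [set x | (depth x <= j)%N && (x \in tree (depth x))].
apply: (@sludge_beats_greens _ _ _ _ _ _ (@depth K n) parent A (m - a.*2)) => //.
- by rewrite /A inE /= inE.
- by move=> u; rewrite inE => /andP[_ uT] /card_tree_children; apply.
- move=> u y; rewrite inE => /andP[_ uT]; rewrite inE => /and3P[yA /eqP <- /eqP dy].
  move: yA; rewrite inE dy => /andP[uj]; have hk := leq_trans uj jK.
  move=> /(treeSP hk)[p /and3P[_ _ pE] ->]; rewrite (parent_slot hk pE).
  by apply: slot_darc; move: pE; rewrite finset.in_setD => /andP[].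
- by move=> u; rewrite inE => /andP[_ uT] du; rewrite du in uT; exact: tree_dist_layer.
Qed.

(** The game for [j] presupposes a nonempty layer, which the same tree provides. *)
Lemma tree_dist_layer_neq0 : (a.*2 < m)%N -> dist_layer G None j != finset.set0.
Proof.
move=> am; suff [x xT] : exists x, x \in tree j.
  by apply/set0Pn; exists x; exact: tree_dist_layer.
suff H k : (k <= j)%N -> exists x, x \in tree k by exact: H.
elim: k => [|k IH] kj; first by exists None; rewrite inE.
have [u uT] := IH (ltnW kj).
have : (0 < m - a.*2)%N by rewrite subn_gt0.
move=> /leq_trans/(_ (card_tree_children kj uT)); rewrite card_gt0 => /set0Pn[y].
rewrite inE => /and3P[+ _ /eqP dy]; rewrite inE => /andP[_].
by rewrite dy (tree_depth uT); exists y.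
Qed.

End Tree.

(** * Power sums and the growth of the layers *)

Lemma le_powR (R : realType) (r x y : R) : 0 <= r -> 0 <= x -> x <= y ->
  x `^ r <= y `^ r.
Proof.
by move=> r0 x0 xy; apply: ge0_ler_powR => //; rewrite nnegrE // (le_trans x0).
Qed.

Section PowerSums.
Context {R : realType}.
Variables (i0 c s th : R).
Hypotheses (i0_gt0 : 0 < i0) (c_gt0 : 0 < c) (s_gt0 : 0 < s) (s_lt1 : s < 1).
Hypothesis thE : th = 1 - s.
Let th_gt0 : 0 < th. Proof. by rewrite thE subr_gt0. Qed.

Lemma powR_split (y : R) : 0 < y -> y `^ th = y * y `^ (- s).
Proof.
move=> y0; rewrite thE powRD; last by rewrite (gt_eqF y0) implybT.
by rewrite powRr1 // ltW.
Qed.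

(** Concavity of t^th: the graph lies below its tangent at [y]. It comes from Young's inequality
    with exponents 1/th and 1/s, which reads z^th y^s <= th z + s y. *)
Lemma powR_tangent (y z : R) : 0 < y -> 0 <= z ->
  z `^ th <= y `^ th + th * y `^ (- s) * (z - y).
Proof.
move=> y0 z0.
have th0 : th != 0 by rewrite gt_eqF.
have s0 : s != 0 by rewrite gt_eqF.
have : z `^ th * y `^ s <= th * z + s * y.
  have := @conjugate_powR R (z `^ th) (y `^ s) th^-1 s^-1 (powR_ge0 _ _)
    (powR_ge0 _ _) _ _ _.
  rewrite !invrK -!powRrM !divff // (powRr1 z0) (powRr1 (ltW y0)).
  rewrite [z * _]mulrC [y * _]mulrC.
  by apply; rewrite ?invr_gt0 // thE; ring.
have ys : 0 < y `^ s by rewrite powR_gt0.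
rewrite (powR_split y0).
rewrite powRN -ler_pdivlMr // => /le_trans -> //.
rewrite [leRHS](_ : _ = (th * z + s * y) / y `^ s) // thE.
by field; rewrite gt_eqF.
Qed.

Lemma powRN_le (x y : R) : 0 < x -> x <= y -> y `^ (- s) <= x `^ (- s).
Proof.
move=> x0 xy; have y0 : 0 < y := lt_le_trans x0 xy.
by rewrite !powRN lef_pV2 ?posrE ?powR_gt0 //; apply: le_powR => //; exact: ltW.
Qed.

Lemma powRN_scale_ge (l x : R) : 1 <= l -> 0 < x ->
  l^-1 * x `^ (- s) <= (l * x) `^ (- s).
Proof.
move=> l1 x0; have l0 : 0 < l := lt_le_trans ltr01 l1.
rewrite (powRM _ (ltW l0) (ltW x0)) ler_wpM2r ?powR_ge0 // powRN lef_pV2 ?posrE ?powR_gt0 //.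
by apply: ler1_powR => //; exact: ltW.
Qed.

Lemma powRN_scale_le (l x : R) : 0 < l <= 1 -> 0 < x ->
  (l * x) `^ (- s) <= l^-1 * x `^ (- s).
Proof.
move=> /andP[l0 l1] x0.
rewrite (powRM _ (ltW l0) (ltW x0)) ler_wpM2r ?powR_ge0 // powRN lef_pV2 ?posrE ?powR_gt0 //.
by apply: ger1_powR; [rewrite l0|exact: ltW].
Qed.

Definition plaw (i : nat) : R := c * (i0 + i%:R - 1) `^ (- s).

(** The integral of c (i0 + t)^(-s) over t from 0 to [y], which replaces the sum of the first [y]
    weights. *)
Definition plaw_int (y : R) : R := c / th * ((i0 + y) `^ th - i0 `^ th).

Lemma plawS i : plaw i.+1 = c * (i0 + i%:R) `^ (- s).
Proof. by rewrite /plaw -natr1 addrA addrK. Qed.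

Lemma plaw_ge0 i : 0 <= plaw i.
Proof. by rewrite mulr_ge0 ?powR_ge0 // ltW. Qed.

Lemma plaw_le i l : (0 < i)%N -> (i <= l)%N -> plaw l <= plaw i.
Proof.
case: i => // i _; case: l => // l il; rewrite !plawS ler_wpM2l ?(ltW c_gt0) //.
apply: powRN_le; first by rewrite ltr_pwDl.
by rewrite lerD2l ler_nat.
Qed.

Lemma weight_sumS w (m : nat) : weight_sum w m.+1 = weight_sum w m + w m.+1 :> R.
Proof. by rewrite /weight_sum big_ord_recr. Qed.

Let cth_gt0 : 0 < c / th. Proof. exact: divr_gt0. Qed.

Lemma plaw_int_le (y z : R) : 0 <= y -> y <= z -> plaw_int y <= plaw_int z.
Proof.
have ig := i0_gt0; move=> y0 yz; rewrite /plaw_int ler_wpM2l ?(ltW cth_gt0) // lerD2r.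
by apply: le_powR; [exact: ltW|lra|lra].
Qed.

Lemma weight_sum_ge D : plaw_int D%:R <= weight_sum plaw D.
Proof.
elim: D => [|D IH].
  by rewrite /weight_sum big_ord0 /plaw_int addr0 subrr mulr0.
rewrite weight_sumS plawS; apply: le_trans (lerD IH (lexx _)).
have y0 : 0 < i0 + D%:R by rewrite ltr_pwDl.
have := @powR_tangent (i0 + D%:R) (i0 + D.+1%:R) y0 (addr_ge0 (ltW i0_gt0) (ler0n _ _)).
rewrite -natr1 (_ : i0 + (D%:R + 1) - (i0 + D%:R) = 1); last by ring.
rewrite mulr1 -lerBlDl -(ler_pM2l cth_gt0) [X in _ <= X -> _]mulrA.
by rewrite divfK ?gt_eqF // /plaw_int; lra.
Qed.

(** Each later weight is at most the integral over the unit interval to its left; the first has no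
    such interval and is paid separately. *)
Lemma weight_sum_le D : weight_sum plaw D <= plaw 1 + plaw_int D%:R.
Proof.
case: D => [|D].
  by rewrite /weight_sum big_ord0 /plaw_int addr0 subrr mulr0 addr0 plaw_ge0.
apply: (@le_trans _ _ (plaw 1 + plaw_int D%:R)); last first.
  by rewrite lerD2l plaw_int_le // ler_nat.
elim: D => [|D IH].
  by rewrite weight_sumS /weight_sum big_ord0 add0r /plaw_int addr0 subrr mulr0 addr0.
rewrite weight_sumS [plaw D.+2]plawS; apply: le_trans (lerD IH (lexx _)) _.
have y0 : 0 < i0 + D.+1%:R by rewrite ltr_pwDl.
have := @powR_tangent (i0 + D.+1%:R) (i0 + D%:R) y0 (addr_ge0 (ltW i0_gt0) (ler0n _ _)).
rewrite -natr1 (_ : i0 + D%:R - (i0 + (D%:R + 1)) = -1); last by ring.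
rewrite mulrN1 -(ler_pM2l cth_gt0) mulrDr mulrN [X in _ - X]mulrA.
by rewrite divfK ?gt_eqF // /plaw_int; lra.
Qed.

Lemma weight_sum_ge_min D : D%:R * (c * (i0 + D%:R) `^ (- s)) <= weight_sum plaw D.
Proof.
rewrite [leLHS](_ : _ = \sum_(i < D) plaw D.+1); last first.
  by rewrite sumr_const card_ord -plawS mulr_natl.
apply: ler_sum => i _; apply: plaw_le => //; exact: ltnW (ltn_ord i).
Qed.

(** A concave function vanishing at 0. The tangent at i0 + l y is read at both ends of the interval
    and the two bounds are mixed with weights 1 - l and l. *)
Lemma plaw_int_scale_ge (l y : R) : 0 <= l <= 1 -> 0 <= y ->
  l * plaw_int y <= plaw_int (l * y).
Proof.
move=> /andP[l0 l1] y0; have ly0 : 0 <= l * y by rewrite mulr_ge0.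
have Y0 : 0 < i0 + l * y by rewrite ltr_pwDl.
have H1 := @powR_tangent _ i0 Y0 (ltW i0_gt0).
have H2 := @powR_tangent _ (i0 + y) Y0 (addr_ge0 (ltW i0_gt0) y0).
rewrite /plaw_int mulrCA ler_pM2l //.
have l1' : 0 <= 1 - l by rewrite subr_ge0.
have := lerD (ler_wpM2l l1' H1) (ler_wpM2l l0 H2).
set A := (i0 + l * y) `^ th; set B := (i0 + l * y) `^ (- s).
rewrite [leRHS](_ : _ = A); last by ring.
by lra.
Qed.

Lemma plaw_int_scale_le (l y : R) : 1 <= l -> 0 <= y ->
  plaw_int (l * y) <= l * plaw_int y.
Proof.
move=> l1 y0; have l0 : 0 < l := lt_le_trans ltr01 l1.
have li : 0 <= l^-1 <= 1 by rewrite invr_ge0 (ltW l0) invf_le1.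
have := plaw_int_scale_ge li (mulr_ge0 (ltW l0) y0).
by rewrite mulKf ?gt_eqF // ler_pdivrMl.
Qed.

(* Growth of a layered count D_0 = 1, D_(k+1) ~ weight_sum D_k, compared with a *)
(* reference sequence p: relative errors add up during the first q steps, after *)
(* which the exponent th < 1 absorbs the error made at each step.               *)
Section Growth.
Variables (p wb : nat -> R) (q J : nat) (eps z : R).
Hypotheses (eps_gt0 : 0 < eps) (eps_le : eps <= 1 / 2) (z_gt0 : 0 < z).
Hypotheses (z_q : 20 * z * q.+1%:R <= eps) (z_s : 20 * z <= s * eps).
Hypotheses (p0 : p 0 = 1) (p1 : p 1 = plaw 1) (p_gt0 : forall k, 0 < p k).
Hypotheses (p1_large : 1 <= z * p 1)
  (p_large : forall k, (1 < k)%N -> 1 + plaw 1 <= z * p k).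
Hypothesis p_early : forall k, (0 < k < q)%N ->
  (1 - z) * p k.+1 <= plaw_int (p k) <= (1 + z) * p k.+1.
Hypothesis p_late : forall k, (q <= k)%N ->
  [/\ p k.+1 = c / th * p k `^ th, i0 <= z * p k & i0 `^ th <= z * p k `^ th].
Hypothesis q_gt0 : (0 < q)%N.
Hypothesis wb_plaw : forall k, (0 < k)%N ->
  (1 - z) * wb k.+1 <= c * (i0 + p k) `^ (- s).
Hypothesis wb_large : forall k, (k < J)%N -> 10 <= z * wb k.+1.

(** The error allowed at layer [k]: it rises by eps / (q + 1), at least 20 z, per early layer and
    stays at [eps] from layer [q] on. *)
Definition tol (k : nat) : R := eps * (minn k q).+1%:R / q.+1%:R.

Let q1_gt0 : 0 < q.+1%:R :> R. Proof. by []. Qed.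

Lemma z_small : 40 * z <= eps.
Proof.
have : 2 <= q.+1%:R :> R by rewrite ler_nat.
by have := ltW z_gt0; have := z_q; nra.
Qed.

Lemma tol_le k : tol k <= eps.
Proof.
rewrite /tol ler_pdivrMr // ler_pM2l // ler_nat ltnS; exact: geq_minr.
Qed.

Lemma tol_gt0 k : 0 < tol k.
Proof. by rewrite /tol divr_gt0 // mulr_gt0. Qed.

Lemma tol_ge k : 20 * z <= tol k.
Proof.
have : 20 * z <= tol 0 by rewrite /tol min0n mulr1 ler_pdivlMr.
move/le_trans; apply; rewrite /tol ler_pM2r ?invr_gt0 // ler_pM2l // ler_nat.
by rewrite min0n.
Qed.

Lemma tolS k : (k < q)%N -> tol k + 20 * z <= tol k.+1.
Proof.
move=> kq; rewrite /tol (minn_idPl kq) (minn_idPl (ltnW kq)).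
rewrite -lerBrDl -mulrBl -mulrBr -[X in X - _]natr1 addrAC subrr add0r mulr1.
by rewrite ler_pdivlMr.
Qed.

Lemma tol_late k : (q <= k)%N -> tol k = eps.
Proof. by move=> qk; rewrite /tol (minn_idPr qk) mulfK ?gt_eqF. Qed.

Lemma weight_sum1 : weight_sum plaw 1 = plaw 1.
Proof. by rewrite weight_sumS /weight_sum big_ord0 add0r. Qed.

Lemma growth_ub k D : D%:R <= (1 + tol k) * p k ->
  1 + weight_sum plaw D <= (1 + tol k.+1) * p k.+1.
Proof.
have [eg el zg] := And3 eps_gt0 eps_le z_gt0.
have [ig sg sl] := And3 i0_gt0 s_gt0 s_lt1; have tg := th_gt0.
have zs := z_small; have t1 := tol_ge k.+1; have t0 := tol_le k; have tk := tol_gt0 k.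
have pk1 := p_gt0 k.+1.
case: k => [|k] in t1 t0 tk pk1 *.
  (* Layer 0 leaves only D = 0 or 1, as the tolerance is at most 1/2. *)
  rewrite p0 mulr1 => D1; have {D1} : (D < 2)%N by rewrite -(ltr_nat R); lra.
  have Hp : 1 + plaw 1 <= (1 + tol 1) * p 1 by rewrite -p1; have := p1_large; nra.
  case: D => [|[|//]] _; last by rewrite weight_sum1.
  apply: le_trans Hp; rewrite lerD2l {1}/weight_sum big_ord0; exact: plaw_ge0.
move=> Dp; have := weight_sum_le D; have := @p_large k.+2 isT.
have : plaw_int D%:R <= plaw_int ((1 + tol k.+1) * p k.+1) by apply: plaw_int_le.
have pk := p_gt0 k.+1.
(* In an early layer concavity hands the relative error on without amplifying it, and the increment
   of [tol] covers the new errors. *)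
have [kq|kq] := ltnP k.+1 q.
  have /andP[_ E] := @p_early k.+1 kq.
  have := @plaw_int_scale_le (1 + tol k.+1) (p k.+1) _ (ltW pk).
  move=> /(_ ltac:(lra)) H1 H2 H3 H4; have H5 := tolS kq.
  have H6 : (1 + tol k.+1) * plaw_int (p k.+1) <= (1 + tol k.+1) * ((1 + z) * p k.+2).
    by rewrite ler_pM2l //; lra.
  have H7 : (1 + tol k.+1) * ((1 + z) * p k.+2) <= (1 + tol k.+1 + 2 * z) * p k.+2.
    rewrite mulrA ler_pM2r //; nra.
  have : (1 + tol k.+1 + 2 * z) * p k.+2 + z * p k.+2 <= (1 + tol k.+2) * p k.+2.
    by rewrite -mulrDl ler_pM2r //; lra.
  lra.
have [pE iz _] := p_late kq; rewrite !tol_late ?(leqW kq) //.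
move=> H2 H3 H4.
(* In a late layer the tangent at p turns a relative error [eps] into th eps; the surplus s eps
   covers [i0] and the additive terms. *)
have H5 : plaw_int ((1 + eps) * p k.+1) <= (1 + th * (eps + z)) * p k.+2.
  rewrite pE mulrCA /plaw_int ler_pM2l //.
  apply: (@le_trans _ _ ((i0 + (1 + eps) * p k.+1) `^ th)).
    by rewrite gerBl powR_ge0.
  have -> : (1 + th * (eps + z)) * p k.+1 `^ th =
    p k.+1 `^ th + th * p k.+1 `^ (- s) * ((1 + eps + z) * p k.+1 - p k.+1).
    by rewrite (powR_split pk); ring.
  apply: le_trans (powR_tangent pk _); last by apply: mulr_ge0; lra.
  by apply: le_powR; [exact: ltW|nra|nra].
have : (1 + th * (eps + z)) * p k.+2 + z * p k.+2 <= (1 + eps) * p k.+2.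
  rewrite -mulrDl ler_pM2r // thE; have := z_s; nra.
by lra.
Qed.

(** The tangent of t^th at 1 - eps, read at 1, bounds (1 - eps)^th from below. Its excess over 1 -
    eps is the contraction that pays for the losses in late layers. *)
Lemma one_sub_powR : 1 - eps + s * eps / 2 <= (1 - eps) `^ th.
Proof.
have [eg el zg] := And3 eps_gt0 eps_le z_gt0.
have [ig sg sl] := And3 i0_gt0 s_gt0 s_lt1; have tg := th_gt0.
have y0 : 0 < 1 - eps by lra.
have := powR_tangent y0 ler01; rewrite powR1.
have -> : (1 - eps) `^ (- s) = (1 - eps) `^ th / (1 - eps).
  by rewrite (powR_split y0) mulrAC divff ?mul1r // gt_eqF.
set y := (1 - eps) `^ th => H.
have : 1 - eps <= y * (1 - s * eps).
  rewrite -(ler_pM2r y0) mul1r in H.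
  rewrite (_ : y * (1 - s * eps) = (y + th * (y / (1 - eps)) * (1 - (1 - eps))) * (1 - eps)) //.
  by rewrite thE; field; rewrite gt_eqF.
have sE : 0 < s * eps by rewrite mulr_gt0.
have sE1 : s * eps <= 1 / 2 by nra.
have : 1 - eps <= y -> (1 - eps + s * eps / 2) * (1 - s * eps) <= 1 - eps by nra.
move=> H1 H2; rewrite -(ler_pM2r (_ : 0 < 1 - s * eps)); last by lra.
by apply: le_trans H2; nra.
Qed.

Lemma weight_at_ge k D : (0 < k)%N -> D%:R <= (1 + tol k) * p k ->
  (1 - z) / (1 + tol k) * wb k.+1 <= c * (i0 + D%:R) `^ (- s).
Proof.
have [eg el zg] := And3 eps_gt0 eps_le z_gt0.
have [ig sg sl] := And3 i0_gt0 s_gt0 s_lt1; have tg := th_gt0.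
move=> k0 Dp; have pk := p_gt0 k; have tk := tol_gt0 k.
have lip : 0 < i0 + p k by rewrite addr_gt0.
apply: (@le_trans _ _ (c * ((1 + tol k) * (i0 + p k)) `^ (- s))); last first.
  rewrite ler_pM2l //; apply: powRN_le; first by rewrite ltr_pwDl.
  by rewrite mulrDr lerD // ler_peMl ?(ltW i0_gt0) //; lra.
apply: (@le_trans _ _ (c * ((1 + tol k)^-1 * (i0 + p k) `^ (- s)))); last first.
  by rewrite ler_pM2l //; apply: powRN_scale_ge => //; lra.
rewrite [leRHS]mulrCA [leLHS]mulrAC [leLHS]mulrC ler_pM2l ?invr_gt0; last by lra.
exact: wb_plaw.
Qed.

Lemma growth_lb k D D' : (k < J)%N ->
  (1 - tol k) * p k <= D%:R <= (1 + tol k) * p k ->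
  weight_sum plaw D <= D'%:R + 2 * D%:R + 2 * z * p k.+1 ->
  (1 - tol k.+1) * p k.+1 <= D'%:R.
Proof.
have [eg el zg] := And3 eps_gt0 eps_le z_gt0.
have [ig sg sl] := And3 i0_gt0 s_gt0 s_lt1; have tg := th_gt0.
move=> kJ; have zs := z_small; have t1 := tol_ge k.+1; have t0 := tol_le k.
have tk := tol_gt0 k; have pk1 := p_gt0 k.+1; have wJ := wb_large kJ.
case: k => [|k] in kJ t1 t0 tk pk1 wJ *.
  rewrite p0 !mulr1 => /andP[D0 D1].
  have {D1} : (D < 2)%N by rewrite -(ltr_nat R); lra.
  have {D0} : (0 < D)%N by rewrite -(ltr_nat R); lra.
  case: D => [//|[|//]] _ _; rewrite weight_sum1 -p1.
  have := p1_large; nra.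
move=> /andP[D0 D1] H; have pk := p_gt0 k.+1.
(* All of the first D weights are at least 5 / z, so the loss of 2 per node is at most a fraction
   [z] of their sum. *)
have wD : 5 <= z * (c * (i0 + D%:R) `^ (- s)).
  have h : 1 / 2 <= (1 - z) / (1 + tol k.+1) by rewrite ler_pdivlMr; lra.
  have := @weight_at_ge k.+1 D isT D1; rewrite -(ler_pM2l z_gt0) => /(le_trans _); apply.
  rewrite mulrCA; have : 1 / 2 * (z * wb k.+2) <= (1 - z) / (1 + tol k.+1) * (z * wb k.+2).
    by rewrite ler_wpM2r //; lra.
  lra.
have fD := weight_sum_ge_min D.
set f := weight_sum plaw D in H fD *.
have D2 : 2 * D%:R <= z * f.
  have := ler_wpM2l (ltW z_gt0) fD; rewrite mulrCA.
  have := ler_wpM2l (ler0n R D) wD; have := ler0n R D; lra.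
have fP : plaw_int ((1 - tol k.+1) * p k.+1) <= f.
  apply: le_trans (weight_sum_ge D); apply: plaw_int_le => //.
  by rewrite mulr_ge0 ?ltW //; lra.
(* If f >= (e + 3z) p, the losses z f and 2 z p still leave D' >= e p; each of the two regimes then
   only supplies its [e]. *)
have key : forall e, 0 <= e <= 1 - 4 * z -> 1 - tol k.+2 <= e ->
    (e + 4 * z) * p k.+2 <= (f + z * p k.+2) -> (1 - tol k.+2) * p k.+2 <= D'%:R.
  move=> e /andP[e0 e1] ee ef; have H1 : (1 - z) * f <= D'%:R + 2 * z * p k.+2 by lra.
  have H2 : (1 - z) * ((e + 3 * z) * p k.+2) <= (1 - z) * f.
    by rewrite ler_pM2l; lra.
  apply: (@le_trans _ _ (e * p k.+2)); first by rewrite ler_pM2r //; lra.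
  have H3 : (e + 2 * z) * p k.+2 <= (1 - z) * ((e + 3 * z) * p k.+2).
    by rewrite mulrA ler_pM2r //; nra.
  by have := mulr_gt0 z_gt0 pk1; lra.
have [kq|kq] := ltnP k.+1 q.
  have /andP[E _] := @p_early k.+1 kq; have tS := tolS kq.
  apply: (key (1 - tol k.+1 - 5 * z)); [lra|lra|].
  have /(_ _)/le_trans/(_ fP) := @plaw_int_scale_ge (1 - tol k.+1) (p k.+1) _ (ltW pk).
  move=> /(_ ltac:(lra)) H1.
  have H2 : (1 - tol k.+1) * ((1 - z) * p k.+2) <= f.
    by apply: le_trans H1; rewrite ler_pM2l //; lra.
  have H3 : (1 - tol k.+1 - z) * p k.+2 <= (1 - tol k.+1) * ((1 - z) * p k.+2).
    by rewrite mulrA ler_pM2r //; nra.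
  by have := mulr_gt0 z_gt0 pk1; lra.
have [pE iz ith] := p_late kq; rewrite tol_late // in fP.
have one := one_sub_powR.
apply: (key (1 - eps)); [lra|by rewrite tol_late ?(leqW kq)|].
have : (1 - eps + s * eps / 2 - z) * p k.+2 <= f.
  apply: le_trans fP; rewrite pE /plaw_int mulrCA ler_pM2l //.
  apply: (@le_trans _ _ (((1 - eps) * p k.+1) `^ th - i0 `^ th)); last first.
    rewrite lerD2r; by apply: le_powR; [exact: ltW|nra|nra].
  rewrite powRM ?(ltW pk) //; last by lra.
  have pth : 0 < p k.+1 `^ th by rewrite powR_gt0.
  have : (1 - eps + s * eps / 2) * p k.+1 `^ th <= (1 - eps) `^ th * p k.+1 `^ th.
    by rewrite ler_pM2r.
  lra.
have : (1 - eps + 4 * z) * p k.+2 <= (1 - eps + s * eps / 2 - z) * p k.+2.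
  by rewrite ler_pM2r //; have := z_s; lra.
by have := mulr_gt0 z_gt0 pk1; lra.
Qed.

End Growth.
End PowerSums.

(** * Large n *)

Section LargeIndex.
Context {R : realType}.
Implicit Types (n : nat) (t C e : R).
Local Open Scope classical_set_scope.

Lemma near_natr_ge C : \forall n \near \oo, C <= n%:R.
Proof.
exists (Num.truncn C).+1 => // n /= Cn.
by apply/ltW/(lt_le_trans (truncnS_gt C)); rewrite ler_nat.
Qed.

Lemma near_powR_ge t C : 0 < t -> \forall n \near \oo, C <= n%:R `^ t.
Proof.
move=> t0; have [C0|C0] := leP C 0.
  by near=> n; apply: le_trans C0 (powR_ge0 _ _).
near=> n; rewrite (_ : C = (C `^ t^-1) `^ t).
  by apply: le_powR; [exact: ltW|exact: powR_ge0|near: n; exact: near_natr_ge].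
by rewrite -powRrM mulVf ?gt_eqF // powRr1 // ltW.
Unshelve. all: by end_near. Qed.

Lemma near_powR_le t e : t < 0 -> 0 < e -> \forall n \near \oo, n%:R `^ t <= e.
Proof.
move=> t0 e0; have : 0 < - t by rewrite oppr_gt0.
move/(@near_powR_ge _ e^-1); apply: filterS => n.
rewrite powRN => H; have : 0 < (n%:R `^ t)^-1 by apply: lt_le_trans H; rewrite invr_gt0.
by rewrite invr_gt0 => n0; move: H; rewrite lef_pV2.
Qed.

Lemma near_lnln_ge C : \forall n \near \oo, C <= ln (ln (n%:R : R)).
Proof.
apply: filterS (near_natr_ge (expR (expR C))) => n H.
have n0 : 0 < n%:R :> R := lt_le_trans (expR_gt0 _) H.
have : expR C <= ln (n%:R : R) by rewrite -[leLHS]expRK ler_ln ?posrE ?expR_gt0.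
move=> H1; have l0 := lt_le_trans (expR_gt0 _) H1.
by rewrite -[leLHS]expRK ler_ln ?posrE ?expR_gt0.
Qed.

Lemma ln_le_powR (y t : R) : 0 < t -> 0 < y -> ln y <= t^-1 * y `^ t.
Proof.
move=> t0 y0; rewrite ler_pdivlMl // -ln_powR.
have yt : 0 < y `^ t by rewrite powR_gt0.
have := expR_ge1Dx (ln (y `^ t)); rewrite lnK ?posrE //; lra.
Qed.

Lemma near_lnln_exp_le (k : nat) t : 0 < t ->
  \forall n \near \oo, ln (ln (n%:R : R)) ^+ k <= n%:R `^ t.
Proof.
(* With this [u] both factors of (n^u / u)^k are eventually at most n^(t/2). *)
move=> t0; pose u := t / (2 * k.+1%:R).
have k0 : 0 < 2 * k.+1%:R :> R by rewrite mulr_gt0.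
have u0 : 0 < u by rewrite divr_gt0.
near=> n.
have L1 : 1 <= ln (ln (n%:R : R)) by near: n; exact: near_lnln_ge.
have n1 : 1 <= n%:R :> R by near: n; exact: near_natr_ge.
have n0 : 0 < n%:R :> R by exact: lt_le_trans n1.
have l0 : 0 < ln (n%:R : R).
  rewrite ltNge; apply/negP => l0; have := ln_le0 (le_trans l0 ler01); lra.
have Ll : ln (ln (n%:R : R)) <= ln n%:R.
  by have := expR_ge1Dx (ln (ln (n%:R : R))); rewrite lnK ?posrE //; lra.
have H : ln (ln (n%:R : R)) <= u^-1 * n%:R `^ u by apply: le_trans Ll (ln_le_powR _ _).
apply: (@le_trans _ _ ((u^-1 * n%:R `^ u) ^+ k)).
  by apply: lerXn2r; rewrite ?nnegrE ?mulr_ge0 ?invr_ge0 ?powR_ge0 ?(ltW u0) //; lra.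
rewrite exprMn -[(n%:R `^ u) ^+ k]powR_mulrn ?powR_ge0 // -powRrM.
have -> : n%:R `^ t = n%:R `^ (t / 2) * n%:R `^ (t / 2) :> R.
  by rewrite -powRD ?(gt_eqF n0) ?implybT // -splitr.
apply: ler_pM; rewrite ?exprn_ge0 ?invr_ge0 ?(ltW u0) ?powR_ge0 //.
  by near: n; apply: near_powR_ge; rewrite divr_gt0.
rewrite ler_powR // /u mulrAC ler_pdivrMr // [t / 2 * _]mulrA divfK //.
by rewrite ler_pM2l // ler_nat.
Unshelve. all: by end_near. Qed.

Lemma near_bounded (N : nat) (P : nat -> nat -> Prop) :
  (forall k, (k < N)%N -> \forall n \near \oo, P n k) ->
  \forall n \near \oo, forall k, (k < N)%N -> P n k.
Proof.
elim: N => [|N IH] H; first by near=> n.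
have H1 := IH (fun k kN => H k (ltnW kN)).
apply: filterS2 H1 (H N (leqnn _)) => n h1 h2 k.
by rewrite ltnS leq_eqVlt => /predU1P[->//|]; exact: h1.
Unshelve. all: by end_near. Qed.

End LargeIndex.

(** * Parameters of the power law *)

Section PowerLawIdentities.
Context {R : realType}.
Variables (beta d alpha : R).
Hypotheses (hb : 2 < beta) (hd : 0 < d) (ha : 0 < alpha < 1).
Implicit Types (n k : nat).

Local Notation s := (1 / (beta - 1)).
Local Notation th := ((beta - 2) / (beta - 1)).
Local Notation x := (pl_x beta alpha).
Local Notation M := (pl_M alpha).
Local Notation i0 := (pl_i0 beta d alpha).
Local Notation c := (pl_c beta d).
Local Notation gam := (pl_gamma beta d alpha).
Local Notation base := (pl_base beta d alpha).
Local Notation wbar := (pl_wbar beta d alpha).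

Definition kap : R := (d * th) `^ (beta - 1).

Let b1_gt0 : 0 < beta - 1. Proof. by have := hb; lra. Qed.
Let b2_gt0 : 0 < beta - 2. Proof. by have := hb; lra. Qed.

Lemma pl_s_gt0 : 0 < s. Proof. exact: divr_gt0. Qed.

Lemma pl_s_lt1 : s < 1.
Proof. by rewrite ltr_pdivrMr // mul1r; have := hb; lra. Qed.

Lemma pl_thE : th = 1 - s.
Proof. by field; rewrite gt_eqF. Qed.

Lemma pl_th_gt0 : 0 < th. Proof. exact: divr_gt0. Qed.

Lemma pl_th_lt1 : th < 1.
Proof. by rewrite pl_thE; have := pl_s_gt0; lra. Qed.

Lemma dth_gt0 : 0 < d * th.
Proof. by rewrite mulr_gt0 // pl_th_gt0. Qed.

Lemma kap_gt0 : 0 < kap.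
Proof. by rewrite powR_gt0 // dth_gt0. Qed.

Lemma alpha_x : alpha * x = 1 - alpha * beta + 3 * alpha.
Proof.
have [/gt_eqF a0 _] := andP ha; rewrite /pl_x; field; by rewrite a0.
Qed.

Lemma natr_gt0 n : (0 < n)%N -> 0 < n%:R :> R. Proof. by rewrite ltr0n. Qed.

Lemma powRD_pos (y u v : R) : 0 < y -> y `^ u * y `^ v = y `^ (u + v).
Proof. by move=> y0; rewrite powRD // (gt_eqF y0) implybT. Qed.

(** Against layer sizes of order n^(alpha k), this exponent shows that [i0] dominates exactly when k
    + 2 < x. This is where the critical value [x] and the cases of [pl_wbar] come from. *)
Lemma pl_i0E n : (0 < n)%N -> i0 n = kap * n%:R `^ (alpha * (x - 2)).
Proof.
move=> /natr_gt0 n0; rewrite /pl_i0 /pl_M /kap.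
rewrite (_ : d / n%:R `^ alpha * th = d * th * n%:R `^ (- alpha)); last first.
  by rewrite powRN mulrAC.
rewrite (powRM _ (ltW dth_gt0) (powR_ge0 _ _)) -powRrM mulrCA.
rewrite -{1}[n%:R]powRr1 ?(ltW n0) // powRD_pos //; congr (_ * _ `^ _).
by rewrite [alpha * (x - 2)]mulrBr alpha_x; ring.
Qed.

Lemma kap_s : kap `^ (- s) = (d * th)^-1.
Proof.
rewrite /kap -powRrM (_ : (beta - 1) * - s = -1) ?powR_inv1 ?(ltW dth_gt0) //.
by field; rewrite gt_eqF.
Qed.

Lemma pl_cE n : c n = d * th * n%:R `^ s.
Proof. by rewrite /pl_c [d * th]mulrC. Qed.

Lemma plaw1 n : (0 < n)%N -> plaw (i0 n) (c n) s 1 = M n.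
Proof.
move=> n0; have nR := natr_gt0 n0; rewrite plawS addr0 pl_i0E // pl_cE /pl_M.
rewrite powRM ?(ltW kap_gt0) ?powR_ge0 // kap_s -powRrM mulrACA divff ?mul1r; last first.
  by rewrite gt_eqF // dth_gt0.
rewrite powRD_pos //; congr (_ `^ _).
rewrite [alpha * (x - 2)]mulrBr alpha_x; field; by rewrite gt_eqF.
Qed.

Lemma pl_c_th n : c n / th = d * n%:R `^ s.
Proof.
rewrite pl_cE mulrAC mulfK // gt_eqF //; exact: pl_th_gt0.
Qed.

Lemma beta_th : (beta - 1) * th = beta - 2.
Proof. by field; rewrite gt_eqF. Qed.

Lemma d_pow : d * d `^ (beta - 2) = d `^ (beta - 1).
Proof.
rewrite -{1}[d]powRr1 ?(ltW hd) // powRD_pos //; congr (_ `^ _); ring.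
Qed.

(** * The reference sequence and its critical layer, with q = j_1 - 1 *)

Variable q : nat.
Hypotheses (q_gt0 : (0 < q)%N) (q_j1 : pl_j1 beta alpha = q.+1%:Z).
Hypotheses (q_le : q.+1%:R <= Num.max x 2) (q_gt : Num.max x 2 < q.+2%:R).

Lemma x_lt : x < q.+2%:R.
Proof. by apply: le_lt_trans q_gt; rewrite le_max lexx. Qed.

Lemma x_ge : (1 < q)%N -> q.+1%:R <= x.
Proof.
move=> q1; have := q_le; rewrite le_max => /orP[//|].
by rewrite ler_nat ltnNge q1.
Qed.

(* The critical case of the informal statement, in which x = j_1 >= 3. *)
Lemma pl_gammaP :
  [/\ x = q.+1%:R, (1 < q)%N & gam = d `^ (beta - 1) * th `^ (beta - 2) *
      ((1 + (d * th) `^ (1 - beta)) `^ th - 1)] \/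
  gam = 1 /\ (x = q.+1%:R -> q = 1%N).
Proof.
rewrite /pl_gamma; case: ifP => [/and4P[/natrP[k xk] x0 x1 x2]|xN]; [left|right].
  have k3 : (2 < k)%N.
    by move: x0 x1 x2; rewrite xk; case: k {xk} => [|[|[|]]]; rewrite ?eqxx.
  suff kq : k = q.+1 by rewrite xk kq; split => //; move: k3; rewrite kq.
  have : x < q.+2%:R := x_lt; rewrite xk ltr_nat ltnS => kq.
  have := q_le; rewrite le_max xk !ler_nat => /orP[qk|q2].
    by apply/eqP; rewrite eqn_leq kq qk.
  by have := leq_trans k3 (leq_trans kq q2); rewrite ltnn.
split=> // xq; apply/eqP; move/negbT: xN; rewrite xq !negb_and.
rewrite natr_nat !negbK pnatr_eq0 (eqr_nat R q.+1 1) (eqr_nat R q.+1 2) !eqSS /=.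
by rewrite (gtn_eqF q_gt0).
Qed.

Lemma pl_gamma_gt0 : 0 < gam.
Proof.
case: pl_gammaP => [[_ _ ->]|[-> _]] //.
rewrite mulr_gt0 // ?mulr_gt0 ?powR_gt0 ?pl_th_gt0 // subr_gt0.
apply: (@le_lt_trans _ _ (1 `^ th)); first by rewrite powR1.
apply: gt0_ltr_powR; rewrite ?pl_th_gt0 ?nnegrE //.
  by rewrite addr_ge0 // powR_ge0.
by rewrite ltrDl powR_gt0 // dth_gt0.
Qed.

(** Early layers grow by the factor M = n^alpha. From [q] on this is the closed form of p_(k+1) = d
    n^s p_k^th, whose fixed point is n d^(beta-1): [base] is the ratio of p_q to the fixed point,
    and each step raises the ratio to the power th. *)
Definition pl_p n k : R :=
  if (k < q)%N then n%:R `^ (alpha * k%:R)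
  else n%:R * d `^ (beta - 1) * base n `^ (th ^+ (k - q)).

Lemma pl_baseE n : base n =
  gam / d `^ (beta - 1) * n%:R `^ (alpha * q%:R - 1).
Proof. by rewrite /pl_base q_j1 -[q.+1%:~R]/(q.+1%:R) -natr1 addrK. Qed.

Lemma pl_base_gt0 n : (0 < n)%N -> 0 < base n.
Proof.
move=> /natr_gt0 n0; rewrite pl_baseE mulr_gt0 ?divr_gt0 ?powR_gt0 //.
exact: pl_gamma_gt0.
Qed.

Lemma pl_p_gt0 n k : (0 < n)%N -> 0 < pl_p n k.
Proof.
move=> n0; have nR := natr_gt0 n0; rewrite /pl_p; case: ifP => _.
  exact: powR_gt0.
by rewrite !mulr_gt0 ?powR_gt0 ?pl_base_gt0.
Qed.

Lemma pl_p_early n k : (k < q)%N -> pl_p n k = n%:R `^ (alpha * k%:R).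
Proof. by rewrite /pl_p => ->. Qed.

Lemma pl_p_late n k : (q <= k)%N ->
  pl_p n k = n%:R * d `^ (beta - 1) * base n `^ (th ^+ (k - q)).
Proof. by rewrite /pl_p ltnNge => ->. Qed.

Lemma pl_p0 n : pl_p n 0 = 1.
Proof. by rewrite pl_p_early // mulr0 powRr0. Qed.

Lemma pl_pq n : (0 < n)%N -> pl_p n q = gam * n%:R `^ (alpha * q%:R).
Proof.
move=> /natr_gt0 n0; rewrite /pl_p ltnn subnn expr0.
rewrite powRr1; last first.
  by rewrite pl_baseE mulr_ge0 ?divr_ge0 ?powR_ge0 // ltW // pl_gamma_gt0.
rewrite pl_baseE -{1}[n%:R]powRr1 ?(ltW n0) //.
have dd : d `^ (beta - 1) != 0 by rewrite gt_eqF // powR_gt0.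
rewrite mulrACA [_ * n%:R `^ _]mulrC.
rewrite (_ : n%:R `^ (alpha * q%:R) = n%:R `^ 1 * n%:R `^ (alpha * q%:R - 1)).
  by field.
by rewrite powRD_pos //; congr (_ `^ _); ring.
Qed.

Lemma pl_p_lateS n k : (0 < n)%N -> (q <= k)%N ->
  pl_p n k.+1 = c n / th * pl_p n k `^ th.
Proof.
move=> n0 qk; have nR := natr_gt0 n0; have b0 := pl_base_gt0 n0.
rewrite (pl_c_th n) (pl_p_late n qk) (pl_p_late n (leqW qk)) (subSn qk).
have nE : n%:R `^ s * n%:R `^ th = n%:R :> R.
  by rewrite powRD_pos // [in _ + _]pl_thE addrC subrK powRr1 // ltW.
have dE : d * (d `^ (beta - 1)) `^ th = d `^ (beta - 1).
  by rewrite -powRrM beta_th d_pow.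
have bE : base n `^ (th ^+ (k - q).+1) = (base n `^ (th ^+ (k - q))) `^ th.
  by rewrite -powRrM -exprSr.
have -> : (n%:R * d `^ (beta - 1) * base n `^ (th ^+ (k - q))) `^ th =
    n%:R `^ th * (d `^ (beta - 1)) `^ th * base n `^ (th ^+ (k - q).+1).
  have P1 := powR_ge0 d (beta - 1); have P2 := powR_ge0 (base n) (th ^+ (k - q)).
  by rewrite (powRM _ (mulr_ge0 (ltW nR) P1) P2) (powRM _ (ltW nR) P1) bE.
move: nE dE {bE}; set u := _ `^ s; set v := n%:R `^ th; set B := base n `^ _.
set D := d `^ (beta - 1); set E := D `^ th => nE dE.
transitivity (u * v * (d * E) * B); first by rewrite nE dE.
by clearbody u v B E D; clear; ring.
Qed.

Lemma pl_p_1 n : (0 < n)%N -> pl_p n 1 = M n.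
Proof.
move=> n0; have [q1|q1] := ltnP 1 q; first by rewrite pl_p_early // mulr1.
have q1' : q = 1%N by apply/eqP; rewrite eqn_leq q1 q_gt0.
have := pl_pq n0; rewrite q1' mulr1 => ->; rewrite /pl_M.
by case: pl_gammaP => [[_]|[-> _]]; [rewrite q1'|rewrite mul1r].
Qed.

Lemma pl_p_earlyS n k : (0 < n)%N -> (k.+1 <= q)%N -> k.+2%:R < x ->
  pl_p n k.+1 = n%:R `^ (alpha * k.+1%:R).
Proof.
move=> n0; rewrite leq_eqVlt => /predU1P[kq|kq] kx; last exact: pl_p_early.
rewrite kq pl_pq //; case: pl_gammaP => [[xq]|[-> _]]; last by rewrite mul1r.
by move: kx; rewrite xq kq ltxx.
Qed.

Lemma pl_wbar1 n : wbar n 1 = M n. Proof. by []. Qed.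

Lemma pl_wbar_early n k : (0 < k)%N -> k.+2%:R < x -> wbar n k.+1 = M n.
Proof.
case: k => // k _ kx; rewrite /pl_wbar /=.
have E : alpha^-1 - beta + 3 = x by [].
have E2 : alpha^-1 - beta + 2 = x - 1 by rewrite /pl_x; ring.
rewrite E E2 ifT; first by rewrite ifT //; move: kx; rewrite -[k.+3%:R]natr1; lra.
by move: kx; rewrite -[k.+3%:R]natr1; lra.
Qed.

Lemma pl_wbar_critical n k : (0 < k)%N -> k.+2%:R = x ->
  wbar n k.+1 = pl_xi beta d * M n.
Proof.
case: k => // k _ kx; rewrite /pl_wbar /=.
have E : alpha^-1 - beta + 3 = x by [].
have E2 : alpha^-1 - beta + 2 = k.+2%:R.
  have <- : x - 1 = k.+2%:R by rewrite -kx -[k.+3%:R]natr1 addrK.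
  by rewrite /pl_x; ring.
by rewrite E E2 ltxx eqxx -kx ifT // ltr_nat.
Qed.

(** Late weights are those at label p_k, with [i0] neglected; the two overlapping branches of
    [pl_wbar] are unified here. *)
Lemma pl_wbar_late n k : (0 < n)%N -> (q <= k)%N ->
  wbar n k.+1 = c n * pl_p n k `^ (- s).
Proof.
move=> n0 qk; have nR := natr_gt0 n0; have k0 := leq_trans q_gt0 qk.
have E : alpha^-1 - beta + 3 = x by [].
have E2 : alpha^-1 - beta + 2 = x - 1 by rewrite /pl_x; ring.
have xq := x_lt.
rewrite /pl_wbar ltnS ltnNge k0 /= E E2.
(* The branch below the critical value is still active only for k = q, and then gamma = 1. *)
case: ifP => [kx|kx].
  have kq : k = q.
    apply/eqP; rewrite eqn_leq qk andbT -ltnS -ltnS -(ltr_nat R).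
    exact: lt_trans kx xq.
  rewrite {}kq in kx *.
  have xq1 : x - 1 < q.+1%:R by move: xq; rewrite -[q.+2%:R]natr1; lra.
  rewrite ifF; last by apply/negbTE; rewrite -leNgt ltW.
  rewrite ifF; last by apply/negbTE; rewrite gt_eqF.
  rewrite pl_pq //; case: pl_gammaP => [[xE]|[-> _]]; first by rewrite xE ltxx in kx.
  rewrite mul1r -powRrM pl_cE -[RHS]mulrA powRD_pos // [d * th]mulrC.
  congr (_ * _ `^ _); rewrite -[q.+1%:R]natr1; field; by rewrite gt_eqF.
have b0 := pl_base_gt0 n0.
rewrite (pl_p_late n qk) pl_cE q_j1.
rewrite (_ : k.+1%:Z - q.+1%:Z = (k - q)%N%:Z); last first.
  by rewrite subzn // subSS.
rewrite -exprnP powRM ?mulr_ge0 ?powR_ge0 // powRM ?powR_ge0 // -!powRrM.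
rewrite (_ : (beta - 1) * - s = -1); last by field; rewrite gt_eqF.
rewrite powR_inv1 ?(ltW hd) // (_ : - th ^+ (k - q) / (beta - 1) = th ^+ (k - q) * - s).
  have ns : n%:R `^ s * n%:R `^ (- s) = 1 :> R by rewrite powRD_pos // subrr powRr0.
  set B := base n `^ _; set u := n%:R `^ s in ns *; set v := n%:R `^ (- s) in ns *.
  transitivity (th * (d / d) * B * (u * v)); last by ring.
  by rewrite ns divff ?gt_eqF // !mulr1.
by field; rewrite gt_eqF.
Qed.

(** Here [i0] equals kap p_(q-1), so neither term may be neglected. The factor kap + 1 in i0 +
    p_(q-1) produces the constant xi in the weight and gamma in the integral. *)
Lemma pl_critical n : (0 < n)%N -> x = q.+1%:R -> (1 < q)%N ->
  [/\ wbar n q = c n * (i0 n + pl_p n q.-1) `^ (- s) &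
      plaw_int (i0 n) (c n) th (pl_p n q.-1) = pl_p n q].
Proof.
move=> n0 xq q1; have nR := natr_gt0 n0.
have qE : q = q.-1.+1 by rewrite prednK.
have q1R : q%:R = q.-1%:R + 1 :> R by rewrite natr1 -qE.
have xq1 : x - 2 = q.-1%:R by rewrite xq -natr1 q1R; ring.
have pE : pl_p n q.-1 = n%:R `^ (alpha * (x - 2)).
  by rewrite pl_p_early ?xq1 // -qE.
have iE : i0 n + pl_p n q.-1 = (kap + 1) * pl_p n q.-1.
  by rewrite pl_i0E // -pE mulrDl mul1r.
have p0 := pl_p_gt0 q.-1 n0.
have k1 : 0 < kap + 1 by rewrite addr_gt0 // kap_gt0.
split.
  rewrite {1}qE pl_wbar_critical; last by rewrite -qE xq.
    rewrite iE -(plaw1 n0) plawS addr0 pl_i0E // -pE.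
    rewrite powRM ?(ltW kap_gt0) ?(ltW p0) // powRM ?(ltW k1) ?(ltW p0) //.
    rewrite kap_s /pl_xi -[d * _ / _]mulrA -/kap.
    have dt : d * th != 0 by rewrite gt_eqF // dth_gt0.
    rewrite [th * d]mulrC; set v := (kap + 1) `^ _; set u := _ `^ (- s).
    transitivity (d * th / (d * th) * (c n * (v * u))); first by ring.
    by rewrite divff // mul1r.
  by rewrite -ltnS -qE.
rewrite /plaw_int iE pl_i0E // -pE.
rewrite powRM ?(ltW k1) ?(ltW p0) // powRM ?(ltW kap_gt0) ?(ltW p0) //.
rewrite pl_c_th pl_pq //.
case: pl_gammaP => [[_ _ ->]|[_ /(_ xq)]]; last by move=> q1'; rewrite q1' in q1.
have kth : kap `^ th = (d * th) `^ (beta - 2) by rewrite /kap -powRrM beta_th.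
have kinv : (d * th) `^ (1 - beta) = kap^-1.
  by rewrite /kap -powRN; congr (_ `^ _); ring.
have -> : (kap + 1) `^ th = kap `^ th * (1 + kap^-1) `^ th.
  rewrite -powRM ?(ltW kap_gt0) //; last by rewrite addr_ge0 // invr_ge0 ltW // kap_gt0.
  by rewrite mulrDr mulr1 divff // gt_eqF // kap_gt0.
rewrite kinv kth powRM ?(ltW hd) ?(ltW pl_th_gt0) // -d_pow.
rewrite (_ : n%:R `^ (alpha * q%:R) = n%:R `^ s * pl_p n q.-1 `^ th); first by ring.
rewrite pE -powRrM powRD_pos //; congr (_ `^ _).
have -> : q%:R = x - 1 by rewrite xq -natr1 addrK.
rewrite [alpha * (x - 1)]mulrBr [alpha * (x - 2)]mulrBr alpha_x.
by field; rewrite gt_eqF.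
Qed.

End PowerLawIdentities.

(** * Asymptotics of the reference sequence *)

Lemma subz_natE (a : int) (q j : nat) : (q <= j)%N -> j%:Z <= a - 1 ->
  exists2 m : nat, a - q.+1%:Z = m%:Z & (j - q <= m)%N.
Proof. by move=> qj ja; exists `|a - q.+1%:Z|%N; lia. Qed.

Section PowerSumsMore.
Context {R : realType}.
Variables (i0 c s th : R).
Hypotheses (i0_gt0 : 0 < i0) (c_gt0 : 0 < c) (s_gt0 : 0 < s) (s_lt1 : s < 1).
Hypothesis thE : th = 1 - s.
Let th_gt0 : 0 < th. Proof. by rewrite thE subr_gt0. Qed.

Lemma plaw_int_ub y : 0 <= y -> plaw_int i0 c th y <= plaw i0 c s 1 * y.
Proof.
move=> y0; rewrite /plaw_int plawS addr0.
have := powR_tangent s_gt0 s_lt1 thE i0_gt0 (addr_ge0 (ltW i0_gt0) y0).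
rewrite addrAC subrr add0r -lerBlDl -(ler_pM2l (divr_gt0 c_gt0 th_gt0)).
by rewrite [X in _ <= X -> _](_ : _ = c * i0 `^ (- s) * y) //; field; rewrite gt_eqF.
Qed.

Lemma plaw_int_lb y : 0 <= y -> c * (i0 + y) `^ (- s) * y <= plaw_int i0 c th y.
Proof.
move=> y0; rewrite /plaw_int.
have y0' : 0 < i0 + y by rewrite ltr_pwDl.
have := powR_tangent s_gt0 s_lt1 thE y0' (ltW i0_gt0).
rewrite (_ : i0 - (i0 + y) = - y); last by ring.
rewrite mulrN => H.
have {}H := ler_wpM2l (ltW (divr_gt0 c_gt0 th_gt0)) H.
have E : c / th * (th * (i0 + y) `^ (- s) * y) = c * (i0 + y) `^ (- s) * y.
  by field; rewrite gt_eqF.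
by move: H; rewrite !mulrBr E; lra.
Qed.

Lemma powRN_add_ge (x y z : R) : 0 < x -> 0 < z -> 0 <= y <= z * x ->
  (1 - z) * x `^ (- s) <= (x + y) `^ (- s).
Proof.
move=> x0 z0 /andP[y0 yz].
have z1 : 0 < 1 + z by rewrite addr_gt0.
apply: (@le_trans _ _ ((1 + z)^-1 * x `^ (- s))).
  rewrite ler_wpM2r ?powR_ge0 // -[leRHS]mul1r ler_pdivlMr //.
  by rewrite mulrDr mulr1; have := mulr_ge0 (ltW z0) (ltW z0); lra.
apply: (@le_trans _ _ (((1 + z) * x) `^ (- s))).
  by apply: powRN_scale_ge => //; rewrite lerDl ltW.
by apply: powRN_le => //; rewrite ?ltr_wpDr // mulrDl mul1r lerD2l.
Qed.

End PowerSumsMore.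

Section Asymptotics.
Context {R : realType}.
Variables (beta d alpha : R).
Hypotheses (hb : 2 < beta) (hd : 0 < d) (ha : 0 < alpha < 1).
Implicit Types (n k : nat).
Local Open Scope classical_set_scope.

Local Notation s := (1 / (beta - 1)).
Local Notation th := ((beta - 2) / (beta - 1)).
Local Notation x := (pl_x beta alpha).
Local Notation M := (pl_M alpha).
Local Notation i0 := (pl_i0 beta d alpha).
Local Notation c := (pl_c beta d).
Local Notation gam := (pl_gamma beta d alpha).
Local Notation base := (pl_base beta d alpha).
Local Notation wbar := (pl_wbar beta d alpha).
Local Notation L n := (ln (ln (n%:R : R))).

Variable q : nat.
Hypotheses (q_gt0 : (0 < q)%N) (q_j1 : pl_j1 beta alpha = q.+1%:Z).
Hypotheses (q_le : q.+1%:R <= Num.max x 2) (q_gt : Num.max x 2 < q.+2%:R).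
Local Notation p := (pl_p beta d alpha q).

Let a0 : 0 < alpha. Proof. by case/andP: ha. Qed.
Let s_gt0 := pl_s_gt0 hb.
Let s_lt1 := pl_s_lt1 hb.
Let th_gt0 := pl_th_gt0 hb.
Let th_lt1 := pl_th_lt1 hb.
Let thE := pl_thE hb.
Let gam_gt0 : 0 < gam := pl_gamma_gt0 hb hd q_gt0 q_le q_gt.

(** This makes p_q polynomially smaller than n, so [base] tends to 0. *)
Lemma alpha_q : alpha * q%:R < 1.
Proof.
have [a a1 b] := And3 a0 (proj2 (andP ha)) hb.
have := q_le; rewrite le_max => /orP[qx|q2].
  have := alpha_x beta ha; have : alpha * q.+1%:R <= alpha * x by rewrite ler_pM2l.
  by rewrite -natr1 mulrDr; have := mulr_gt0 a (_ : 0 < beta - 2); nra.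
have q1 : q = 1%N by apply/eqP; rewrite eqn_leq q_gt0 andbT -ltnS -(ler_nat R).
by rewrite q1 mulr1.
Qed.

Lemma near_base_le e : 0 < e -> \forall n \near \oo, 0 < base n <= e.
Proof.
move=> e0; pose C := gam / d `^ (beta - 1).
have C0 : 0 < C by rewrite divr_gt0 // powR_gt0.
have t0 : alpha * q%:R - 1 < 0 by rewrite subr_lt0 alpha_q.
near=> n.
have n0 : (0 < n)%N by near: n; exact: nbhs_infty_gt.
rewrite (pl_base_gt0 hb hd q_gt0 q_j1 q_le q_gt n0) (pl_baseE _ q_j1) -/C /=.
rewrite mulrC -ler_pdivlMr //; near: n.
by apply: near_powR_le => //; rewrite divr_gt0.
Unshelve. all: by end_near. Qed.

Lemma pl_p_ge_q n k : (0 < n)%N -> base n <= 1 -> (q <= k)%N -> p n q <= p n k.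
Proof.
move=> n0 b1 qk; have b0 := pl_base_gt0 hb hd q_gt0 q_j1 q_le q_gt n0.
rewrite /pl_p ltnn ltnNge qk subnn expr0 /=.
rewrite ler_wpM2l ?mulr_ge0 ?powR_ge0 //; apply: ger_powR; first by rewrite b0.
by rewrite exprn_ile1 // ltW.
Qed.

Lemma near_i0_le e : 0 < e -> \forall n \near \oo, i0 n <= e * p n q.
Proof.
move=> e0; have t0 : alpha * (x - 2 - q%:R) < 0.
  rewrite pmulr_rlt0 // subr_lt0; have := x_lt q_gt; rewrite -natr1 -natr1; lra.
have k0 := kap_gt0 hb hd.
near=> n.
have n0 : (0 < n)%N by near: n; exact: nbhs_infty_gt.
have nR := natr_gt0 n0 (R := R).
rewrite (pl_i0E hb hd ha) // (pl_pq hb hd q_gt0 q_j1 q_le q_gt n0).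
have -> : n%:R `^ (alpha * (x - 2)) =
    n%:R `^ (alpha * (x - 2 - q%:R)) * n%:R `^ (alpha * q%:R) :> R.
  by rewrite powRD_pos // -mulrDr subrK.
rewrite !mulrA ler_wpM2r ?powR_ge0 // mulrC -ler_pdivlMr //.
near: n; apply: near_powR_le => //.
by rewrite divr_gt0 // mulr_gt0.
Unshelve. all: by end_near. Qed.

Lemma near_M_le e : 0 < e -> \forall n \near \oo, forall k, (1 < k)%N ->
  1 + M n <= e * p n k.
Proof.
move=> e0.
(* As M = n^alpha, it is enough to gain a fixed power n^t, uniformly in k >= 2. *)
suff [C [t [C0 t0 H]]] : exists C t, [/\ 0 < C, 0 < t & \forall n \near \oo,
    forall k, (1 < k)%N -> C * n%:R `^ (alpha + t) <= p n k].
  near=> n => k k1.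
  have n0 : (0 < n)%N by near: n; exact: nbhs_infty_gt.
  have nR := natr_gt0 n0 (R := R).
  have H1 : C * n%:R `^ (alpha + t) <= p n k by move: k k1; near: n.
  have H2 : 1 <= M n by near: n; exact: near_powR_ge.
  have H3 : 2 / (e * C) <= n%:R `^ t by near: n; exact: near_powR_ge.
  apply: le_trans (ler_wpM2l (ltW e0) H1); rewrite -powRD_pos //.
  have eC : 0 < e * C by rewrite mulr_gt0.
  move: H3; rewrite ler_pdivrMr // => H3.
  have := ler_wpM2r (le_trans ler01 H2) H3; rewrite /pl_M in H2 *; lra.
have [q1|q1] := ltnP 1 q.
  exists (Num.min 1 gam), alpha; split => //; first by rewrite lt_min ltr01.
  near=> n => k k1.
  have n0 : (0 < n)%N by near: n; exact: nbhs_infty_gt.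
  have nR : 1 <= n%:R :> R by rewrite ler1n.
  have b1 : 0 < base n <= 1 by near: n; exact: near_base_le.
  have mono l : (1 < l)%N -> n%:R `^ (alpha + alpha) <= n%:R `^ (alpha * l%:R) :> R.
    move=> l1; apply: ler_powR => //.
    rewrite (_ : alpha + alpha = alpha * 2%:R); last by ring.
    by rewrite ler_pM2l // ler_nat.
  have [kq|qk] := ltnP k q.
    rewrite pl_p_early //; apply: le_trans (mono _ k1).
    by rewrite ler_piMl ?powR_ge0 // ge_min lexx.
  apply: le_trans (pl_p_ge_q n0 (proj2 (andP b1)) qk).
  rewrite (pl_pq hb hd q_gt0 q_j1 q_le q_gt n0).
  by apply: ler_pM; rewrite ?powR_ge0 ?mono // ?ge_min ?lexx ?orbT // le_min ler01 ltW.
have q1' : q = 1%N by apply/eqP; rewrite eqn_leq q1 q_gt0.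
(* With q = 1 the second layer already obeys the late recursion: d n^s M^th has exponent s + alpha
   th = alpha + s (1 - alpha). *)
exists d, (s * (1 - alpha)); split => //.
  by rewrite mulr_gt0 // subr_gt0; case/andP: ha.
near=> n => k k1.
have n0 : (0 < n)%N by near: n; exact: nbhs_infty_gt.
have nR := natr_gt0 n0 (R := R).
have b1 : 0 < base n <= 1 by near: n; exact: near_base_le.
case: k k1 => [//|k] k1; have qk : (q <= k)%N by rewrite q1'.
rewrite (pl_p_lateS hb hd q_gt0 q_j1 q_le q_gt n0 qk) (pl_c_th _ hb).
have -> : alpha + s * (1 - alpha) = s + alpha * th.
  by rewrite [in RHS]thE; ring.
rewrite -(powRD_pos s (alpha * th) nR) [leLHS]mulrA ler_wpM2l ?mulr_ge0 ?powR_ge0 ?(ltW hd) //.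
rewrite powRrM; apply: le_powR; rewrite ?powR_ge0 ?(ltW th_gt0) //.
apply: le_trans (pl_p_ge_q n0 (proj2 (andP b1)) qk).
by rewrite [X in pl_p _ _ _ _ _ X]q1' (pl_p_1 hb hd q_gt0 q_j1 q_le q_gt n0).
Unshelve. all: by end_near. Qed.

Lemma near_early_ratio k e : 0 < e -> k.+2%:R < x ->
  \forall n \near \oo, n%:R `^ (alpha * k%:R) <= e * i0 n.
Proof.
move=> e0 kx; have k0 := kap_gt0 hb hd.
have t0 : alpha * (k.+2%:R - x) < 0 by rewrite pmulr_rlt0 // subr_lt0.
near=> n.
have n0 : (0 < n)%N by near: n; exact: nbhs_infty_gt.
have nR := natr_gt0 n0 (R := R).
rewrite (pl_i0E hb hd ha) //.
have -> : alpha * k%:R = alpha * (k.+2%:R - x) + alpha * (x - 2).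
  by rewrite -natr1 -natr1; ring.
rewrite -powRD_pos // mulrA ler_wpM2r ?powR_ge0 //.
by near: n; apply: near_powR_le => //; rewrite mulr_gt0.
Unshelve. all: by end_near. Qed.

Lemma early_x k : (0 < k < q)%N -> k.+2%:R < x \/ x = q.+1%:R /\ k.+1 = q.
Proof.
move=> /andP[k0 kq]; have q1 : (1 < q)%N by apply: leq_ltn_trans kq.
have := x_ge q_le q1; rewrite le_eqVlt => /predU1P[xq|xq].
  move: kq; rewrite leq_eqVlt => /predU1P[kq|kq]; first by right.
  by left; rewrite -xq ltr_nat.
by left; apply: le_lt_trans xq; rewrite ler_nat.
Qed.

(** If [i0] dominates, the first p_k weights agree with M up to a factor 1 - z. The one remaining
    layer is critical, and there the identities are exact. *)
Lemma near_early z k : 0 < z -> (0 < k < q)%N -> \forall n \near \oo,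
  [/\ (1 - z) * p n k.+1 <= plaw_int (i0 n) (c n) th (p n k) <= (1 + z) * p n k.+1,
      (1 - z) * wbar n k.+1 <= c n * (i0 n + p n k) `^ (- s)
    & c n * (i0 n + p n k) `^ (- s) <= wbar n k.+1].
Proof.
move=> z0 kq; have /andP[k0 kq'] := kq.
have [kx|[xq kE]] := early_x kq; last first.
  near=> n.
  have n0 : (0 < n)%N by near: n; exact: nbhs_infty_gt.
  have q1 : (1 < q)%N by rewrite -kE ltnS.
  have [wE pE] := pl_critical hb hd ha q_gt0 q_j1 q_le q_gt n0 xq q1.
  have kE' : k = q.-1 by rewrite -kE.
  rewrite -kE' kE in wE pE *; rewrite pE wE.
  have p0 := ltW (pl_p_gt0 hb hd q_gt0 q_j1 q_le q_gt q n0).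
  have C0 : 0 <= c n * (i0 n + p n k) `^ (- s).
    by rewrite mulr_ge0 ?powR_ge0 // ltW // pl_c_gt0.
  by rewrite -wE in C0 *; split; rewrite ?ler_piMl ?ler_peMl //; lra.
near=> n.
have n0 : (0 < n)%N by near: n; exact: nbhs_infty_gt.
have nR := natr_gt0 n0 (R := R).
have i0p : 0 < i0 n by exact: pl_i0_gt0.
have cp : 0 < c n by exact: pl_c_gt0.
have rat : p n k <= z * i0 n.
  by rewrite pl_p_early //; near: n; exact: near_early_ratio.
have pk := pl_p_gt0 hb hd q_gt0 q_j1 q_le q_gt k n0.
have M1 : plaw (i0 n) (c n) s 1 = M n by exact: plaw1.
have pS : p n k.+1 = M n * p n k.
  rewrite (pl_p_earlyS hb hd q_gt0 q_j1 q_le q_gt) // pl_p_early //.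
  by rewrite powRD_pos // -natr1; congr (_ `^ _); ring.
rewrite pl_wbar_early //.
have W : (1 - z) * M n <= c n * (i0 n + p n k) `^ (- s).
  rewrite -M1 plawS addr0 mulrCA ler_pM2l //.
  by apply: powRN_add_ge => //; rewrite (ltW pk).
split => //; last first.
  rewrite -M1 plawS addr0 ler_pM2l //; apply: powRN_le => //.
  by rewrite lerDl ltW.
apply/andP; split.
  apply: le_trans (plaw_int_lb i0p cp s_gt0 s_lt1 thE (ltW pk)).
  by rewrite pS mulrA ler_wpM2r // ltW.
apply: le_trans (plaw_int_ub i0p cp s_gt0 s_lt1 thE (ltW pk)) _.
rewrite M1 -pS ler_peMl ?lerDl ?(ltW z0) //.
by rewrite ltW // pl_p_gt0.
Unshelve. all: by end_near. Qed.

Lemma near_late z : 0 < z -> \forall n \near \oo, forall k, (q <= k)%N ->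
  [/\ p n k.+1 = c n / th * p n k `^ th, i0 n <= z * p n k,
      i0 n `^ th <= z * p n k `^ th,
      (1 - z) * wbar n k.+1 <= c n * (i0 n + p n k) `^ (- s)
    & c n * (i0 n + p n k) `^ (- s) <= wbar n k.+1].
Proof.
(* The second entry of the minimum serves the comparison of the th-th powers. *)
move=> z0; pose z' := Num.min z (z `^ th^-1).
have z'0 : 0 < z' by rewrite lt_min z0 powR_gt0.
near=> n => k qk.
have n0 : (0 < n)%N by near: n; exact: nbhs_infty_gt.
have i0p : 0 < i0 n by exact: pl_i0_gt0.
have cp : 0 < c n by exact: pl_c_gt0.
have pk := pl_p_gt0 hb hd q_gt0 q_j1 q_le q_gt k n0.
have b1 : 0 < base n <= 1 by near: n; exact: near_base_le.
have H : i0 n <= z' * p n k.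
  apply: (@le_trans _ _ (z' * p n q)); first by near: n; exact: near_i0_le.
  by rewrite ler_pM2l //; apply: pl_p_ge_q => //; case/andP: b1.
have Hz : i0 n <= z * p n k.
  by apply: le_trans H _; rewrite ler_pM2r // ge_min lexx.
rewrite (pl_wbar_late hb hd q_gt0 q_j1 q_le q_gt n0 qk).
split => //; first exact: pl_p_lateS.
- apply: (@le_trans _ _ ((z `^ th^-1 * p n k) `^ th)).
    apply: le_powR; [exact: ltW|exact: ltW|].
    by apply: le_trans H _; rewrite ler_pM2r // ge_min lexx orbT.
  rewrite powRM ?powR_ge0 ?(ltW pk) // -powRrM mulVf ?gt_eqF //.
  by rewrite powRr1 // ltW.
- rewrite mulrCA ler_pM2l // [i0 n + _]addrC.
  by apply: powRN_add_ge => //; rewrite Hz ltW.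
- by rewrite ler_pM2l //; apply: powRN_le => //; rewrite lerDr ltW.
Unshelve. all: by end_near. Qed.

Lemma pl_xi_gt0 : 0 < pl_xi beta d.
Proof.
apply: mulr_gt0; first by rewrite mulr_gt0.
by apply/powR_gt0/ltr_wpDl; first exact: powR_ge0.
Qed.

(** * Consequences of the definition of j_2 *)

Section UpToJ2.
Variables (omega : nat -> R) (j2 : nat -> int).
Hypothesis (homega : omega n @[n --> \oo] --> +oo).
Hypothesis hj2 : \forall n \near \oo, is_pl_j2 beta d alpha omega n (j2 n).

Lemma near_j2_cond (e : R) : e <= Num.max 2 ((beta - 1) ^+ 2) ->
  \forall n \near \oo,
  d `^ (beta - 1) * base n `^ (th ^ (j2 n - q.+1%:Z)) <= L n `^ (- e).
Proof.
move=> ee; near=> n.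
have [+ _] : is_pl_j2 beta d alpha omega n (j2 n) by near: n.
rewrite /pl_j2_cond q_j1 => /le_trans; apply.
have om : 1 <= omega n by near: n; move/cvgryPge : homega; apply.
have L1 : 1 <= L n by near: n; exact: near_lnln_ge.
have L0 : 0 < L n by exact: lt_le_trans L1.
rewrite !powRN lef_pV2 ?posrE ?powR_gt0 ?mulr_gt0 ?(lt_le_trans ltr01 om) //.
apply: (@le_trans _ _ (L n `^ Num.max 2 ((beta - 1) ^+ 2))); first exact: ler_powR.
apply: le_powR; rewrite ?(ltW L0) ?le_max ?ler0n //.
by rewrite ler_peMl // ltW.
Unshelve. all: by end_near. Qed.

(** For q <= j < j_2 the exponent j - q is at most j_2 - j_1, so the condition defining j_2 bounds
    p_j / n. For j < q the ratio is polynomially small in n. *)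
Lemma near_p_le (e : R) : 0 < e <= Num.max 2 ((beta - 1) ^+ 2) ->
  \forall n \near \oo, forall j : nat, j%:Z <= j2 n - 1 ->
  p n j <= n%:R * L n `^ (- e).
Proof.
move=> /andP[e0 ee]; have aq := alpha_q; have H := near_j2_cond ee.
have [N eN] : exists N : nat, e <= N%:R.
  by exists (Num.truncn e).+1; rewrite ltW // truncnS_gt.
near=> n => j jj2.
have n0 : (0 < n)%N by near: n; exact: nbhs_infty_gt.
have n1 : 1 <= n%:R :> R by rewrite ler1n.
have nR := natr_gt0 n0 (R := R).
have L1 : 1 <= L n by near: n; exact: near_lnln_ge.
have L0 : 0 < L n by exact: lt_le_trans L1.
have b1 : 0 < base n <= 1 by near: n; exact: near_base_le.
have [jq|qj] := ltnP j q.
  rewrite pl_p_early // powRN ler_pdivlMr ?powR_gt0 //.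
  have LN : L n ^+ N <= n%:R `^ (1 - alpha * q%:R).
    by near: n; apply: near_lnln_exp_le; rewrite subr_gt0.
  apply: (@le_trans _ _ (n%:R `^ (alpha * q%:R) * n%:R `^ (1 - alpha * q%:R))).
    apply: ler_pM; rewrite ?powR_ge0 //.
      by apply: ler_powR => //; rewrite ler_pM2l // ler_nat ltnW.
    apply: le_trans LN; rewrite -powR_mulrn ?(ltW L0) //; exact: ler_powR.
  by rewrite powRD_pos // addrC subrK powRr1 // ltW.
rewrite /pl_p ltnNge qj /= -mulrA ler_pM2l //.
have H1 : d `^ (beta - 1) * base n `^ (th ^ (j2 n - q.+1%:Z)) <= L n `^ (- e).
  by near: n; exact: H.
apply: le_trans H1; rewrite ler_pM2l ?powR_gt0 //; apply: ger_powR => //.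
have [m mE jm] := subz_natE qj jj2.
rewrite mE -exprnP; apply: ler_wiXn2l => //; exact: ltW.
Unshelve. all: by end_near. Qed.

Lemma near_p_small : \forall n \near \oo, forall j : nat, j%:Z <= j2 n - 1 ->
  p n j <= n%:R / L n ^+ 2.
Proof.
have e2 : 0 < (2 : R) <= Num.max 2 ((beta - 1) ^+ 2).
  by rewrite le_max lexx andbT.
have H := near_p_le e2; near=> n => j jj2.
have L1 : 1 <= L n by near: n; exact: near_lnln_ge.
have <- : L n `^ (- 2) = (L n ^+ 2)^-1 by rewrite powRN powR_mulrn // (le_trans ler01).
by move: j jj2; near: n; exact: H.
Unshelve. all: by end_near.
Qed.

(** Early weights are of order n^alpha. For late ones, p_(k+1) <= n L^(-e) is pulled back through
    the recursion to bound p_k, and wbar_(k+1) = c p_k^(-s). *)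
Lemma near_wbar_large : \forall n \near \oo, forall j : nat, (0 < j)%N ->
  j%:Z <= j2 n - 1 -> L n ^+ 3 <= wbar n j.
Proof.
pose e := (beta - 1) ^+ 2.
have ee : 0 < e <= Num.max 2 ((beta - 1) ^+ 2).
  by rewrite le_max lexx orbT andbT exprn_gt0 //; have := hb; lra.
pose C := d * th * d `^ (s / th).
have C0 : 0 < C by rewrite /C mulr_gt0 ?powR_gt0 // dth_gt0.
have P := near_p_le ee.
have xi0 := pl_xi_gt0.
near=> n => j j0 jj2.
have n0 : (0 < n)%N by near: n; exact: nbhs_infty_gt.
have nR := natr_gt0 n0 (R := R).
have L1 : 1 <= L n by near: n; exact: near_lnln_ge.
have L0 : 0 < L n by exact: lt_le_trans L1.
have [jq|qj] := leqP j q.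
  have [jx|jx] : wbar n j = M n \/ wbar n j = pl_xi beta d * M n.
  - case: j j0 jq {jj2} => [//|[|j]] _ jq; first by left; exact: pl_wbar1.
    have [kx|[xq kE]] := @early_x j.+1 jq; first by left; exact: pl_wbar_early.
    by right; apply: pl_wbar_critical; rewrite // xq kE.
  - by rewrite jx; near: n; exact: near_lnln_exp_le.
  have H1 : L n ^+ 3 <= n%:R `^ (alpha / 2).
    by near: n; apply: near_lnln_exp_le; rewrite divr_gt0.
  have H2 : (pl_xi beta d)^-1 <= n%:R `^ (alpha / 2).
    by near: n; apply: near_powR_ge; rewrite divr_gt0.
  have A0 : 0 <= n%:R `^ (alpha / 2) :> R := powR_ge0 _ _.
  rewrite jx /pl_M (splitr alpha) -(powRD_pos (alpha / 2) (alpha / 2) nR).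
  apply: le_trans H1 _; rewrite mulrA ler_peMl // -ler_pdivrMl // mulr1.
  exact: H2.
case: j j0 qj jj2 => // k _ qk jj2.
have cp : 0 < c n by exact: pl_c_gt0.
have pk := pl_p_gt0 hb hd q_gt0 q_j1 q_le q_gt k n0.
have Pk : p n k.+1 <= n%:R * L n `^ (- e) by move: (k.+1) jj2; near: n; exact: P.
rewrite (pl_wbar_late hb hd q_gt0 q_j1 q_le q_gt n0 qk).
rewrite (pl_p_lateS hb hd q_gt0 q_j1 q_le q_gt n0 qk) (pl_c_th _ hb) in Pk.
have Le := powR_ge0 (L n) (- e).
(* [Y] solves d n^s Y^th = n L^(-e). *)
pose Y := n%:R * (L n `^ (- e) / d) `^ th^-1.
have Y0 : 0 < Y by rewrite mulr_gt0 // powR_gt0 // divr_gt0 // powR_gt0.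
have pY : p n k <= Y.
  have H : p n k `^ th <= Y `^ th.
    rewrite powRM ?powR_ge0 // -powRrM mulVf ?gt_eqF //.
    rewrite powRr1 ?divr_ge0 ?(ltW hd) //.
    rewrite -(ler_pM2l (_ : 0 < d * n%:R `^ s)); last by rewrite mulr_gt0 ?powR_gt0.
    apply: le_trans Pk _.
    rewrite [leRHS](_ : _ = n%:R `^ s * n%:R `^ th * L n `^ (- e)); last first.
      by field; rewrite gt_eqF.
    rewrite (powRD_pos s th nR) [in s + _]thE [s + _]addrC subrK powRr1 //.
  have := le_powR (ltW (_ : 0 < th^-1)) (powR_ge0 _ _) H.
  rewrite invr_gt0 -!powRrM divff ?gt_eqF // !powRr1 ?(ltW Y0) ?(ltW pk) //.
  exact.
apply: (@le_trans _ _ (c n * Y `^ (- s))); last first.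
  by rewrite ler_pM2l //; exact: powRN_le.
have -> : c n * Y `^ (- s) = C * L n `^ (e * s / th).
  rewrite /Y powRM ?powR_ge0 // (powRM _ Le) ?invr_ge0 ?(ltW hd) //.
  have dE : (d^-1 `^ th^-1) `^ (- s) = d `^ (s / th).
    rewrite -powR_inv1 ?(ltW hd) // -!powRrM; congr (_ `^ _); ring.
  have LE : ((L n `^ (- e)) `^ th^-1) `^ (- s) = L n `^ (e * s / th).
    by rewrite -!powRrM; congr (_ `^ _); ring.
  rewrite powRM ?powR_ge0 // dE LE pl_cE.
  transitivity (d * th * (n%:R `^ s * n%:R `^ (- s)) * L n `^ (e * s / th) * d `^ (s / th)).
    by ring.
  by rewrite powRD_pos // subrr powRr0 mulr1 /C; ring.
(* The exponent is (beta - 1)^2 / (beta - 2), at least 4 because (beta - 3)^2 >= 0; one factor L is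
   then spent on the constant [C]. *)
have e4 : 4%:R <= e * s / th.
  have b2 : 0 < beta - 2 by have := hb; lra.
  have -> : e * s / th = (beta - 1) ^+ 2 / (beta - 2).
    by rewrite /e; field; rewrite !gt_eqF //; have := hb; lra.
  by rewrite ler_pdivlMr //; have := sqr_ge0 (beta - 3); rewrite !expr2; lra.
have CL : C^-1 <= L n by near: n; exact: near_lnln_ge.
have L4 : L n ^+ 4 <= L n `^ (e * s / th).
  by rewrite -powR_mulrn ?(ltW L0) //; exact: ler_powR.
apply: le_trans (ler_wpM2l (ltW C0) L4).
by rewrite [L n ^+ 4]exprS mulrA ler_peMl ?exprn_ge0 ?(ltW L0) // -ler_pdivrMl // mulr1.
Unshelve. all: by end_near. Qed.

(** With m = j_2 - j_1, the condition gives th^m (- ln base) >= 1, while - ln base <= 2 ln n; taking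
    logarithms bounds [m]. *)
Lemma near_j2_le : exists2 C : R, 0 < C & \forall n \near \oo, (j2 n)%:~R <= C * L n.
Proof.
have lt0 : ln th < 0 by rewrite ln_lt0 // th_gt0 th_lt1.
(* The first summand bounds j_2 - j_1, the second j_1. *)
pose C : R := 2 / - ln th + q.+1%:R.
have C0 : 0 < C by rewrite ltr_wpDl // divr_ge0 // oppr_ge0 ltW.
have e2 : 2%:R <= Num.max 2 ((beta - 1) ^+ 2) by rewrite le_max lexx.
have H := near_j2_cond e2.
exists C => //; near=> n.
have n0 : (0 < n)%N by near: n; exact: nbhs_infty_gt.
have nR := natr_gt0 n0 (R := R).
have L1 : 1 <= L n by near: n; exact: near_lnln_ge.
have L0 : 0 < L n by exact: lt_le_trans L1.
have [jq|qj] := leP (j2 n) q.+1%:Z.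
  apply: (@le_trans _ _ (q.+1%:R * L n)).
    apply: (@le_trans _ _ (q.+1%:R)); last by rewrite ler_peMr.
    by rewrite -[q.+1%:R]/(q.+1%:Z%:~R) ler_int.
  by rewrite ler_pM2r // lerDr divr_ge0 // oppr_ge0 ltW.
have [m mE] : exists m : nat, j2 n = (m + q.+1)%N%:Z.
  exists `|j2 n - q.+1%:Z|%N; clear -qj; lia.
have Hn : d `^ (beta - 1) * base n `^ (th ^ (j2 n - q.+1%:Z)) <= L n `^ (- 2%:R).
  by near: n; exact: H.
have b1 : 0 < base n <= 1 by near: n; exact: near_base_le.
have b0 : 0 < base n by case/andP: b1.
rewrite mE PoszD addrK -exprnP in Hn.
have B1 : base n `^ (th ^+ m) <= expR (-1).
  have : expR 1 / d `^ (beta - 1) <= L n by near: n; exact: near_lnln_ge.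
  rewrite ler_pdivrMr ?powR_gt0 // => eL.
  rewrite -(ler_pM2l (_ : 0 < d `^ (beta - 1))) ?powR_gt0 //.
  apply: le_trans Hn _; rewrite powRN powR_mulrn ?(ltW L0) // expRN.
  rewrite -[leRHS]/(_ / _) ler_pdivlMr ?expR_gt0 // mulrC ler_pdivrMr ?exprn_gt0 //.
  apply: le_trans eL _; rewrite mulrC ler_pM2l ?powR_gt0 // expr2 ler_peMl //.
  exact: ltW.
have B2 : 1 <= th ^+ m * - ln (base n).
  have : ln (base n `^ (th ^+ m)) <= ln (expR (-1)).
    by rewrite ler_ln ?posrE ?expR_gt0 ?powR_gt0.
  by rewrite ln_powR expRK mulrN; lra.
have B3 : - ln (base n) <= 2 * ln n%:R.
  pose G := gam / d `^ (beta - 1).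
  have G0 : 0 < G by rewrite divr_gt0 // powR_gt0.
  have GL : G^-1 <= n%:R by near: n; exact: near_natr_ge.
  have n1 : 1 <= n%:R :> R by rewrite ler1n.
  have bn : (n%:R ^+ 2)^-1 <= base n.
    rewrite (pl_baseE d q_j1) -/G exprS expr1 invfM; apply: ler_pM.
    - by rewrite invr_ge0 ltW.
    - by rewrite invr_ge0 ltW.
    - by rewrite -[leRHS]invrK lef_pV2 ?posrE ?invr_gt0.
    rewrite -powR_inv1 ?(ltW nR) //; apply: ler_powR => //.
    by rewrite lerBrDl subrr mulr_ge0 // ltW.
  have : ln ((n%:R ^+ 2)^-1) <= ln (base n).
    by rewrite ler_ln ?posrE ?invr_gt0 ?exprn_gt0.
  by rewrite lnV ?posrE ?exprn_gt0 // lnXn // mulr_natl; lra.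
have l0 : 0 < ln (n%:R : R).
  rewrite ltNge; apply/negP => l0; have := ln_le0 (le_trans l0 ler01); lra.
have thm : 0 < th ^+ m by rewrite exprn_gt0.
have B4 : 1 <= th ^+ m * (2 * ln n%:R).
  by apply: le_trans B2 _; rewrite ler_pM2l.
have B5 : m%:R * - ln th <= 2 * L n.
  have : 0 <= ln (th ^+ m * (2 * ln n%:R)) by rewrite ln_ge0.
  rewrite lnM ?posrE ?mulr_gt0 // lnM ?posrE // lnXn // -[ln th *+ m]mulr_natl.
  have : ln 2 <= 1 :> R.
    by have := le_ln1Dx (_ : -1 < (1 : R)); rewrite (_ : 1 + 1 = 2) //; apply; lra.
 by lra.
rewrite mE -[(m + q.+1)%:~R]/((m + q.+1)%:R) natrD /C mulrDl; apply: lerD.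
  by rewrite mulrAC ler_pdivlMr // oppr_gt0.
by rewrite ler_peMr.
Unshelve. all: by end_near. Qed.

End UpToJ2.
End Asymptotics.

(** * Bounds on the green number for a fixed n *)

Section FixedSize.
Context {R : realType}.
Variables (i0 c s th : R).
Hypotheses (i0_gt0 : 0 < i0) (c_gt0 : 0 < c) (s_gt0 : 0 < s) (s_lt1 : s < 1).
Hypothesis thE : th = 1 - s.
Variables (K n D : nat).
Local Notation w := (plaw i0 c s).
Hypothesis w_le : forall i, (0 < i)%N -> (Num.truncn (w i) <= D)%N.
Variables (p wb : nat -> R) (q j : nat) (eps z : R).
Hypotheses (eps_gt0 : 0 < eps) (eps_le : eps <= 1 / 2) (z_gt0 : 0 < z).
Hypotheses (z_q : 20 * z * q.+1%:R <= eps) (z_s : 20 * z <= s * eps).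
Hypotheses (p0 : p 0 = 1) (p1 : p 1 = w 1) (p_gt0 : forall k, 0 < p k).
Hypotheses (p1_large : 1 <= z * p 1)
  (p_large : forall k, (1 < k)%N -> 1 + w 1 <= z * p k).
Hypothesis p_early : forall k, (0 < k < q)%N ->
  (1 - z) * p k.+1 <= plaw_int i0 c th (p k) <= (1 + z) * p k.+1.
Hypothesis p_late : forall k, (q <= k)%N ->
  [/\ p k.+1 = c / th * p k `^ th, i0 <= z * p k & i0 `^ th <= z * p k `^ th].
Hypothesis q_gt0 : (0 < q)%N.
Hypothesis wb_plaw : forall k, (0 < k)%N ->
  (1 - z) * wb k.+1 <= c * (i0 + p k) `^ (- s).
Hypothesis plaw_wb : forall k, (0 < k)%N ->
  c * (i0 + p k) `^ (- s) <= wb k.+1.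
Hypotheses (wb0 : wb 0 = w 1) (wb1 : wb 1 = w 1).
Hypothesis wb_large : forall k, (k < j)%N -> 10 <= z * wb k.+1.
Hypotheses (j_gt0 : (0 < j)%N) (jK : (j <= K)%N) (n_gt0 : (0 < n)%N).
Implicit Types (X : outcome K n D) (k : nat).
Local Notation tol := (tol q eps).
Local Notation nodes X k := (node_count w X k).

Let w_ge0 : forall i, 0 <= w i. Proof. exact: plaw_ge0. Qed.

(** This holds for every outcome, since collisions, rounding and in-degrees can only lower the
    count. *)
Lemma nodes_ub X k : (k <= j)%N -> (nodes X k)%:R <= (1 + tol k) * p k.
Proof.
elim: k => [|k IH] kj.
  by rewrite node_count0 p0 mulr1 lerDl ltW // tol_gt0.
have kK := leq_trans kj jK.
apply: le_trans (growth_ub i0_gt0 c_gt0 s_gt0 s_lt1 thE eps_gt0 eps_le z_gt0 z_q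
  z_s p0 p1 p_gt0 p1_large p_large p_early p_late q_gt0 (IH (ltnW kj))).
apply: le_trans (lerD (lexx 1) (edge_count_ub w_ge0 w_le X kK)).
by rewrite addrC natr1 ler_nat node_count_le_edge.
Qed.

Lemma edges_ub X k : (k <= j)%N -> (edge_count w X k)%:R <= 2 * p k.
Proof.
have [eg el pk] := And3 eps_gt0 eps_le (p_gt0 k).
case: k pk => [|k] pk kj; first by rewrite edge_count0 mulr_ge0 // ltW.
have kK := leq_trans kj jK.
apply: le_trans (edge_count_ub w_ge0 w_le X kK) _.
have := growth_ub i0_gt0 c_gt0 s_gt0 s_lt1 thE eps_gt0 eps_le z_gt0 z_q
  z_s p0 p1 p_gt0 p1_large p_large p_early p_late q_gt0 (nodes_ub X (ltnW kj)).
have := tol_le q eps_gt0 k.+1; nra.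
Qed.

Definition few_collisions X : bool :=
  [forall k : 'I_j, (\sum_(l < k.+1) #|collided w X l|)%:R <= z * p k.+1].

Lemma nodes_lb X k : few_collisions X -> (k <= j)%N ->
  (1 - tol k) * p k <= (nodes X k)%:R.
Proof.
move=> /forallP few; elim: k => [|k IH] kj.
  by rewrite node_count0 p0 mulr1 gerBl ltW // tol_gt0.
have kK := leq_trans kj jK.
apply: (growth_lb i0_gt0 c_gt0 s_gt0 s_lt1 thE eps_gt0 eps_le z_gt0 z_q z_s p0 p1
  p_gt0 p1_large p_early p_late q_gt0 wb_plaw wb_large kj (D := nodes X k)).
  by rewrite IH 1?ltnW // nodes_ub // ltnW.
apply: le_trans (edge_count_lb w_ge0 w_le X kK) _.
(* Collisions are charged twice: once in replacing the new edge count by nodes, once for the old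
   edges that bound the in-degrees. *)
have := few (Ordinal kj); rewrite /=; set C := (\sum_(l < k.+1) _)%N => CS.
have E1 := edge_count_lt_node w X kK; rewrite -/C in E1.
have E0 : (edge_count w X k < nodes X k + C)%N.
  apply: leq_trans (edge_count_lt_node w X (ltnW kK)) _.
  by rewrite leq_add2l /C big_ord_recr leq_addr.
have := ltnW E1; have := ltnW E0; rewrite -!(ler_nat R) !natrD => H0 H1.
lra.
Qed.

(** Markov's inequality in each layer: the mean number of collided slots is at most (2p)^2 / n,
    against a threshold of z p. *)
Lemma card_many_collisions :
  #|[set X : outcome K n D | ~~ few_collisions X]|%:R <=
  \sum_(k < j) (4 * p k.+1 / (z * n%:R)) * #|outcome K n D|%:R.
Proof.
have zg := z_gt0; have nR : 0 < n%:R :> R by rewrite ltr0n.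
pose B (k : 'I_j) := [set X : outcome K n D |
  z * p k.+1 < (\sum_(l < k.+1) #|collided w X l|)%:R].
apply: (@le_trans _ _ (\sum_(k < j) #|B k|%:R)).
  rewrite -natr_sum ler_nat; apply: card_exists_le => X; rewrite inE.
  rewrite negb_forall => /existsP[k]; rewrite -ltNge => H; exists k => //.
  by rewrite inE.
apply: ler_sum => k _; have pk := p_gt0 k.+1.
rewrite mulrAC ler_pdivlMr ?mulr_gt0 //.
rewrite -(ler_pM2r pk).
pose W := Num.truncn (2 * p k.+1).
have WE : W%:R <= 2 * p k.+1 by rewrite truncn_le mulr_ge0 // ltW.
have EW X : (edge_count w X k.+1 <= W)%N.
  by rewrite truncn_ge_nat ?edges_ub ?mulr_ge0 // ltW.
have := sum_all_collided (leq_trans (ltn_ord k) jK) EW.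
rewrite -(ler_nat R) !natrM natr_sum => H.
apply: (@le_trans _ _ (W%:R * W%:R * #|outcome K n D|%:R)); last first.
  rewrite [leRHS](_ : _ = (2 * p k.+1) * (2 * p k.+1) * #|outcome K n D|%:R).
    by rewrite ler_wpM2r // ler_pM.
  by ring.
apply: le_trans H.
rewrite [leLHS](_ : _ = n%:R * (#|B k|%:R * (z * p k.+1))); last by ring.
rewrite ler_pM2l //.
rewrite mulr_natl -sumr_const big_mkcond; apply: ler_sum => X _.
by case: ifP => [|_]; rewrite ?ler0n // inE => /ltW.
Qed.

Lemma card_bad_le (m a : nat) (y : R) : 2 * p j / n%:R <= y -> 0 <= y -> (0 < m)%N ->
  #|[set X : outcome K n D | [exists k : 'I_j, bad w m a X k]]|%:R <=
  j%:R * m%:R ^+ j * 2 ^+ m * y ^+ a * #|outcome K n D|%:R.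
Proof.
move=> yp y0 m0; have nR : 0 < n%:R :> R by rewrite ltr0n.
pose W := Num.truncn (2 * p j).
have WE : W%:R <= y * n%:R.
  rewrite (@le_trans _ _ (2 * p j)) //; last by rewrite -ler_pdivrMr.
  by rewrite truncn_le mulr_ge0 // ltW.
have EW k X : (k < j)%N -> (#|edge_slots w X k| <= W)%N.
  move=> kj; apply: leq_trans (card_slots_le_count w X (_ : k < j <= K)%N) _.
    by rewrite kj.
  by rewrite truncn_ge_nat ?edges_ub ?mulr_ge0 // ltW.
apply: (@le_trans _ _ (\sum_(k < j) #|[set X : outcome K n D | bad w m a X k]|%:R)).
  rewrite -natr_sum ler_nat; apply: card_exists_le => X; rewrite inE.
  by move=> /existsP[k H]; exists k; rewrite // inE.
rewrite -!mulrA -[j in j%:R]card_ord mulr_natl -sumr_const; apply: ler_sum => k _.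
have := card_bad m a (ltnW (leq_trans (ltn_ord k) jK)) (fun X => EW k X (ltn_ord k)).
rewrite -(ler_nat R) !natrM !natrX => H.
rewrite -(ler_pM2l (exprn_gt0 a nR)); apply: le_trans H _.
rewrite [leRHS](_ : _ = m%:R ^+ j * 2 ^+ m * (y * n%:R) ^+ a * #|outcome K n D|%:R).
  rewrite ler_wpM2r // ler_pM // ?mulr_ge0 ?exprn_ge0 //.
    by rewrite ler_wpM2r ?exprn_ge0 // ler_weXn2l ?ler1n // ltnW.
  by rewrite lerXn2r // nnegrE // mulr_ge0.
by rewrite exprMn; ring.
Qed.

Lemma node_count_mono X k l : (k <= l <= K)%N -> (nodes X k <= nodes X l)%N.
Proof.
move=> /andP[]; elim: l => [|l IH]; first by rewrite leqn0 => /eqP ->.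
rewrite leq_eqVlt ltnS => /predU1P[-> //|kl] hl.
by rewrite node_countS // (leq_trans (IH kl (ltnW hl))) ?leq_addr.
Qed.

(** Weights decrease with the label, and labels before layer [j] are at most the number of nodes up
    to layer j - 1. *)
Lemma weight_ge X k u : (k < j)%N -> u \in pnodes (stage w X k) ->
  (1 - 2 * eps) * wb j <= w (node_label (stage w X k) u).
Proof.
have [eg el zg] := And3 eps_gt0 eps_le z_gt0.
have zs := z_small z_gt0 z_q q_gt0.
move=> kj /label_le /andP[l0 lk].
have [j1|j1] := leqP j 1.
  have jE : j = 1%N by apply/eqP; rewrite eqn_leq j1 j_gt0.
  have k0 : k = 0%N by move: kj; rewrite jE ltnS leqn0 => /eqP.
  move: l0 lk; rewrite k0 node_count0 => l0 l1.
  have -> : node_label (stage w X 0) u = 1%N.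
    by apply/eqP; rewrite eqn_leq l1 l0.
  by rewrite jE wb1; have := w_ge0 1; nra.
have jE : j = j.-1.+1 by rewrite prednK.
have wbj : 0 < wb j.
  have /wb_large : (j.-1 < j)%N by rewrite -jE.
  by rewrite -jE => H; rewrite -(pmulr_rgt0 _ zg); lra.
have dj : (nodes X k <= nodes X j.-1)%N.
  apply: node_count_mono; rewrite (leq_trans (leq_pred _) jK) andbT.
  by rewrite -ltnS -jE.
apply: (@le_trans _ _ (c * (i0 + (nodes X j.-1)%:R) `^ (- s))); last first.
  rewrite -plawS; apply: plaw_le => //.
  by apply: leq_trans lk _; apply: leqW.
have j10 : (0 < j.-1)%N by rewrite -ltnS -jE.
have := weight_at_ge i0_gt0 c_gt0 s_gt0 s_lt1 thE eps_gt0 eps_le z_gt0 p_gt0 wb_plaw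
  j10 (nodes_ub X (leq_pred j)).
rewrite -jE; apply: le_trans; rewrite ler_pM2r //.
have t1 := tol_le q eps_gt0 j.-1; have t0 := tol_gt0 q eps_gt0 j.-1.
by rewrite ler_pdivlMr; nra.
Qed.

(** Nodes of layer j - 1 are labelled after all nodes up to layer j - 2. For j <= 2 the largest
    weight of all is good enough. *)
Lemma weight_le X u : few_collisions X -> u \in pnodes (stage w X j.-1) ->
  depth u = j.-1 ->
  w (node_label (stage w X j.-1) u) <= (1 + 2 * eps) * wb j.-1.
Proof.
have [eg el zg] := And3 eps_gt0 eps_le z_gt0.
move=> few uS du; have /andP[l0 _] := label_le uS.
have [j2|j2] := leqP j 2.
  have -> : wb j.-1 = w 1 by move: j_gt0 j2; case: j => [|[|[|]]].
  apply: (@le_trans _ _ (w 1)); first exact: plaw_le.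
  by have := w_ge0 1; nra.
have [k jE] : exists k, j = k.+3 by exists (j - 3)%N; rewrite -addn3 subnK.
have kj : (k.+1 <= j)%N by rewrite jE ltnS -addn2 leq_addr.
have kK : (k.+1 < K)%N by apply: leq_trans jK; rewrite jE leqnSn.
rewrite jE /= in uS du l0 *.
have lg := label_gt kK uS du.
apply: (@le_trans _ _ (w (nodes X k.+1).+1)); first exact: plaw_le.
have t1 := tol_le q eps_gt0 k.+1; have t0 := tol_gt0 q eps_gt0 k.+1.
have pk := p_gt0 k.+1.
have tp : 0 < 1 - tol k.+1 <= 1 by apply/andP; split; lra.
have lb := nodes_lb few kj.
rewrite plawS; apply: (@le_trans _ _ (c * ((1 - tol k.+1) * (i0 + p k.+1)) `^ (- s))).
  rewrite ler_pM2l //; apply: powRN_le => //.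
    by apply: mulr_gt0; [case/andP: tp|exact: addr_gt0].
  rewrite mulrDr lerD // ler_piMl ?(ltW i0_gt0) //; by case/andP: tp.
apply: (@le_trans _ _ (c * ((1 - tol k.+1)^-1 * (i0 + p k.+1) `^ (- s)))).
  by rewrite ler_pM2l //; apply: powRN_scale_le => //; rewrite addr_gt0.
have W := @plaw_wb k.+1 isT.
have C0 : 0 <= c * (i0 + p k.+1) `^ (- s) by rewrite mulr_ge0 ?powR_ge0 // ltW.
rewrite mulrCA; apply: ler_pM => //.
  by rewrite invr_ge0; lra.
rewrite -[leLHS]mul1r ler_pdivrMr; nra.
Qed.

Section Bounds.
Variables (X : outcome K n D) (m a : nat) (del : R).
Hypothesis few : few_collisions X.
Hypothesis good : forall k, (k < j)%N -> ~~ bad w m a X k.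
Hypothesis m_wb : m%:R + 1 <= (1 - 2 * eps) * wb j.
Hypotheses (am : (a.*2 < m)%N) (del_m : (1 - del) * wb j + 1 <= m%:R - 2 * a%:R).
Hypothesis del_wb : (1 + 2 * eps) * wb j.-1 + 1 <= (1 + del) * wb j.-1.
Hypothesis wb_gt0 : 0 < wb j.-1.

Lemma green_number_bounds :
  let gj := green_number R (random_dag w X) None j in
  [/\ dist_layer (random_dag w X) None j != finset.set0,
      (1 - del) * wb j <= gj & gj <= (1 + del) * wb j.-1].
Proof.
have [eg el zg] := And3 eps_gt0 eps_le z_gt0; have wg := wb_gt0.
have m_le k u : (k < j)%N -> u \in pnodes (stage w X k) ->
    m%:R + 1 <= w (node_label (stage w X k) u).
  by move=> kj uk; apply: le_trans m_wb (weight_ge kj uk).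
rewrite /=; split.
- exact: (tree_dist_layer_neq0 w_ge0 w_le jK m_le good am).
- apply: lb_le_inf; last first.
    move=> r [r0 win]; rewrite leNgt; apply/negP => rlt.
    have := tree_not_greens_win w_ge0 w_le jK m_le good (r := r); apply => //.
    move=> t t0; have H := greens_rate_ub (ltW r0) t0.
    rewrite -(ltr_nat R) (natrB _ (ltnW am)).
    apply: lt_le_trans H _; rewrite -mul2n natrM; have := del_m; lra.
  (* A lower bound passes to the infimum only for a nonempty set; the rate that gives the upper
     bound is a witness. *)
  exists ((1 + 2 * eps) * wb j.-1 + 1); split; first by nra.
  rewrite -(prednK j_gt0).
  apply: (greens_win_of_weight w_ge0 (B := (1 + 2 * eps) * wb j.-1)).
  + by rewrite prednK.
  + by nra.
  + by lra.
  + by move=> u uS du; apply: weight_le.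
- apply: le_trans del_wb; apply: ge_inf.
    by exists 0 => r [/ltW].
  split; first by nra.
  rewrite -(prednK j_gt0).
  apply: (greens_win_of_weight w_ge0 (B := (1 + 2 * eps) * wb j.-1)).
  + by rewrite prednK.
  + by nra.
  + by lra.
  + by move=> u uS du; apply: weight_le.
Qed.

End Bounds.
End FixedSize.

(** * Conclusion *)

Section Assembly.
Context {R : realType}.
Local Open Scope classical_set_scope.

Lemma half_le_ln2 : 1 / 2 <= ln (2 : R).
Proof.
have : ln (2^-1 : R) <= - (1 / 2).
  have := @le_ln1Dx R (- (1 / 2)); rewrite (_ : 1 + - (1 / 2) = 2^-1); last by field.
  by apply; lra.
by rewrite lnV ?posrE //; lra.
Qed.

(** From ln m <= 2 sqrt m and 4 k <= sqrt m follows k ln m <= m / 2 <= m ln 2. *)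
Lemma expn_le_exp2 (m k : nat) : (16 * k ^ 2 <= m)%N -> (m ^ k <= 2 ^ m)%N.
Proof.
case: m => [|m]; first by case: k => [//|k]; rewrite leqn0 muln_eq0 expn_eq0.
move=> km; rewrite -(ler_nat R) !natrX.
have m0 : 0 < m.+1%:R :> R by [].
rewrite -ler_ln ?posrE ?exprn_gt0 // !lnXn //.
have l2 := half_le_ln2; pose r := m.+1%:R `^ (1 / 2) : R.
have r0 : 0 < r by rewrite powR_gt0.
have rE : r * r = m.+1%:R.
  by rewrite /r powRD_pos // (_ : 1 / 2 + 1 / 2 = 1) ?powRr1 //; field.
have lm : ln (m.+1%:R : R) <= 2 * r.
  have := ln_le_powR (_ : 0 < (1 / 2 : R)) m0; rewrite -/r invf_div divr1.
  by apply; rewrite divr_gt0.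
have kr : 4 * k%:R <= r.
  rewrite -(@ler_pXn2r R 2) // ?nnegrE ?(ltW r0) ?mulr_ge0 //.
  rewrite [r ^+ 2]expr2 rE; move: km; rewrite -(ler_nat R) natrM natrX exprMn.
  by rewrite (_ : (4 : R) ^+ 2 = 16) // expr2; ring.
rewrite -[leLHS]mulr_natl -[leRHS]mulr_natl.
apply: (@le_trans _ _ (k%:R * (2 * r))); first by rewrite ler_wpM2l.
apply: (@le_trans _ _ (m.+1%:R * (1 / 2))); last by rewrite ler_pM2l.
by rewrite -rE; nra.
Qed.

(** Take u n = 1/(k + 1) for the largest k <= n at which [P n] holds. The maximum is attained, and
    it eventually exceeds every fixed k. *)
Lemma diagonal (P : nat -> R -> Prop) :
  (forall e, 0 < e -> \forall n \near \oo, P n e) ->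
  exists2 u : nat -> R, u n @[n --> \oo] --> 0 & \forall n \near \oo, P n (u n).
Proof.
move=> HP; have pos k : 0 < (k.+1%:R)^-1 :> R by rewrite invr_gt0.
pose A n := [set k : 'I_n.+1 | `[< P n (k.+1%:R)^-1 >]]%SET.
pose top n := (\max_(k in A n) val k)%N.
exists (fun n => (top n).+1%:R^-1).
  apply/cvgrPdist_le => e e0; have [k ke] : exists k : nat, k.+1%:R^-1 <= e.
    exists (Num.truncn e^-1); rewrite -[leRHS]invrK lef_pV2 ?posrE ?invr_gt0 //.
    by rewrite ltW // truncnS_gt.
  near=> n; rewrite sub0r normrN ger0_norm ?(ltW (pos _)) //.
  apply: le_trans ke; rewrite lef_pV2 ?posrE // ler_nat ltnS.
  have kn : (k < n.+1)%N by near: n; exact: nbhs_infty_ge.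
  have Pk : P n (k.+1%:R)^-1 by near: n; exact: HP.
  rewrite -[leqLHS]/(val (Ordinal kn)); apply: leq_bigmax_cond.
  by rewrite inE; apply/asboolP.
near=> n; have P1 : P n (1%:R)^-1 by near: n; apply: HP; rewrite invr_gt0.
have A0 : (0 < #|A n|)%N.
  by rewrite card_gt0; apply/finset.set0Pn; exists ord0; rewrite inE; apply/asboolP.
have [k kA kE] := eq_bigmax_cond (fun k : 'I_n.+1 => val k) A0.
by rewrite /top kE; move: kA; rewrite inE => /asboolP.
Unshelve. all: by end_near. Qed.

Lemma tree_parameters (h B : R) (r : nat) : 0 < h -> h <= 1 / 20 -> 1000 <= B ->
  1 <= h * B -> (0 < r)%N -> h^-1 <= r%:R ->
  exists m a : nat, [/\ m%:R + 1 <= (1 - 2 * h) * B, (a.*2 < m)%N,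
    (1 - 20 * h) * B + 1 <= m%:R - 2 * a%:R, (m <= r * a)%N & B / 2 <= m%:R].
Proof.
(* [m] is the largest integer with m + 1 <= (1 - 2h) B. Taking [a] just above m / r, at most h m +
   1, costs another 2h; the slack up to 20h absorbs the roundings. *)
move=> h0 h20 B1000 hB r0 rh; set m := Num.truncn ((1 - 2 * h) * B - 1).
have mle : m%:R <= (1 - 2 * h) * B - 1 by rewrite truncn_le; nra.
have mge : (1 - 2 * h) * B - 2 < m%:R.
  by have := truncnS_gt ((1 - 2 * h) * B - 1); rewrite -/m -natr1; lra.
exists m, (m %/ r).+1; set a := (m %/ r).+1.
have aR : a%:R <= h * m%:R + 1.
  rewrite /a -natr1 lerD2r.
  have : (m %/ r * r <= m)%N by exact: leq_trunc_div.
  rewrite -(ler_nat R) natrM => H.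
  have : h * ((m %/ r)%:R * r%:R) <= h * m%:R by rewrite ler_pM2l.
  apply: le_trans; rewrite mulrCA ler_peMr //.
  by rewrite -ler_pdivrMl // mulr1.
have m0 := ler0n R m.
split; [lra| |nra|by rewrite mulnC ltnW // ltn_ceil|nra].
by rewrite -(ltr_nat R) -mul2n natrM; nra.
Qed.

(** Of the three factors 2 in 8, one pays for j m^j, one for the choice of subsets, and the third
    leaves 2^(-m) <= 1/m. *)
Lemma tree_failure_le (e y : R) (j m a r : nat) : 0 < e -> 2 / e <= m%:R ->
  (16 * j.+1 ^ 2 <= m)%N -> (m <= r * a)%N -> 0 <= y -> y * 8 ^+ r <= 1 ->
  j%:R * m%:R ^+ j * 2 ^+ m * y ^+ a <= e / 2.
Proof.
move=> e0 em jm ma y0 yr.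
have m0 : (0 < m)%N by apply: leq_trans jm; rewrite muln_gt0 expn_gt0.
have mR : 0 < m%:R :> R by rewrite ltr0n.
have H1 : j%:R * m%:R ^+ j <= 2 ^+ m :> R.
  rewrite -!natrX -natrM ler_nat; apply: leq_trans (expn_le_exp2 jm).
  rewrite expnS leq_mul2r; apply/orP; right; apply: leq_trans jm.
  by rewrite expnS expn1; lia.
have H2 : y ^+ a * 8 ^+ m <= 1.
  apply: (@le_trans _ _ (y ^+ a * 8 ^+ (r * a))).
    by rewrite ler_wpM2l ?exprn_ge0 // ler_weXn2l // ler1n.
  by rewrite exprM -exprMn exprn_ile1 // mulr_ge0 // exprn_ge0.
have H3 : m%:R <= 2 ^+ m :> R by rewrite -natrX ler_nat ltnW // ltn_expl.
have p2 : 0 < 2 ^+ m :> R by rewrite exprn_gt0.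
have E8 : 8 ^+ m = 2 ^+ m * 2 ^+ m * 2 ^+ m :> R.
  by rewrite -!exprMn; congr (_ ^+ _); ring.
rewrite -(ler_pM2r p2).
apply: (@le_trans _ _ (2 ^+ m * 2 ^+ m * y ^+ a * 2 ^+ m)).
  by rewrite ler_pM2r // ler_wpM2r ?exprn_ge0 // ler_wpM2r // ltW.
apply: (@le_trans _ _ 1).
  by move: H2; rewrite E8; apply: le_trans; rewrite le_eqVlt; apply/orP; left; apply/eqP; ring.
have : 2 / e <= 2 ^+ m by apply: le_trans em H3.
by rewrite ler_pdivrMr //; lra.
Qed.

Lemma prob_ge (Omega : finType) (E : Omega -> Prop) (B1 B2 : {set Omega}) (e1 e2 : R) :
  (0 < #|Omega|)%N -> (forall X, X \notin B1 -> X \notin B2 -> E X) ->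
  #|B1|%:R <= e1 * #|Omega|%:R -> #|B2|%:R <= e2 * #|Omega|%:R ->
  1 - (e1 + e2) <= prob R E.
Proof.
move=> O0 HE H1 H2; rewrite /prob ler_pdivlMr ?ltr0n //.
set A := [set X | _]%SET.
have sub : ~: A \subset B1 :|: B2.
  apply/fintype.subsetP => X; rewrite !inE; apply: contraNT; rewrite negb_or.
  by move=> /andP[X1 X2]; apply/asboolP; exact: HE.
have := leq_trans (subset_leq_card sub) (leq_card_setU _ _).
have := cardsC A; rewrite -(ler_nat R) natrD => <-; rewrite natrD; move: H1 H2.
have -> : #|Omega|%:R = #|A|%:R + #|~: A|%:R :> R by rewrite -natrD cardsC.
lra.
Qed.

End Assembly.

Section PowerLawGame.
Context {R : realType}.
Variables (beta d alpha : R).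
Hypotheses (hb : 2 < beta) (hd : 0 < d) (ha : 0 < alpha < 1).
Local Open Scope classical_set_scope.

Local Notation s := (1 / (beta - 1)).
Local Notation th := ((beta - 2) / (beta - 1)).
Local Notation x := (pl_x beta alpha).
Local Notation i0 := (pl_i0 beta d alpha).
Local Notation c := (pl_c beta d).
Local Notation wbar := (pl_wbar beta d alpha).
Local Notation L n := (ln (ln (n%:R : R))).

Lemma pl_j1P : exists q : nat, [/\ (0 < q)%N, pl_j1 beta alpha = q.+1%:Z,
  q.+1%:R <= Num.max x 2 & Num.max x 2 < q.+2%:R].
Proof.
have := floor_le (Num.max x 2); have := floorD1_gt (Num.max x 2).
have : 2%:Z <= Num.floor (Num.max x 2) by rewrite floor_ge_int le_max lexx orbT.
rewrite /pl_j1; case: (Num.floor _) => [[|[|q]]|q] // _ H1 H2.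
exists q.+1; split => //.
by move: H1; rewrite -[(_ + 1)%:~R]/((q.+2 + 1)%N%:~R) addn1.
Qed.

Variable q : nat.
Hypotheses (q_gt0 : (0 < q)%N) (q_j1 : pl_j1 beta alpha = q.+1%:Z).
Hypotheses (q_le : q.+1%:R <= Num.max x 2) (q_gt : Num.max x 2 < q.+2%:R).
Variables (omega : nat -> R) (j2 : nat -> int).
Hypothesis (homega : omega n @[n --> \oo] --> +oo).
Hypothesis hj2 : \forall n \near \oo, is_pl_j2 beta d alpha omega n (j2 n).
Local Notation p := (pl_p beta d alpha q).

(** c^(beta-1) = kap n, so the truncation depth is linear in n and lies beyond all layers
    considered. *)
Lemma near_depth C : \forall n \near \oo, C * L n <= (pl_depth beta d n)%:R.
Proof.
have k0 := kap_gt0 hb hd.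
have h0 : 0 < 1 / 2 :> R by rewrite divr_gt0.
near=> n.
have n0 : (0 < n)%N by near: n; exact: nbhs_infty_gt.
have nR := natr_gt0 n0 (R := R).
have L1 : 1 <= L n by near: n; exact: near_lnln_ge.
have Ln : L n ^+ 1 <= n%:R `^ (1 / 2) by near: n; exact: near_lnln_exp_le.
have Cn : C / kap beta d <= n%:R `^ (1 / 2) by near: n; exact: near_powR_ge.
apply: (@le_trans _ _ (pl_c beta d n `^ (beta - 1))); last first.
  by rewrite ltW // truncnS_gt.
have b1 : beta - 1 != 0 by rewrite gt_eqF //; have := hb; lra.
rewrite pl_cE powRM ?powR_ge0 ?(ltW (dth_gt0 hb hd)) // -powRrM divfK // powRr1 ?(ltW nR) //.
rewrite -/(kap beta d); rewrite ler_pdivrMr // in Cn; rewrite expr1 in Ln.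
apply: (@le_trans _ _ (n%:R `^ (1 / 2) * kap beta d * L n)).
  by rewrite ler_wpM2r //; lra.
apply: (@le_trans _ _ (n%:R `^ (1 / 2) * kap beta d * n%:R `^ (1 / 2))).
  by rewrite ler_wpM2l // mulr_ge0 ?powR_ge0 // ltW.
rewrite mulrAC powRD_pos // (_ : 1 / 2 + 1 / 2 = 1); last by field.
by rewrite powRr1 ?(ltW nR) // mulrC.
Unshelve. all: by end_near. Qed.

Definition green_event (n j : nat) (e : R) (X : pl_outcome beta d alpha n) : Prop :=
  let gj := green_number R (pl_dag X) (pl_source beta d n) j in
  dist_layer (pl_dag X) (pl_source beta d n) j != finset.set0 /\
  (1 - e) * wbar n j <= gj /\ gj <= (1 + e) * wbar n j.-1.

Lemma near_prob_ge (e : R) : 0 < e -> e <= 1 ->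
  \forall n \near \oo, forall j : nat, (1 <= j)%N -> j%:Z <= j2 n - 1 ->
    1 - e <= prob R (@green_event n j e).
Proof.
(* [tree_parameters] loses 20 h in total. *)
move=> e0 e1; pose h := e / 20.
have h0 : 0 < h by rewrite divr_gt0.
have h20 : h <= 1 / 20 by rewrite /h; lra.
have h2 : h <= 1 / 2 by lra.
have cube (l : R) : 10 <= l -> 1000 <= l ^+ 3.
  by move=> l10; rewrite !exprS expr0 mulr1; nra.
have hE : e = 20 * h by rewrite /h; field.
have [s0 s1] := (pl_s_gt0 hb, pl_s_lt1 hb).
have thE := pl_thE hb.
(* The largest [z] allowed by the two budget conditions of the growth estimates. *)
pose z := Num.min (h / (20 * q.+1%:R)) (s * h / 20).
have z0 : 0 < z.
  by rewrite lt_min; apply/andP; split; apply: divr_gt0 => //; exact: mulr_gt0.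
have zq : 20 * z * q.+1%:R <= h.
  have : z <= h / (20 * q.+1%:R) by rewrite ge_min lexx.
  by rewrite ler_pdivlMr ?mulr_gt0 //; lra.
have zs : 20 * z <= s * h.
  have : z <= s * h / 20 by rewrite ge_min lexx orbT.
  by rewrite ler_pdivlMr //; lra.
have [r r0 rh] : exists2 r : nat, (0 < r)%N & h^-1 <= r%:R.
  by exists (Num.truncn h^-1).+1 => //; rewrite ltW // truncnS_gt.
have [C C0 HC] := near_j2_le hb hd ha q_gt0 q_j1 q_le q_gt homega hj2.
have square (l : R) : 10 <= l -> 32 * C ^+ 2 <= l -> 16 * (C * l) ^+ 2 <= l ^+ 3 / 2.
  move=> l10 lC; rewrite (_ : 16 * (C * l) ^+ 2 = l ^+ 2 / 2 * (32 * C ^+ 2)); last by field.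
  rewrite (_ : l ^+ 3 / 2 = l ^+ 2 / 2 * l); last by field.
  by rewrite ler_wpM2l // divr_ge0 // sqr_ge0.
have widen (u : R) : 1 <= h * u -> (1 + 2 * h) * u + 1 <= (1 + 20 * h) * u by lra.
have halve (l : R) : 8 * C <= l * (z * e) -> 4 * C <= e / 2 * (z * l).
  by rewrite (_ : e / 2 * (z * l) = l * (z * e) / 2); [lra|field].
have HE : \forall n \near \oo, forall k, (k < q)%N -> (0 < k)%N ->
  [/\ (1 - z) * p n k.+1 <= plaw_int (i0 n) (c n) th (p n k) <= (1 + z) * p n k.+1,
      (1 - z) * wbar n k.+1 <= c n * (i0 n + p n k) `^ (- s)
    & c n * (i0 n + p n k) `^ (- s) <= wbar n k.+1].
  apply: near_bounded => k kq; have [->|k0] := posnP k; first by near=> n.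
  have kk : (0 < k < q)%N by rewrite k0.
  by apply: filterS (near_early hb hd ha q_gt0 q_j1 q_le q_gt z0 kk) => n H _.
have HL := near_late hb hd ha q_gt0 q_j1 q_le q_gt z0.
have HM := near_M_le hb hd ha q_gt0 q_j1 q_le q_gt z0.
have HP := near_p_small hb hd ha q_gt0 q_j1 q_le q_gt homega hj2.
have HW := near_wbar_large hb hd ha q_gt0 q_j1 q_le q_gt homega hj2.
have HK := near_depth C.
have a0 : 0 < alpha by case/andP: ha.
near=> n => j j1 jj2.
have n0 : (0 < n)%N by near: n; exact: nbhs_infty_gt.
have nR := natr_gt0 n0 (R := R).
have early : forall k, (k < q)%N -> (0 < k)%N ->
  [/\ (1 - z) * p n k.+1 <= plaw_int (i0 n) (c n) th (p n k) <= (1 + z) * p n k.+1,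
      (1 - z) * wbar n k.+1 <= c n * (i0 n + p n k) `^ (- s)
    & c n * (i0 n + p n k) `^ (- s) <= wbar n k.+1] by near: n; exact: HE.
have late : forall k, (q <= k)%N ->
  [/\ p n k.+1 = c n / th * p n k `^ th, i0 n <= z * p n k,
      i0 n `^ th <= z * p n k `^ th,
      (1 - z) * wbar n k.+1 <= c n * (i0 n + p n k) `^ (- s)
    & c n * (i0 n + p n k) `^ (- s) <= wbar n k.+1] by near: n; exact: HL.
have Mp : forall k, (1 < k)%N -> 1 + pl_M alpha n <= z * p n k by near: n; exact: HM.
have psmall : forall k : nat, k%:Z <= j2 n - 1 -> p n k <= n%:R / L n ^+ 2.
  by near: n; exact: HP.
have wlarge : forall k : nat, (0 < k)%N -> k%:Z <= j2 n - 1 -> L n ^+ 3 <= wbar n k.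
  by near: n; exact: HW.
have j2C : (j2 n)%:~R <= C * L n by near: n; exact: HC.
have KC : C * L n <= (pl_depth beta d n)%:R by near: n; exact: HK.
have L10 : 10 <= L n by near: n; exact: near_lnln_ge.
have LC : 32 * C ^+ 2 <= L n by near: n; exact: near_lnln_ge.
have Lz : 10 / z <= L n by near: n; exact: near_lnln_ge.
have Lh : h^-1 <= L n by near: n; exact: near_lnln_ge.
have Le : 2 / e * 2 <= L n by near: n; exact: near_lnln_ge.
have Lr : 2 * 8 ^+ r <= L n by near: n; exact: near_lnln_ge.
have LCz : 8 * C / (z * e) <= L n by near: n; exact: near_lnln_ge.
have p1z : z^-1 <= pl_M alpha n by near: n; exact: near_powR_ge.
have L0 : 0 < L n by exact: lt_le_trans L10.
have L1 : 1 <= L n by apply: le_trans L10; rewrite ler1n.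
have L3 : L n <= L n ^+ 3 by rewrite -[leLHS]expr1 ler_weXn2l.
have i0p : 0 < i0 n by exact: pl_i0_gt0.
have cp : 0 < c n by exact: pl_c_gt0.
have M1 : plaw (i0 n) (c n) s 1 = pl_M alpha n by exact: plaw1.
have wbj k : (k < j)%N -> L n ^+ 3 <= wbar n k.+1.
  move=> kj; apply: wlarge => //; apply: le_trans jj2.
  by rewrite lez_nat.
have j1R : j%:R + 1 <= C * L n.
  have : (j%:Z + 1)%:~R <= (j2 n)%:~R :> R by rewrite ler_int -lerBrDr.
  by rewrite intrD => H; exact: le_trans H j2C.
have jK : (j <= pl_depth beta d n)%N.
  by rewrite -(ler_nat R); apply: le_trans KC; apply: le_trans j1R; rewrite lerDl.
have wle i : (0 < i)%N -> (Num.truncn (plaw (i0 n) (c n) s i) <= pl_width beta d alpha n)%N.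
  by move=> ip; apply: le_truncn; exact: pl_w_le_w1.
have pk0 k : 0 < p n k by exact: pl_p_gt0.
have p1E : p n 1 = plaw (i0 n) (c n) s 1 by rewrite M1; exact: pl_p_1.
have p1l : 1 <= z * p n 1 by rewrite p1E M1 -ler_pdivrMl // mulr1.
have plarge k : (1 < k)%N -> 1 + plaw (i0 n) (c n) s 1 <= z * p n k.
  by rewrite M1; exact: Mp.
have pearly k : (0 < k < q)%N ->
    (1 - z) * p n k.+1 <= plaw_int (i0 n) (c n) th (p n k) <= (1 + z) * p n k.+1.
  by move=> /andP[k0 kq]; case: (early k kq k0).
have plate k : (q <= k)%N ->
    [/\ p n k.+1 = c n / th * p n k `^ th, i0 n <= z * p n k
      & i0 n `^ th <= z * p n k `^ th].
  by move=> /late[].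
have wbp k : (0 < k)%N -> (1 - z) * wbar n k.+1 <= c n * (i0 n + p n k) `^ (- s).
  move=> k0; have [kq|qk] := ltnP k q; first by case: (early k kq k0).
  by case: (late k qk).
have pwb k : (0 < k)%N -> c n * (i0 n + p n k) `^ (- s) <= wbar n k.+1.
  move=> k0; have [kq|qk] := ltnP k q; first by case: (early k kq k0).
  by case: (late k qk).
have wb0 : wbar n 0 = plaw (i0 n) (c n) s 1 by rewrite M1.
have wb1 : wbar n 1 = plaw (i0 n) (c n) s 1 by rewrite M1.
have wbl k : (k < j)%N -> 10 <= z * wbar n k.+1.
  move=> /wbj H; rewrite mulrC -ler_pdivrMr //.
  by apply: le_trans Lz _; apply: le_trans L3 H.
have wbj1 : L n ^+ 3 <= wbar n j.-1.
  case: j j1 {jj2 j1R jK wbl} wbj => [//|[|j]] _ wbj; last exact: (wbj j (leqnSn _)).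
  by rewrite /= wb0 -wb1; exact: wbj.
have wbjj : L n ^+ 3 <= wbar n j.
  by have := wbj j.-1; rewrite prednK //; apply.
pose B := wbar n j.
have L1000 := cube _ L10.
have B1000 : 1000 <= B := le_trans L1000 wbjj.
have hB : 1 <= h * B.
  rewrite -ler_pdivrMl // mulr1; apply: le_trans Lh _; exact: le_trans L3 wbjj.
have [m [a [mwb am delm ra mB]]] := tree_parameters h0 h20 B1000 hB r0 rh.
rewrite -hE in delm.
have m0 : (0 < m)%N by apply: leq_ltn_trans am.
have wbpos : 0 < wbar n j.-1 by apply: lt_le_trans wbj1; rewrite exprn_gt0.
have delwb : (1 + 2 * h) * wbar n j.-1 + 1 <= (1 + e) * wbar n j.-1.
  have : 1 <= h * wbar n j.-1.
    rewrite -ler_pdivrMl // mulr1; apply: le_trans Lh _; exact: le_trans L3 wbj1.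
  by rewrite hE; exact: widen.
have O0 : (0 < #|pl_outcome beta d alpha n|)%N.
  by rewrite card_ffun card_ord expn_gt0 n0.
pose w := plaw (i0 n) (c n) s.
pose B1 := [set X : pl_outcome beta d alpha n | [exists k : 'I_j, bad w m a X k]]%SET.
pose B2 := [set X : pl_outcome beta d alpha n | ~~ few_collisions (i0 n) (c n) s (p n) j z X]%SET.
(* Half of the error goes to the trees that lose too many children, half to layers with too many
   collisions. *)
have -> : e = e / 2 + e / 2 by field.
apply: (prob_ge (B1 := B1) (B2 := B2)) => //.
- move=> X; rewrite !inE negb_exists negbK => /forallP good few.
  have := green_number_bounds i0p cp s0 s1 thE wle h0 h2 z0 zq zs
    (pl_p0 beta d alpha q_gt0 n) p1E pk0 p1l plarge pearly plate q_gt0 wbp pwb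
    wb0 wb1 wbl j1 jK few (fun k kj => good (Ordinal kj)) mwb am delm delwb wbpos.
  by rewrite -splitr => -[? ? ?].
- pose y := 2 / L n ^+ 2.
  have y0 : 0 <= y by rewrite divr_ge0 // exprn_ge0 // ltW.
  have yp : 2 * p n j / n%:R <= y.
    rewrite ler_pdivrMr // /y mulrAC -mulrA ler_pM2l //; exact: psmall.
  have := card_bad_le i0p cp s0 s1 thE wle h0 h2 z0 zq zs
    (pl_p0 beta d alpha q_gt0 n) p1E pk0 p1l plarge pearly plate q_gt0 jK n0 a yp y0 m0.
  move/le_trans; apply; rewrite ler_wpM2r //.
  apply: (tree_failure_le (r := r)) => //.
  + apply: le_trans mB; rewrite ler_pdivlMr //; apply: le_trans wbjj.
    apply: le_trans L3; exact: Le.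
  + rewrite -(ler_nat R) natrM natrX; apply: le_trans mB.
    apply: (@le_trans _ _ (L n ^+ 3 / 2)); last by rewrite ler_pM2r // invr_gt0.
    apply: le_trans (square _ L10 LC); rewrite ler_pM2l // lerXn2r // ?nnegrE //.
      by rewrite mulr_ge0 // ltW.
    by rewrite -natr1.
  + rewrite /y mulrAC ler_pdivrMr ?exprn_gt0 // mul1r.
    by apply: le_trans Lr _; rewrite -[leLHS]expr1 ler_weXn2l.
- have := card_many_collisions i0p cp s0 s1 thE wle h0 h2 z0 zq zs
    (pl_p0 beta d alpha q_gt0 n) p1E pk0 p1l plarge pearly plate q_gt0 jK n0.
  move/le_trans; apply; rewrite -mulr_suml ler_wpM2r //.
  (* Each layer contributes O(1/L^2) and there are at most C L layers, so the sum is O(1/L). *)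
  apply: (@le_trans _ _ (\sum_(k < j) (4 / (z * L n ^+ 2)))).
    apply: ler_sum => k _; rewrite ler_pdivrMr ?mulr_gt0 //.
    rewrite [leRHS](_ : _ = 4 * (n%:R / L n ^+ 2)); last first.
      by field; rewrite !gt_eqF.
    rewrite ler_pM2l //; apply: psmall; apply: le_trans jj2.
    by rewrite lez_nat.
  rewrite sumr_const card_ord -[leLHS]mulr_natl.
  apply: (@le_trans _ _ (C * L n * (4 / (z * L n ^+ 2)))).
    rewrite ler_wpM2r ?divr_ge0 ?mulr_ge0 ?exprn_ge0 ?(ltW z0) ?(ltW L0) //.
    by apply: le_trans j1R; rewrite lerDl.
  rewrite [leLHS](_ : _ = 4 * C / (z * L n)); last by field; rewrite !gt_eqF.
  rewrite ler_pdivrMr ?mulr_gt0 //; move: LCz; rewrite ler_pdivrMr ?mulr_gt0 //.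
  exact: halve.
Unshelve. all: by end_near. Qed.

End PowerLawGame.

Local Open Scope classical_set_scope.

Theorem theorem3p2 (R : realType) (beta d alpha : R)
    (hbeta : 2 < beta) (hd : 0 < d) (halpha : 0 < alpha < 1)
    (omega : nat -> R) (homega : omega n @[n --> \oo] --> +oo)
    (j2 : nat -> int)
    (hj2 : \forall n \near \oo, is_pl_j2 beta d alpha omega n (j2 n)) :
  (exists C : R, \forall n \near \oo, (j2 n)%:~R <= C * ln (ln n%:R)) /\
  exists lo hi : nat -> R,
    lo n @[n --> \oo] --> 0 /\ hi n @[n --> \oo] --> 0 /\
    forall delta : R, 0 < delta ->
    \forall n \near \oo, forall j : nat, (1 <= j)%N -> j%:Z <= j2 n - 1 ->
      1 - delta <= prob R (fun X : pl_outcome beta d alpha n =>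
        let G := pl_dag X in
        let v := pl_source beta d n in
        let gj := green_number R G v j in
        dist_layer G v j != finset.set0 /\
        (1 + lo n) * pl_wbar beta d alpha n j <= gj /\
        gj <= (1 + hi n) * pl_wbar beta d alpha n j.-1).
Proof.
have [q [q_gt0 q_j1 q_le q_gt]] := pl_j1P beta alpha.
split.
  have [C _ HC] := near_j2_le hbeta hd halpha q_gt0 q_j1 q_le q_gt homega hj2.
  by exists C.
pose P n e := forall j : nat, (1 <= j)%N -> j%:Z <= j2 n - 1 ->
  1 - e <= prob R (@green_event R beta d alpha n j e).
(* The estimate covers e <= 1, so the property is made vacuous for larger e; this costs nothing as u
   n tends to 0. *)
have [e e0|u u0 Pu] := @diagonal R (fun n e => e <= 1 -> P n e).
  have [e1|e1] := leP e 1; last by near=> n.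
  apply: filterS (near_prob_ge hbeta hd halpha q_gt0 q_j1 q_le q_gt homega hj2 e0 e1).
  by move=> n H _.
exists (fun n => - u n), u; split; first by rewrite -oppr0; exact: cvgN.
split=> // delta delta0; near=> n => j j1 jj2.
have ud : `|0 - u n| <= Num.min delta 1.
  by near: n; move/cvgrPdist_le : u0; apply; rewrite lt_min delta0 ltr01.
have {ud} : u n <= Num.min delta 1.
  by apply: le_trans ud; rewrite sub0r normrN ler_norm.
rewrite le_min => /andP[ud u1].
have H : u n <= 1 -> P n (u n) by near: n.
by apply: le_trans (H u1 j j1 jj2); rewrite lerD2l lerN2.
Unshelve. all: by end_near. Qed.
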